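(* Let $N\ge7$, $p=\frac{N+2}{N-2}$ and $\frac{N(N-2)}{4}<\lambda<\left(\frac{N-1}{2}\right)^2$. Then the equation $$-\Delta_{\mathbb{B}^N}u-\lambda u=|u|^{p-1}u\quad\text{in }\mathbb{B}^N,\qquad u\in H^1(\mathbb{B}^N),$$ has at least two pairs (of the form $\pm u$) of non-trivial radial solutions.
   Context: $\mathbb{B}^N=\{x\in\mathbb{R}^N:|x|<1\}$ is the ball model of hyperbolic space, with metric $g_{ij}=\left(\frac{2}{1-|x|^2}\right)^2\delta_{ij}$, volume $dV_{\mathbb{B}^N}=\left(\frac{2}{1-|x|^2}\right)^N dx$, and Laplace-Beltrami operator $\Delta_{\mathbb{B}^N}=\left(\frac{1-|x|^2}{2}\right)^2\Delta+(N-2)\frac{1-|x|^2}{2}\langle x,\nabla\cdot\rangle$. $H^1(\mathbb{B}^N)$ is the Sobolev space of this Riemannian manifold, with squared norm $\int_{\mathbb{B}^N}(|\nabla_{\mathbb{B}^N}u|^2_{\mathbb{B}^N}+u^2)\,dV_{\mathbb{B}^N}$, where $|\nabla_{\mathbb{B}^N}u|^2_{\mathbb{B}^N}=\left(\frac{1-|x|^2}{2}\right)^2|\nabla u|^2$. Solutions are understood in the weak sense. Radial means depending only on $|x|$. *)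

(* Defs.v *)
From HB Require Import structures.
From mathcomp Require Import all_boot all_order all_algebra.
From mathcomp Require Import all_classical all_reals all_analysis.

Set Implicit Arguments.
Unset Strict Implicit.
Unset Printing Implicit Defensive.
Import Order.TTheory GRing.Theory Num.Theory.
Import numFieldNormedType.Exports.

Local Open Scope classical_set_scope.
Local Open Scope ring_scope.

(* Points of R^N are row vectors; 'rV[R]_N carries the product sigma-algebra
   (defined as the library does for N.-tuple R), which is the Borel one. *)
Section measurable_rV.
Context (R : realType) (n : nat).

Let coors : 'I_n -> 'rV[R]_n -> R := fun i x => x ord0 i.

Let rV_set0 : g_sigma_preimage coors set0.
Proof. exact: sigma_algebra0. Qed.

Let rV_setC A : g_sigma_preimage coors A -> g_sigma_preimage coors (~` A).
Proof. exact: sigma_algebraC. Qed.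

Let rV_bigcup (F : _^nat) : (forall i, g_sigma_preimage coors (F i)) ->
  g_sigma_preimage coors (\bigcup_i F i).
Proof. exact: sigma_algebra_bigcup. Qed.

HB.instance Definition _ :=
  @isMeasurable.Build (measure_tuple_display default_measure_display)
    'rV[R]_n (g_sigma_preimage coors) rV_set0 rV_setC rV_bigcup.

End measurable_rV.

Lemma measurable_rV_coord (R : realType) n (i : 'I_n) :
  measurable_fun [set: 'rV[R]_n] (fun x => x ord0 i).
Proof.
move=> _ Y mY; rewrite setTI; apply: sub_sigma_algebra => /=.
rewrite -bigcup_seq/=; exists i => /=; first by rewrite mem_index_enum.
by exists Y => //; rewrite setTI.
Qed.

Lemma measurable_fun_rV d (T : measurableType d) (R : realType) n
    (f : T -> 'rV[R]_n) :
  (forall i, measurable_fun [set: T] (fun t => f t ord0 i)) ->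
  measurable_fun [set: T] f.
Proof.
move=> mf; apply: (@measurability _ _ _ _ _ _
  (\big[setU/set0]_(i < n) preimage_set_system setT
    (fun x : 'rV[R]_n => x ord0 i) measurable)) => //.
move=> _ [A + <-]; rewrite -bigcup_seq => -[i _ [B mB <-]].
by rewrite setTI; exact: mf.
Qed.

Section lebesgue_rV_succ.
Context (R : realType) (n : nat).
Variable mu : {sigma_finite_measure set 'rV[R]_n -> \bar R}.

Definition rV_cons (tx : R * 'rV[R]_n) : 'rV[R]_n.+1 :=
  row_mx (tx.1%:M : 'rV_1) tx.2.

Definition rV_uncons (x : 'rV[R]_n.+1) : R * 'rV[R]_n :=
  (x ord0 ord0, \row_i x ord0 (lift ord0 i)).

Lemma rV_consK : cancel rV_cons rV_uncons.
Proof.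
move=> [t x]; rewrite /rV_uncons /rV_cons /=; congr pair.
  by rewrite mxE; case: splitP => // j _; rewrite mxE !ord1 eqxx mulr1n.
apply/rowP => i; rewrite !mxE; case: splitP => j /=.
  by rewrite ord1.
by rewrite /bump/= !add1n => -[/val_inj ->].
Qed.

Lemma measurable_rV_cons : measurable_fun [set: R * 'rV[R]_n] rV_cons.
Proof.
apply: measurable_fun_rV => i; rewrite /rV_cons.
case: (@split_ordP 1 n i) => j ->.
  under eq_fun do rewrite (@row_mxEl _ 1 1 n) mxE !ord1 eqxx mulr1n.
  exact: measurable_fst.
under eq_fun do rewrite (@row_mxEr _ 1 1 n).
exact: (measurableT_comp (measurable_rV_coord j) measurable_snd).
Qed.

Lemma measurable_rV_uncons : measurable_fun [set: 'rV[R]_n.+1] rV_uncons.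
Proof.
apply: measurable_fun_pair; first exact: measurable_rV_coord.
apply: measurable_fun_rV => i; under eq_fun do rewrite mxE.
exact: measurable_rV_coord.
Qed.

Definition lebesgue_rV_succ : set 'rV[R]_n.+1 -> \bar R :=
  pushforward (@lebesgue_measure R \x mu)%E rV_cons.

Let lebesgue_rV_succ0 : lebesgue_rV_succ set0 = 0%E.
Proof. by rewrite /lebesgue_rV_succ /pushforward preimage_set0 measure0. Qed.

Let lebesgue_rV_succ_ge0 A : (0 <= lebesgue_rV_succ A)%E.
Proof. by rewrite /lebesgue_rV_succ /pushforward; exact: measure_ge0. Qed.

Let lebesgue_rV_succ_sigma_additive : semi_sigma_additive lebesgue_rV_succ.
Proof.
move=> F mF tF mUF; rewrite /lebesgue_rV_succ /pushforward preimage_bigcup.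
apply: measure_semi_sigma_additive => //.
- by move=> k; rewrite -[X in measurable X]setTI; exact: measurable_rV_cons.
- apply/trivIsetP => /= i j _ _ ij; rewrite -preimage_setI.
  by move/trivIsetP : tF => ->//; rewrite preimage_set0.
- rewrite -preimage_bigcup -[X in measurable X]setTI.
  exact: measurable_rV_cons.
Qed.

HB.instance Definition _ := isMeasure.Build _ _ _ lebesgue_rV_succ
  lebesgue_rV_succ0 lebesgue_rV_succ_ge0 lebesgue_rV_succ_sigma_additive.

Let lebesgue_rV_succ_sigma_finite : sigma_finite setT lebesgue_rV_succ.
Proof.
have /sigma_finiteP[F [TF ndF Foo]] := sigma_finiteT (@lebesgue_measure R).
have /sigma_finiteP[G [TG ndG Goo]] := sigma_finiteT mu.
exists (fun k => rV_uncons @^-1` (F k `*` G k)).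
  apply/esym; rewrite -subTset => x _.
  have [i _ Fi] : (\bigcup_i F i) (rV_uncons x).1 by rewrite -TF.
  have [j _ Gj] : (\bigcup_i G i) (rV_uncons x).2 by rewrite -TG.
  exists (maxn i j) => //; split.
    by move: Fi; exact/subsetPset/ndF/leq_maxl.
  by move: Gj; exact/subsetPset/ndG/leq_maxr.
move=> k; have [mFk Fkoo] := Foo k; have [mGk Gkoo] := Goo k; split.
  rewrite -[X in measurable X]setTI; apply: measurable_rV_uncons => //.
  exact: measurableX.
rewrite /lebesgue_rV_succ /pushforward -comp_preimage.
rewrite (_ : _ \o _ = id) ?preimage_id; last first.
  by apply/funext => x; exact: rV_consK.
by rewrite product_measure1E// lte_mul_pinfty// ge0_fin_numE.
Qed.

HB.instance Definition _ := Measure_isSigmaFinite.Build _ _ _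
  lebesgue_rV_succ lebesgue_rV_succ_sigma_finite.

End lebesgue_rV_succ.

Section lebesgue_rV0.
Context (R : realType).

Definition lebesgue_rV0 : set 'rV[R]_0 -> \bar R := \d_(0 : 'rV[R]_0).

HB.instance Definition _ := Measure.on lebesgue_rV0.

Let lebesgue_rV0_sigma_finite : sigma_finite setT lebesgue_rV0.
Proof.
apply: fin_num_fun_sigma_finite; first by rewrite measure0.
by move=> A mA; rewrite /lebesgue_rV0 diracE.
Qed.

HB.instance Definition _ := Measure_isSigmaFinite.Build _ _ _
  lebesgue_rV0 lebesgue_rV0_sigma_finite.

End lebesgue_rV0.

(* N-dimensional Lebesgue measure, as an iterated product measure *)
Fixpoint lebesgue_rV (R : realType) (n : nat) :
    {sigma_finite_measure set 'rV[R]_n -> \bar R} :=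
  match n with
  | 0 => @lebesgue_rV0 R
  | n'.+1 => lebesgue_rV_succ (lebesgue_rV R n')
  end.

Section ball_model.
Context (R : realType) (N : nat).
Implicit Types (x y : 'rV[R]_N) (u f phi : 'rV[R]_N -> R).
Implicit Types g : 'rV[R]_N -> 'rV[R]_N.

Local Notation leb := (lebesgue_rV R N).

Definition edot x y : R := \sum_(i < N) x ord0 i * y ord0 i.

(* Not `|x|, which is the sup norm on row vectors *)
Definition enorm x : R := Num.sqrt (edot x x).

Definition hball : set 'rV[R]_N := [set x | enorm x < 1].

Definition conformal_factor x : R := 2 / (1 - enorm x ^+ 2).

(* dV = (2 / (1 - |x|^2))^N dx on hball *)
Definition hintegrable f : Prop :=
  leb.-integrable hball (fun x => (f x * conformal_factor x ^+ N)%:E).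

Definition hintegral f : R :=
  \int[leb]_(x in hball) (f x * conformal_factor x ^+ N).

(* For v and w Euclidean gradients at x of two functions, this is the
   Riemannian inner product of their hyperbolic gradients. *)
Definition hgrad_dot x v w : R := ((1 - enorm x ^+ 2) / 2) ^+ 2 * edot v w.

Definition partial (i : 'I_N) f : 'rV[R]_N -> R :=
  fun x => 'D_(delta_mx ord0 i) f x.

Definition grad f : 'rV[R]_N -> 'rV[R]_N := fun x => \row_i partial i f x.

Fixpoint is_Ck (k : nat) f : Prop :=
  match k with
  | 0 => continuous f
  | k'.+1 => forall i : 'I_N,
      (forall x, derivable f x (delta_mx ord0 i)) /\ is_Ck k' (partial i f)
  end.

(* C_c^oo(hball), each function being extended by 0 to the whole space *)
Definition test_function phi : Prop :=
  (forall k, is_Ck k phi) /\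
  exists K : set 'rV[R]_N,
    [/\ compact K, K `<=` hball & forall x, ~ K x -> phi x = 0].

Definition L1loc f : Prop :=
  forall K : set 'rV[R]_N, compact K -> K `<=` hball ->
    leb.-integrable K (EFin \o f).

Definition weak_gradient u g : Prop :=
  [/\ L1loc u,
      forall i : 'I_N, L1loc (fun x => g x ord0 i) &
      forall phi, test_function phi -> forall i : 'I_N,
        \int[leb]_(x in hball) (u x * partial i phi x) =
        - \int[leb]_(x in hball) (g x ord0 i * phi x)].

Definition H1 u : Prop :=
  exists2 g, weak_gradient u g &
    hintegrable (fun x => hgrad_dot x (g x) (g x) + u x ^+ 2).

(* Green's formula for the Laplace-Beltrami operator reads
     - \int (Delta u) phi dV = \int <grad u, grad phi> dV. *)
Definition weak_solution (lambda p : R) u : Prop :=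
  exists g,
    [/\ weak_gradient u g,
        L1loc (fun x => `|u x| `^ (p - 1) * u x) &
        forall phi, test_function phi ->
          hintegral (fun x => hgrad_dot x (g x) (grad phi x))
            - lambda * hintegral (fun x => u x * phi x) =
          hintegral (fun x => `|u x| `^ (p - 1) * u x * phi x)].

Definition radial u : Prop :=
  forall x y, hball x -> hball y -> enorm x = enorm y -> u x = u y.

(* Equality almost everywhere on hball, i.e. as elements of H1; dV and dx have
   the same null sets there. *)
Definition hae_eq u f : Prop := {ae leb, forall x, hball x -> u x = f x}.

Definition nontrivial_radial_solution (lambda p : R) u : Prop :=
  [/\ H1 u, weak_solution lambda p u, radial u & ~ hae_eq u (fun=> 0)].

End ball_model.

(* Main.v *)
(* Write u(x) = U(t), with t the hyperbolic distance from x to the origin: the equation becomes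
   U'' + (N - 1) coth t U' + lambda U + |U|^(p-1) U = 0, with U(0) = a and U'(0) = 0.
   Since lambda < ((N - 1) / 2)^2, a solution that stays positive near infinity decays, and
   either it is trapped in the region U' + (N - 1)/2 U > 0, which is stable under perturbation
   of a, or it decays faster than e^(- (N - 1) t / 2), which is what H^1 requires. Hence U decays
   fast at the infimum of the set of all a for which U takes a negative value, and at the infimum
   of the set of all a for which U takes a negative and later a positive value: the former
   profile is positive, the latter changes sign. Both sets are nonempty: in Emden-Fowler
   coordinates the energy increases because lambda > N (N - 2) / 4, and for N >= 7 and a large
   the energy gained after the first bubble forces two sign changes. *)
Require Import Defs.
From mathcomp Require Import all_boot all_order all_algebra.
From mathcomp Require Import all_classical all_reals all_analysis.
From mathcomp Require Import measurable_realfun ring lra.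
Import Order.TTheory GRing.Theory Num.Theory.
Import numFieldNormedType.Exports.
Local Open Scope ring_scope.

(** The condition [N >= 7] decides a race. A first bubble at the scale [expR s], with [s] very
    negative, gains an energy of order [expR (2 * s)], so [w] crosses the axis with a speed of order
    [expR s] at least. With [nu = (N - 2) / 2], it needs a time of about [- s / nu] to sink to the
    axis and as long again to climb back to height one. The second bubble thus sits near
    [s * (1 - 2 / nu)], which is still very negative when [nu > 2]. The rate [nu] is available only
    up to a small loss, whence the chain [nu1 < nu3 < nu2 < nu]. The passage from profiles to weak
    solutions uses neither polar coordinates nor the divergence theorem. Identities are integrated
    along lines parallel to a coordinate axis, where one-variable calculus applies; the line of each
    direction that meets the origin, where the Euclidean norm is not smooth, is negligible. Likewise
    the finiteness of the energy comes from a bound on the measure of dyadic shells. *)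

Notation der f x d := (is_derive (x : _) (1 : _) (f : _ -> _) d).
Notation cont f x := (continuous_at (x : _) (f : _ -> _)).

(** * One-variable calculus *)

Section Calculus.
Context {R : realType}.
Implicit Types (f g phi : R -> R) (a b c d x y : R).

Lemma derE {f x a b} : der f x a -> a = b -> der f x b.
Proof. by move=> H <-. Qed.

Lemma der_unique {f x a b} : der f x a -> der f x b -> a = b.
Proof. by move=> [_ <-] [_ <-]. Qed.

Lemma derC c x : der (fun _ : R => c) x 0.
Proof. exact: is_derive_cst. Qed.

Lemma derI x : der (fun y : R => y) x 1.
Proof. exact: is_derive_id. Qed.

Lemma derD f g x a b : der f x a -> der g x b -> der (fun y => f y + g y) x (a + b).
Proof. by move=> ? ?; exact: is_deriveD. Qed.

Lemma derN f x a : der f x a -> der (fun y => - f y) x (- a).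
Proof. by move=> ?; exact: is_deriveN. Qed.

Lemma derM f g x a b : der f x a -> der g x b ->
  der (fun y => f y * g y) x (a * g x + f x * b).
Proof.
move=> df dg; have /derE := is_deriveM df dg; apply.
by rewrite addrC /GRing.scale /= [g x * _]mulrC.
Qed.

Lemma derX f n x a : der f x a ->
  der (fun y => f y ^+ n) x (n%:R * f x ^+ n.-1 * a).
Proof.
move=> H; elim: n => [|n IH]; first by rewrite !mul0r; exact: derC.
rewrite (_ : (fun y => _) = (fun y => f y * f y ^+ n)); last by apply/funext => y; rewrite exprS.
apply: derE (derM _ _ _ _ _ H IH) _ => /=.
case: n IH => [|n] _ /=; first by ring.
by rewrite -[in RHS]natr1 exprS; ring.
Qed.

Lemma der_comp f g x a b : der f (g x) a -> der g x b -> der (fun y => f (g y)) x (a * b).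
Proof. by move=> df dg; have /derE := is_derive1_comp df dg; apply; rewrite mulrC. Qed.

Lemma derV f x a : der f x a -> f x != 0 -> der (fun y => (f y)^-1) x (- a / f x ^+ 2).
Proof.
move=> df fx; have /derE := is_deriveV fx df; apply.
by rewrite /GRing.scale /= -exprVn; ring.
Qed.

Lemma der_expR f x a : der f x a -> der (fun y => expR (f y)) x (expR (f x) * a).
Proof. by move=> H; exact: (der_comp (@expR R) f x _ _ (is_derive_expR _) H). Qed.

Lemma der_ln f x a : der f x a -> 0 < f x -> der (fun y => ln (f y)) x (a / f x).
Proof.
move=> H fx; have K := der_comp (@ln R) f x _ _ (is_derive1_ln fx) H.
by apply: (derE K); rewrite mulrC.
Qed.

Lemma der_cont {f x a} : der f x a -> cont f x.
Proof.
by move=> [H _]; apply: differentiable_continuous; exact/derivable1_diffP.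
Qed.

Lemma contP {f x} : cont f x <->
  (forall e, 0 < e -> exists2 r, 0 < r & forall y, `|y - x| < r -> `|f y - f x| < e).
Proof.
split => [cf e e0|H].
  have /cvgrPdist_lt/(_ e e0) := cf.
  move=> /nbhs_ballP [r /= r0 rP]; exists r => // y yx.
  by rewrite distrC; apply: rP; rewrite /ball /= distrC.
apply/cvgrPdist_lt => e e0; have [r r0 rP] := H e e0.
apply/nbhs_ballP; exists r => //= y.
by rewrite /ball /= distrC => yx; rewrite distrC; exact: rP.
Qed.

Lemma contN f x : cont f x -> cont (fun y => - f y) x.
Proof. by move=> ?; apply: continuousN. Qed.
Lemma contD f g x : cont f x -> cont g x -> cont (fun y => f y + g y) x.
Proof. by move=> ? ?; apply: continuousD. Qed.
Lemma contM f g x : cont f x -> cont g x -> cont (fun y => f y * g y) x.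
Proof. by move=> ? ?; apply: continuousM. Qed.
Lemma contC c x : cont (fun _ : R => c) x.
Proof. exact: cst_continuous. Qed.
Lemma contI x : cont (fun y : R => y) x.
Proof. by []. Qed.
Lemma cont_comp f g x : cont f (g x) -> cont g x -> cont (fun y => f (g y)) x.
Proof. by move=> ? ?; apply: continuous_comp. Qed.
Lemma contX f n x : cont f x -> cont (fun y => f y ^+ n) x.
Proof. by move=> cf; apply: (@cont_comp (fun y => y ^+ n) f) => //; exact: exprn_continuous. Qed.
Lemma contV f x : cont f x -> f x != 0 -> cont (fun y => (f y)^-1) x.
Proof. by move=> cf fx; exact: (continuousV fx cf). Qed.
Lemma cont_norm f x : cont f x -> cont (fun y => `|f y|) x.
Proof. by move=> cf; apply: continuous_comp => //; exact: norm_continuous. Qed.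

Lemma cont_within f a b : (forall x, a <= x <= b -> cont f x) ->
  {within `[a, b], continuous f}%classic.
Proof.
move=> cf; apply: continuous_in_subspaceT => x /[!inE] /=.
by rewrite in_itv /=; exact: cf.
Qed.

Lemma mean_value {f a b} {f' : R -> R} : a < b ->
  (forall x, a <= x <= b -> cont f x) ->
  (forall x, a < x < b -> der f x (f' x)) ->
  exists2 c, a < c < b & f b - f a = f' c * (b - a).
Proof.
move=> ab cf df.
have df' x : x \in `]a, b[ -> der f x (f' x) by rewrite in_itv /=; exact: df.
have [c + ->] := MVT ab df' (cont_within _ _ _ cf).
by rewrite in_itv /=; exists c.
Qed.

Lemma mono_le {f a b} (f' : R -> R) : a <= b ->
  (forall x, a <= x <= b -> cont f x) ->
  (forall x, a < x < b -> der f x (f' x)) ->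
  (forall x, a < x < b -> 0 <= f' x) -> f a <= f b.
Proof.
rewrite le_eqVlt => /predU1P[-> //|ab] cf df f'0.
have [c cab E] := mean_value ab cf df.
by rewrite -subr_ge0 E mulr_ge0 ?f'0// subr_ge0 ltW.
Qed.

Lemma mono_lt {f a b} (f' : R -> R) : a < b ->
  (forall x, a <= x <= b -> cont f x) ->
  (forall x, a < x < b -> der f x (f' x)) ->
  (forall x, a < x < b -> 0 < f' x) -> f a < f b.
Proof.
move=> ab cf df f'0.
have [c cab E] := mean_value ab cf df.
by rewrite -subr_gt0 E mulr_gt0 ?f'0// subr_gt0.
Qed.

(** [c] is the infimum of the points where [phi] is nonnegative; continuity excludes both signs of
    [phi c]. *)
Lemma first_crossing {phi a b} : a <= b ->
  (forall x, a <= x <= b -> cont phi x) -> phi a < 0 -> 0 <= phi b ->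
  exists c, [/\ a < c <= b, phi c = 0 & forall x, a <= x < c -> phi x < 0].
Proof.
move=> ab cf fa fb.
pose S : set R := [set x | a <= x <= b /\ 0 <= phi x]%classic.
have Sb : S b by rewrite /S /= lexx ab.
have Slb : lbound S a by move=> x [] /andP[].
have Sinf : has_inf S by split; [exists b|exists a].
set c := inf S.
have ac : a <= c by apply: lb_le_inf => //; exists b.
have cb : c <= b by apply: (ge_inf Sinf.2).
have below x : a <= x < c -> phi x < 0.
  move=> /andP[ax xc]; rewrite ltNge; apply/negP => fx.
  have : c <= x; last by rewrite leNgt xc.
  apply: (ge_inf Sinf.2); split => //.
  by rewrite ax /= (le_trans (ltW xc)).
have fc : phi c = 0.
  apply/eqP; rewrite eq_le; apply/andP; split; rewrite leNgt; apply/negP => fc.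
    have ac' : a < c.
      by rewrite lt_neqAle ac andbT; apply/eqP => E; move: fa; rewrite E ltNge (ltW fc).
    have /contP/(_ _ fc)[r r0 rP] : cont phi c by apply: cf; rewrite ac cb.
    pose x := Num.max a (c - r / 2).
    have xc : x < c by rewrite /x gt_max ac' /= ltrBlDr ltrDl divr_gt0.
    have ax : a <= x by rewrite /x le_max lexx.
    have := below x; rewrite ax xc => /(_ isT).
    have : `|x - c| < r.
      rewrite distrC gtr0_norm ?subr_gt0//.
      have : c - r / 2 <= x by rewrite /x le_max lexx orbT.
      by move: r0 => r0 ?; lra.
    by move=> /rP; rewrite ltr_norml => /andP[]; lra.
  have fc' : 0 < - phi c by rewrite oppr_gt0.
  have /contP/(_ _ fc')[r r0 rP] : cont phi c by apply: cf; rewrite ac cb.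
  have : c + r <= c; last by rewrite gerDl leNgt r0.
  apply: lb_le_inf; first by exists b.
  move=> x [/andP[ax xb] fx]; rewrite leNgt; apply/negP => xcr.
  have cx : c <= x by apply: (ge_inf Sinf.2); split; rewrite ?ax.
  have : `|x - c| < r by rewrite ger0_norm ?subr_ge0// ltrBlDl.
  by move=> /rP; rewrite ltr_norml => /andP[]; lra.
exists c; split => //; rewrite cb andbT lt_neqAle ac andbT.
by apply/eqP => E; move: fa; rewrite E fc ltxx.
Qed.

Lemma last_crossing {phi a b} : a <= b ->
  (forall x, a <= x <= b -> cont phi x) -> 0 <= phi a -> phi b < 0 ->
  exists c, [/\ a <= c < b, phi c = 0 & forall x, c < x <= b -> phi x < 0].
Proof.
move=> ab cf fa fb.
have [||||c [acb fc H]] := @first_crossing (fun x => phi (- x)) (- b) (- a).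
- by rewrite lerN2.
- move=> x xab; apply: (@cont_comp phi -%R); first by apply: cf; lra.
  exact: opp_continuous.
- by rewrite opprK.
- by rewrite opprK.
exists (- c); split => //; first by move: acb; lra.
by move=> x xc; rewrite -[x]opprK; apply: H; move: xc; lra.
Qed.

Lemma der_lt0_near {f x d} : der f x d -> d < 0 ->
  exists2 r, 0 < r & forall y, `|y - x| < r -> (x < y -> f y < f x) /\ (y < x -> f x < f y).
Proof.
move=> [fd E] d0.
have /cvgrPdist_lt/(_ (- d)) := fd; rewrite oppr_gt0 => /(_ d0).
rewrite -/(derive f x 1) E /=.
move=> /nbhs_ballP[r /= r0 rP]; exists r => // y yx.
have key : y != x -> (f y - f x) / (y - x) < 0.
  move=> yxn.
  have := rP (y - x); rewrite /ball /= sub0r normrN => /(_ yx).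
  rewrite subr_eq0 => /(_ yxn).
  rewrite /GRing.scale /= !mulr1 subrK ltr_norml => /andP[].
  by rewrite mulrC => ? ?; lra.
split => xy.
- have /key : y != x by rewrite gt_eqF.
  by rewrite ltr_pdivrMr ?subr_gt0// mul0r subr_lt0.
- have /key : y != x by rewrite lt_eqF.
  by rewrite ltr_ndivrMr ?subr_lt0// mul0r subr_gt0.
Qed.

Lemma der_ge0_left {f x d a} : der f x d -> a < x ->
  (forall y, a < y < x -> f y <= f x) -> 0 <= d.
Proof.
move=> fd ax H; rewrite leNgt; apply/negP => d0.
have [r r0 rP] := der_lt0_near fd d0.
pose y := Num.max ((a + x) / 2) (x - r / 2).
have y1 : (a + x) / 2 <= y by rewrite /y le_max lexx.
have y2 : x - r / 2 <= y by rewrite /y le_max lexx orbT.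
have yx : y < x by rewrite /y gt_max; apply/andP; split; lra.
have [|_ /(_ yx)] := rP y; first by rewrite ltr_norml; apply/andP; split; lra.
by apply/negP; rewrite -leNgt H//; apply/andP; split; lra.
Qed.

(** At a first zero the left difference quotients are nonnegative, so a negative derivative is
    impossible there. The derivative only has to be controlled at such a zero; the invariance of
    every trapping region below is proved in this way. *)
Lemma barrier {phi a b} :
  (forall x, a <= x <= b -> cont phi x) -> phi a < 0 ->
  (forall c, a < c <= b -> (forall x, a <= x < c -> phi x < 0) -> phi c = 0 ->
     exists2 d, der phi c d & d < 0) ->
  forall x, a <= x <= b -> phi x < 0.
Proof.
move=> cf fa H x /andP[ax xb]; rewrite ltNge; apply/negP => fx.
have [|c [/andP[ac cx] fc below]] := @first_crossing phi a x ax _ fa fx.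
  by move=> y /andP[ay yx]; apply: cf; rewrite ay (le_trans yx).
have [|d dc d0] := H c _ below fc; first by rewrite ac (le_trans cx).
suff : 0 <= d by rewrite leNgt d0.
by apply: der_ge0_left dc ac _ => y /andP[ay yc]; rewrite fc ltW// below// (ltW ay).
Qed.

End Calculus.

(** The derivative is left as an existential variable and synthesized from the shape of the
    function; [derE] then leaves an algebraic identity. The cases [GRing.mul ?c], [GRing.add ?c] and
    [GRing.opp] catch functions in eta-reduced form. *)
Ltac dhead f := lazymatch f with
  | (fun _ => ?c) => eapply derC
  | (fun y => y) => eapply derI
  | (fun y => @?a y + @?b y) => eapply derD
  | (fun y => - @?a y) => eapply derN
  | (fun y => @?a y * @?b y) => eapply derM
  | (fun y => @?a y ^+ _) => eapply derX
  | (fun y => (@?a y)^-1) => eapply derV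
  | (fun y => expR (@?a y)) => eapply der_expR
  | (fun y => ln (@?a y)) => eapply der_ln
  | @expR _ => eapply is_derive_expR
  | GRing.mul ?c => eapply (derM (fun _ => c) (fun y => y))
  | GRing.add ?c => eapply (derD (fun _ => c) (fun y => y))
  | GRing.opp => eapply (derN (fun y => y))
  | _ => fail
  end.
Ltac dstep := first [ eassumption |
  lazymatch goal with |- is_derive _ _ ?f _ => dhead f end | solve [auto] ].
Ltac dtac := eapply derE; [repeat dstep|cbv beta].
Ltac chead f := lazymatch f with
  | (fun _ => ?c) => eapply contC
  | (fun y => y) => eapply contI
  | (fun y => @?a y + @?b y) => eapply contD
  | (fun y => - @?a y) => eapply contN
  | (fun y => @?a y * @?b y) => eapply contM
  | (fun y => @?a y ^+ _) => eapply contX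
  | (fun y => (@?a y)^-1) => eapply contV
  | (fun y => `|@?a y|) => eapply cont_norm
  | GRing.mul ?c => eapply (contM (fun _ => c) (fun y => y))
  | GRing.add ?c => eapply (contD (fun _ => c) (fun y => y))
  | GRing.opp => eapply (contN (fun y => y))
  | _ => fail
  end.
Ltac cstep := first [ eassumption |
  lazymatch goal with |- continuous_at _ ?f => chead f end | solve [auto] ].
Ltac ctac := repeat cstep.

(** * Antiderivatives that vanish on the negative half-line *)

Section Antiderivative.
Context {R : realType}.
Implicit Types (x y a b c d t s : R).

(** Since it is 0 for [x <= 0], it is continuous on the whole line, which spares one-sided
    continuity at 0; its derivative is [g] on the positive half-line. *)
Definition primitive (g : R -> R) x : R :=
  parameterized_integral (@lebesgue_measure R) 0 x g.

Lemma primitive_le0 (g : R -> R) x : x <= 0 -> primitive g x = 0.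
Proof.
rewrite le_eqVlt => /predU1P[->|x0]; rewrite /primitive /parameterized_integral.
  by rewrite set_itv1 Rintegral_set1.
by rewrite set_itv_ge ?Rintegral_set0// bnd_simp -ltNge.
Qed.

Context (g : R -> R) (cg : forall x, cont g x).

Let ig b : (@lebesgue_measure R).-integrable `[0, b]%classic (EFin \o g).
Proof.
apply: continuous_compact_integrable; first exact: segment_compact.
exact: cont_within.
Qed.

Lemma der_primitive x : 0 < x -> der (primitive g) x (g x).
Proof.
move=> x0.
have [||||dF E] := @continuous_FTC1 R g (BLeft 0) x (x + 1).
- by rewrite ltrDl.
- exact: ig.
- exact: x0.
- exact: cg.
apply: (derE (DeriveDef dF erefl)).
by rewrite -E derive1E.
Qed.

Lemma cont_primitive x : cont (primitive g) x.
Proof.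
have [x0|x0|->] := ltgtP x 0.
- apply/contP => e e0; exists (- x); first by rewrite oppr_gt0.
  move=> y; rewrite ltr_norml => /andP[_ H].
  by rewrite !primitive_le0 ?subrr ?normr0// ?ltW//; move: H x0; lra.
- exact: der_cont (der_primitive x x0).
- have G00 : primitive g 0 = 0 by rewrite primitive_le0.
  change (primitive g x @[x --> 0] --> primitive g 0)%classic; rewrite G00.
  exact: (@parameterized_integral_cvg_left R 0 1 g ltr01 (ig 1)).
Qed.

End Antiderivative.

(** * The odd power nonlinearity and its antiderivative *)

Section Power.
Context {R : realType} (q : R) (q0 : 0 < q).
Implicit Types (x y a b M : R).

Definition pow x : R := `|x| `^ q.
Definition spow x : R := pow x * x.

Lemma powN x : pow (- x) = pow x. Proof. by rewrite /pow normrN. Qed.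
Lemma spowN x : spow (- x) = - spow x. Proof. by rewrite /spow powN mulrN. Qed.
Lemma pow_ge0 x : 0 <= pow x. Proof. exact: powR_ge0. Qed.
Lemma pow_gt0 x : x != 0 -> 0 < pow x.
Proof. by move=> x0; rewrite powR_gt0// normr_gt0. Qed.
Lemma pow0 : pow 0 = 0. Proof. by rewrite /pow normr0 powR0// gt_eqF. Qed.
Lemma powM x y : pow (x * y) = pow x * pow y.
Proof. by rewrite /pow normrM powRM. Qed.
Lemma ler_pow x y : `|x| <= `|y| -> pow x <= pow y.
Proof. by move=> xy; apply: (ge0_ler_powR (ltW q0)); rewrite ?nnegrE. Qed.
Lemma ltr_pow x y : `|x| < `|y| -> pow x < pow y.
Proof. by move=> xy; apply: (gt0_ltr_powR q0); rewrite ?nnegrE. Qed.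
(** A real power of a negative number is 1 by convention, hence the second branch. *)
Lemma powK x : pow (x `^ q^-1) = (if 0 <= x then x else 1).
Proof.
rewrite /pow ger0_norm ?powR_ge0// -powRrM mulVf ?gt_eqF//.
case: ifPn => [x0|]; first by rewrite powRr1.
rewrite -ltNge => x0; exact: lt0_powR1.
Qed.

Lemma cont_pow x : cont pow x.
Proof.
apply/contP => e e0.
have [->|x0] := eqVneq x 0.
  exists (e `^ q^-1); first exact: powR_gt0.
  move=> y; rewrite subr0 pow0 subr0 (ger0_norm (pow_ge0 _)) => ye.
  have := ltr_pow y (e `^ q^-1); rewrite powK (ltW e0); apply.
  by rewrite [X in _ < X]ger0_norm ?powR_ge0.
have x0' : 0 < `|x| by rewrite normr_gt0.
have := @is_derive1_powR R q `|x| x0'.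
move=> /der_cont ct.
have : cont (fun y => `|y| `^ q) x.
  exact: (cont_comp (fun z => z `^ q) (fun y => `|y|) x ct (cont_norm _ _ (contI x))).
by move=> /contP; apply.
Qed.

Lemma spowE x : 0 <= x -> spow x = x `^ (q + 1).
Proof.
move=> x0; rewrite /spow /pow ger0_norm//.
have [->|xn0] := eqVneq x 0; first by rewrite mulr0 powR0// gt_eqF// addr_gt0.
by rewrite powRD ?powRr1// ?xn0 ?implybT.
Qed.

Lemma der_spow x : der spow x ((q + 1) * pow x).
Proof.
have pos y : 0 < y -> der spow y ((q + 1) * pow y).
  move=> y0; have := @is_derive1_powR R (q + 1) y y0.
  rewrite addrK => H.
  rewrite (_ : pow y = y `^ q); last by rewrite /pow gtr0_norm.
  apply: near_eq_is_derive H.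
  near=> z; rewrite spowE//; near: z.
  by near do [apply: ltW]; exact: lt_nbhsr.
have [x0|x0|->] := ltgtP x 0; last 2 first.
- exact: pos.
(* At 0 the difference quotient of [spow] is [pow] itself, continuous with value 0. *)
- apply/is_derive1_caratheodory; exists pow; split.
  + by move=> z; rewrite /spow mulr0 !subr0.
  + exact: cont_pow.
  + by rewrite pow0 mulr0.
have H := pos (- x); rewrite oppr_gt0 in H; have {}H := H x0.
have K := derN _ _ _ (der_comp _ _ _ _ _ H (derN _ _ _ (derI x))).
rewrite (_ : spow = (fun y => - spow (- y))); last first.
  by apply/funext => y; rewrite spowN opprK.
by apply: (derE K); rewrite powN; ring.
Unshelve. all: by end_near. Qed.

Definition ppow x : R := pow x * x ^+ 2.

Lemma ppow_ge0 x : 0 <= ppow x.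
Proof. by rewrite mulr_ge0 ?pow_ge0 ?sqr_ge0. Qed.

Lemma ppowN x : ppow (- x) = ppow x.
Proof. by rewrite /ppow powN sqrrN. Qed.

Lemma ler_ppow x y : `|x| <= `|y| -> ppow x <= ppow y.
Proof.
move=> xy; rewrite ler_pM ?pow_ge0 ?sqr_ge0 ?ler_pow//.
by rewrite -(real_normK (num_real x)) -(real_normK (num_real y)) lerXn2r ?nnegrE.
Qed.

Lemma der_ppow x : der ppow x ((q + 2) * spow x).
Proof.
rewrite (_ : ppow = (fun y => spow y * y)); last first.
  by apply/funext => y; rewrite /ppow /spow expr2 mulrA.
have K := derM _ _ _ _ _ (der_spow x) (derI x).
by apply: (derE K); rewrite /spow; ring.
Qed.

Lemma spow_lipschitz M x y : `|x| <= M -> `|y| <= M ->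
  `|spow x - spow y| <= (q + 1) * pow M * `|x - y|.
Proof.
wlog xy : x y / x < y => [H xM yM|xM yM].
  have [xy|xy|->] := ltgtP x y; [exact: H|..].
    by rewrite distrC (distrC x y); exact: H.
  by rewrite !subrr !normr0 mulr0.
have M0 : 0 <= M by apply: le_trans xM.
have [||c cxy] := @mean_value R spow x y (fun z => (q + 1) * pow z) xy.
- by move=> z _; exact: der_cont (der_spow z).
- by move=> z _; exact: der_spow.
rewrite distrC (distrC x y) => ->; rewrite normrM.
have q1 : 0 < q + 1 by rewrite addr_gt0.
rewrite ler_wpM2r// normrM (ger0_norm (ltW q1)) ler_pM2l// (ger0_norm (pow_ge0 _)).
apply: ler_pow; rewrite (ger0_norm M0).
by move: xM yM cxy; rewrite !ler_norml; lra.
Qed.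

End Power.

(** * The singular initial value problem *)

Section Limits.
Context {R : realType}.
Implicit Types (x y C D l : R).

Lemma half_pow_small C x : (forall n, x <= C / 2 ^+ n) -> x <= 0.
Proof.
move=> H; rewrite leNgt; apply/negP => x0.
have C0 : 0 < C by have := H 0%N; rewrite expr0 divr1; exact: lt_le_trans.
pose n := Num.truncn (C / x).
have /andP[_ nC] : (n%:R <= C / x < n.+1%:R).
  by apply: truncn_itv; rewrite divr_ge0// ltW.
have := H n.+1; rewrite ler_pdivlMr ?exprn_gt0//.
apply/negP; rewrite -ltNge.
move: nC; rewrite ltr_pdivrMr// => /lt_le_trans; apply.
by rewrite mulrC ler_pM2l// -natrX ler_nat ltnW// ltn_expl.
Qed.

(** Each [u n - e n] lies below each [u m + e m], so the supremum of the former is within [e n] of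
    every [u n]: the limit comes with its rate, which makes it uniform wherever [D] is. *)
Lemma geometric_cauchy (u : nat -> R) D :
  (forall n, `|u n.+1 - u n| <= D / 2 ^+ n) ->
  exists l, forall n, `|l - u n| <= 2 * D / 2 ^+ n.
Proof.
move=> H; pose e n : R := 2 * D / 2 ^+ n.
have eS n : D / 2 ^+ n = e n - e n.+1.
  by rewrite /e exprS invfM; lra.
have D0 n : 0 <= D / 2 ^+ n by apply: le_trans (H n).
have e0 n : 0 <= e n.
  by rewrite /e -mulrA mulr_ge0.
have mono n k : `|u (n + k)%N - u n| <= e n - e (n + k)%N.
  elim: k => [|k IH]; first by rewrite addn0 !subrr normr0.
  rewrite addnS; have := H (n + k)%N; rewrite eS.
  have := ler_normD (u (n + k).+1 - u (n + k)%N) (u (n + k)%N - u n).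
  by rewrite addrA subrK; lra.
have cross n m : u n - e n <= u m + e m.
  have [nm|mn] := leqP n m.
    have := mono n (m - n)%N; rewrite subnKC// ler_norml => /andP[].
    by have := e0 m; have := e0 n; lra.
  have := mono m (n - m)%N; rewrite subnKC ?(ltnW mn)// ler_norml => /andP[].
  by have := e0 m; have := e0 n; lra.
pose S := range (fun n => u n - e n).
have Ssup : has_sup S.
  split; first by exists (u 0%N - e 0%N), 0%N.
  by exists (u 0%N + e 0%N) => _ [n _ <-]; exact: cross.
exists (sup S) => n; rewrite ler_norml; apply/andP; split.
  have : u n - e n <= sup S by apply: (ub_le_sup Ssup.2); exists n.
  by rewrite /e; lra.
have : sup S <= u n + e n by apply: (ge_sup Ssup.1) => _ [m _ <-]; exact: cross.
by rewrite /e; lra.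
Qed.

End Limits.

Section WeightedBound.
Context {R : realType} (P : R -> R).
Hypothesis P_gt0 : forall x : R, 0 < x -> 0 < P x.
Hypothesis P_homo : forall x y : R, 0 < x -> x <= y -> P x <= P y.
Implicit Types (x y a b c d t s B D : R) (g h u v Q H : R -> R).

(** This is [int P |g| <= P t * int h], the increasing weight being replaced by its last value. In
    this form the factor [P t] cancels later, however fast [P] vanishes at 0. *)
Lemma weighted_bound Q g h H t : 0 <= t ->
  (forall x, cont Q x) -> Q 0 = 0 ->
  (forall x, 0 < x -> der Q x (P x * g x)) ->
  (forall x, cont H x) -> (forall x, 0 < x -> der H x (h x)) ->
  (forall x, 0 < x < t -> `|g x| <= h x) ->
  `|Q t| <= P t * (H t - H 0).
Proof.
move=> t0 cQ Q0 dQ cH dH gh.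
have key s : s = 1 \/ s = -1 -> 0 <= P t * (H t - H 0) - s * Q t.
  move=> s1.
  pose F x := P t * H x + (- s) * Q x.
  have : F 0 <= F t.
    apply: (mono_le (fun x => P t * h x - s * (P x * g x))) => //.
    - by move=> x _; rewrite /F; ctac.
    - move=> x /andP[x0 _]; rewrite /F.
      have dQx := dQ x x0; have dHx := dH x x0.
      by dtac; ring.
    - move=> x /andP[x0 xt].
      have := gh x; rewrite x0 xt => /(_ isT) gx.
      have Px := P_gt0 x x0; have Pxt := P_homo x t x0 (ltW xt).
      have h0 : 0 <= h x by apply: le_trans gx.
      have A1 : P x * `|g x| <= P t * h x.
        by rewrite ler_pM// ltW.
      have A2 : s * (P x * g x) <= P x * `|g x|.
        rewrite mulrCA ler_pM2l//.
        case: s1 => ->; first by rewrite mul1r ler_norm.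
        by rewrite mulN1r -normrN ler_norm.
      by lra.
  by rewrite /F Q0; lra.
have := key 1 (or_introl erefl); have := key (-1) (or_intror erefl).
by rewrite ler_norml => *; apply/andP; split; lra.
Qed.

End WeightedBound.

Section WeightedIVP.
Context {R : realType} (P f : R -> R) (L : R).
Hypothesis P_cont : forall x : R, cont P x.
Hypothesis P_gt0 : forall x : R, 0 < x -> 0 < P x.
Hypothesis P_homo : forall x y : R, 0 < x -> x <= y -> P x <= P y.
Hypothesis L_gt0 : 0 < L.
Hypothesis f_lip : forall x y : R, `|f x - f y| <= L * `|x - y|.
Implicit Types (x y a b c d t s B D : R) (g h u v H : R -> R).

Lemma lipschitz_cont x : cont f x.
Proof.
apply/contP => e e0; exists (e / L); first exact: divr_gt0.
by move=> y; rewrite ltr_pdivlMr// mulrC; apply: le_lt_trans (f_lip _ _).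
Qed.

(** The problem [(P u')' = - P f(u)], [u(0) = a], [u'(0) = 0] is the fixed point equation
    [u = picard a u], with [u' = - wprimitive (f u)]. The weight may vanish at 0, where the
    numerator is 0 as well. *)
Definition wprimitive g x : R := primitive (fun y => P y * g y) x / P x.
Definition picard a u t : R := a - primitive (wprimitive (fun y => f (u y))) t.

Section Wprimitive.
Context (g : R -> R) (cg : forall x, cont g x).

Let cPg x : cont (fun y => P y * g y) x.
Proof. by ctac. Qed.

Lemma mul_wprimitive x : 0 < x -> P x * wprimitive g x = primitive (fun y => P y * g y) x.
Proof. by move=> x0; rewrite /wprimitive mulrCA divff ?mulr1// gt_eqF// P_gt0. Qed.

Lemma der_wprimitive x : 0 < x -> der (fun y => P y * wprimitive g y) x (P x * g x).
Proof.
move=> x0; apply: near_eq_is_derive (der_primitive _ cPg x x0).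
near=> y; rewrite mul_wprimitive//; near: y.
by apply: lt_nbhsr.
Unshelve. all: by end_near. Qed.

Lemma wprimitive_le0 x : x <= 0 -> wprimitive g x = 0.
Proof. by move=> x0; rewrite /wprimitive primitive_le0// mul0r. Qed.

Lemma wprimitive_bound h H t : 0 <= t ->
  (forall x, cont H x) -> (forall x, 0 < x -> der H x (h x)) ->
  (forall x, 0 < x < t -> `|g x| <= h x) ->
  `|wprimitive g t| <= H t - H 0.
Proof.
rewrite le_eqVlt => /predU1P[<- *|t0 cH dH gh].
  by rewrite wprimitive_le0// normr0 subrr.
have Pt := P_gt0 t t0.
have := weighted_bound _ P_gt0 P_homo _ _ _ _ _ (ltW t0) (cont_primitive _ cPg) (primitive_le0 _ _ (lexx 0))
  (der_primitive _ cPg) cH dH gh.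
by rewrite -mul_wprimitive// normrM gtr0_norm// ler_pM2l.
Qed.

Lemma cont_wprimitive x : cont (wprimitive g) x.
Proof.
have [x0|x0|->] := ltgtP x 0.
- apply/contP => e e0; exists (- x); first by rewrite oppr_gt0.
  move=> y; rewrite ltr_norml => /andP[_ H].
  by rewrite !wprimitive_le0 ?subrr ?normr0// ?ltW//; move: H x0; lra.
- apply: contM; first exact: cont_primitive.
  by apply: contV => //; rewrite gt_eqF// P_gt0.
(* Near 0 the bound [|g| <= B] gives [|wprimitive g y| <= B * y], which tends to 0. *)
- have /contP/(_ 1 ltr01)[r r0 rP] := cg 0.
  pose B := `|g 0| + 1.
  have B0 : 0 < B by rewrite ltr_wpDl.
  apply/contP => e e0; exists (Num.min r (e / B)).
    by rewrite lt_min r0 divr_gt0.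
  move=> y; rewrite subr0 lt_min => /andP[yr ye].
  rewrite (wprimitive_le0 0)// subr0.
  have [y0|y0] := leP y 0; first by rewrite wprimitive_le0// normr0.
  apply: le_lt_trans (wprimitive_bound (fun=> B) (fun z => B * z) y (ltW y0) _ _ _) _.
  + by move=> z; ctac.
  + by move=> z _; dtac; ring.
  + move=> z /andP[z0 zy].
    have : `|z - 0| < r by rewrite subr0 gtr0_norm// (lt_trans zy)// -(gtr0_norm y0).
    move=> /rP gz; rewrite -(subrK (g 0) (g z)) (le_trans (ler_normD _ _))//.
    by rewrite /B; lra.
  + by rewrite mulr0 subr0 mulrC -ltr_pdivlMr// -(gtr0_norm y0).
Unshelve. all: by end_near. Qed.

End Wprimitive.

Lemma primitive_dist g1 g2 h H t : (forall x, cont g1 x) -> (forall x, cont g2 x) ->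
  0 <= t -> (forall x, cont H x) -> (forall x, 0 < x -> der H x (h x)) ->
  (forall x, 0 < x < t -> `|g1 x - g2 x| <= h x) ->
  `|primitive g1 t - primitive g2 t| <= H t - H 0.
Proof.
move=> c1 c2 t0 cH dH gh.
have := @weighted_bound R (fun=> 1) (fun _ _ => ltr01) (fun _ _ _ _ => lexx 1)
  (fun x => primitive g1 x - primitive g2 x) (fun x => g1 x - g2 x) h H t t0 _ _ _ cH dH gh.
rewrite mul1r; apply.
- by move=> x; apply: contD; [exact: cont_primitive|apply: contN; exact: cont_primitive].
- by rewrite !primitive_le0// subrr.
- move=> x x0; rewrite mul1r; apply: derD; first exact: der_primitive.
  by apply: derN; exact: der_primitive.
Qed.

Lemma wprimitive_dist g1 g2 h H t : (forall x, cont g1 x) -> (forall x, cont g2 x) ->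
  0 <= t -> (forall x, cont H x) -> (forall x, 0 < x -> der H x (h x)) ->
  (forall x, 0 < x < t -> `|g1 x - g2 x| <= h x) ->
  `|wprimitive g1 t - wprimitive g2 t| <= H t - H 0.
Proof.
move=> c1 c2; rewrite le_eqVlt => /predU1P[<- *|t0 cH dH gh].
  by rewrite !wprimitive_le0// !subrr normr0.
have Pt := P_gt0 t t0.
have cP g x : (forall x, cont g x) -> cont (fun y => P y * g y) x.
  by move=> cg; ctac.
have := @weighted_bound R P P_gt0 P_homo (fun x => primitive (fun y => P y * g1 y) x -
   primitive (fun y => P y * g2 y) x) (fun x => g1 x - g2 x) h H t (ltW t0) _ _ _ cH dH gh.
rewrite -(mul_wprimitive g1 t t0) -(mul_wprimitive g2 t t0) -mulrBr normrM gtr0_norm// ler_pM2l//; apply.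
- by move=> x; apply: contD; [|apply: contN]; apply: cont_primitive => y; exact: cP.
- by rewrite !primitive_le0// subrr.
- move=> x x0; rewrite mulrBr; apply: derD.
    by apply: (der_primitive _ _ x x0) => y; exact: cP.
  by apply: derN; apply: (der_primitive _ _ x x0) => y; exact: cP.
Qed.

(** Each of the two integrations of [expR (K * t)] gains a factor [1 / K]; in the norm weighted by
    this exponential the Picard map is a contraction with factor [L / K ^+ 2 = 1 / 2] on the whole
    half-line, so solutions are global at once. *)
Let K := Num.sqrt (2 * L).

Let K_gt0 : 0 < K. Proof. by rewrite sqrtr_gt0 mulr_gt0. Qed.
Let KK : K * K = 2 * L. Proof. by rewrite -expr2 sqr_sqrtr// mulr_ge0// ltW. Qed.

Lemma picard_le0 a u t : t <= 0 -> picard a u t = a.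
Proof. by move=> t0; rewrite /picard primitive_le0// subr0. Qed.

Lemma cont_fu u x : (forall x, cont u x) -> cont (fun y => f (u y)) x.
Proof. by move=> cu; apply: cont_comp; [exact: lipschitz_cont|exact: cu]. Qed.

Lemma cont_picard a u x : (forall x, cont u x) -> cont (picard a u) x.
Proof.
move=> cu; apply: contD; first exact: contC.
apply: contN; apply: cont_primitive => y; apply: cont_wprimitive => z.
exact: cont_fu.
Qed.

Let der_exp D x : der (fun y => D * expR (K * y)) x (D * K * expR (K * x)).
Proof. by dtac; ring. Qed.

Let cont_exp D x : cont (fun y => D * expR (K * y)) x.
Proof. exact: der_cont (der_exp D x). Qed.

Let exp_ge1 t : 0 <= t -> 1 <= expR (K * t).
Proof. by move=> t0; rewrite -expR0 ler_expR mulr_ge0// ltW. Qed.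

Lemma wprimitive_fu_dist u v D t : (forall x, cont u x) -> (forall x, cont v x) ->
  (forall s, 0 <= s -> `|u s - v s| <= D * expR (K * s)) -> 0 <= t ->
  `|wprimitive (fun y => f (u y)) t - wprimitive (fun y => f (v y)) t|
    <= L * D / K * (expR (K * t) - 1).
Proof.
move=> cu cv uv t0.
have /= := wprimitive_dist (fun y => f (u y)) (fun y => f (v y))
  (fun y => L * D / K * K * expR (K * y)) (fun y => L * D / K * expR (K * y)) t.
rewrite mulr0 expR0 mulr1 => Hd; rewrite mulrBr mulr1; apply: Hd => //.
- by move=> x; exact: cont_fu.
- by move=> x; exact: cont_fu.
- move=> x /andP[x0 _]; rewrite divfK ?gt_eqF// (le_trans (f_lip _ _))//.
  by rewrite -mulrA ler_pM2l// uv// ltW.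
Qed.

Lemma picard_dist a b u v D t : (forall x, cont u x) -> (forall x, cont v x) ->
  (forall s, 0 <= s -> `|u s - v s| <= D * expR (K * s)) -> 0 <= t ->
  `|picard a u t - picard b v t| <= `|a - b| + D / 2 * (expR (K * t) - 1).
Proof.
move=> cu cv uv t0.
have D0 : 0 <= D.
  by have := uv 0 (lexx 0); rewrite mulr0 expR0 mulr1; exact: le_trans.
have /= := primitive_dist (wprimitive (fun y => f (u y))) (wprimitive (fun y => f (v y)))
  (fun y => D / 2 * K * expR (K * y)) (fun y => D / 2 * expR (K * y)) t.
rewrite mulr0 expR0 mulr1 => H.
have -> : picard a u t - picard b v t = (a - b) -
  (primitive (wprimitive (fun y => f (u y))) t - primitive (wprimitive (fun y => f (v y))) t).
  rewrite /picard; move: (primitive (wprimitive (fun y => f (u y))) t) => x.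
  by move: (primitive _ t) => y; ring.
apply: le_trans (ler_normB _ _) _; rewrite lerD2l mulrBr mulr1; apply: H => //.
- by move=> x; apply: cont_wprimitive => y; exact: cont_fu.
- by move=> x; apply: cont_wprimitive => y; exact: cont_fu.
- move=> x /andP[/ltW x0 _]; apply: le_trans (wprimitive_fu_dist _ _ _ _ cu cv uv x0) _.
  have -> : L * D / K = D / 2 * K.
    apply: (mulIf (lt0r_neq0 K_gt0)); rewrite divfK ?gt_eqF//.
    have -> : D / 2 * K * K = D / 2 * (K * K) by ring.
    by rewrite KK; field.
  apply: ler_wpM2l; last by rewrite gerBl.
  by rewrite !mulr_ge0 ?invr_ge0// ltW.
Qed.

Let it a n := iter n (picard a) (fun=> a).

Let cont_it a n x : cont (it a n) x.
Proof. elim: n x => [|n IH] x; [exact: contC|exact: cont_picard]. Qed.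

Let it_le0 a n t : t <= 0 -> it a n t = a.
Proof. by case: n => [//|n] t0; rewrite /it iterS picard_le0. Qed.

Let D0 a := 2 * `|f a| / (K * K).

Let D0_ge0 a : 0 <= D0 a.
Proof. by rewrite /D0 divr_ge0 ?mulr_ge0// ltW. Qed.

Let it_step a n t : 0 <= t ->
  `|it a n.+1 t - it a n t| <= D0 a / 2 ^+ n * expR (K * t).
Proof.
elim: n t => [|n IH] t t0.
  rewrite expr0 divr1 /it /= /picard.
  have -> : a - primitive (wprimitive (fun=> f a)) t - a =
    primitive (fun=> 0) t - primitive (wprimitive (fun=> f a)) t.
    suff -> : primitive (fun=> 0 : R) t = 0 by ring.
    by rewrite /primitive /parameterized_integral Rintegral_cst// mul0r.
  apply: le_trans (primitive_dist _ _ (fun y => D0 a * K * expR (K * y))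
    (fun y => D0 a * expR (K * y)) t _ _ _ _ _ _) _ => //.
  - by move=> x; exact: contC.
  - by move=> x; apply: cont_wprimitive => y; exact: contC.
  - move=> x /andP[/ltW x0 _]; rewrite sub0r normrN.
    apply: le_trans (wprimitive_bound (fun=> f a) _ (fun y => `|f a| / K * K * expR (K * y))
      (fun y => `|f a| / K * expR (K * y)) x _ _ _ _) _ => //.
    + by move=> z; exact: contC.
    + move=> z /andP[/ltW z0 _]; rewrite divfK ?gt_eqF//.
      by rewrite ler_peMr// exp_ge1.
    + rewrite mulr0 expR0 mulr1.
      have -> : D0 a * K = 2 * (`|f a| / K).
        by rewrite /D0; field; rewrite gt_eqF.
      have := exp_ge1 x x0; have : 0 <= `|f a| / K by rewrite divr_ge0// ltW.
      by move: (`|f a| / K) (expR _) => A E ? ?; nra.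
  - rewrite mulr0 expR0 mulr1 gerBl /D0.
    by rewrite divr_ge0 ?mulr_ge0// ltW.
apply: le_trans (picard_dist a a _ _ _ _ (cont_it a n.+1) (cont_it a n) IH t0) _.
rewrite subrr normr0 add0r exprS invfM [2^-1 * _]mulrC mulrA.
apply: ler_wpM2l; last by rewrite gerBl.
by apply: divr_ge0 => //; apply: divr_ge0; [exact: D0_ge0|exact: exprn_ge0].
Qed.

(** The maximum lets one bound serve every [t]: for [t <= 0] all the iterates equal [a]. *)
Let om t := expR (K * Num.max t 0).

Let it_step' a n t : `|it a n.+1 t - it a n t| <= D0 a * om t / 2 ^+ n.
Proof.
rewrite mulrAC /om; have [t0|t0] := leP 0 t; first exact: it_step.
rewrite !it_le0 ?(ltW t0)// subrr normr0.
apply: mulr_ge0; last exact: expR_ge0.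
by apply: divr_ge0; [exact: D0_ge0|exact: exprn_ge0].
Qed.

Let lim_it a t : {l | forall n, `|l - it a n t| <= 2 * (D0 a * om t) / 2 ^+ n}.
Proof. by apply: cid; apply: geometric_cauchy => n; exact: it_step'. Qed.

Definition wsol a t : R := projT1 (lim_it a t).
Definition wsol' a t : R := - wprimitive (fun y => f (wsol a y)) t.

Let wsolP a n t : `|wsol a t - it a n t| <= 2 * (D0 a * om t) / 2 ^+ n.
Proof. exact: (projT2 (lim_it a t)). Qed.

Let om_ge0 t : 0 <= t -> om t = expR (K * t).
Proof. by move=> t0; rewrite /om max_l. Qed.

Lemma cont_wsol a x : cont (wsol a) x.
Proof.
apply/contP => e e0.
pose C := 2 * (D0 a * expR (K * (`|x| + 1))).
have [n nC] : exists n, C / 2 ^+ n < e / 4.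
  apply: contrapT => /forallNP H.
  suff : e / 4 <= 0 by rewrite leNgt divr_gt0.
  by apply: (@half_pow_small _ C) => n; rewrite leNgt; apply/negP/H.
have close y : `|y - x| < 1 -> `|wsol a y - it a n y| < e / 4.
  move=> yx; apply: le_lt_trans nC; apply: le_trans (wsolP a n y) _.
  rewrite ler_wpM2r ?invr_ge0 ?exprn_ge0// /C ler_pM2l// ler_wpM2l ?D0_ge0//.
  rewrite /om ler_expR ler_pM2l// ge_max addr_ge0// andbT.
  rewrite -lerBlDl; move: yx; rewrite ltr_norml => /andP[_].
  by have := ler_norm x; lra.
have /contP/(_ (e / 4)) := cont_it a n x; rewrite divr_gt0// => /(_ isT)[r r0 rP].
exists (Num.min r 1); first by rewrite lt_min r0 ltr01.
move=> y; rewrite lt_min => /andP[/rP yr y1].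
have := close y y1; have := close x; rewrite subrr normr0 ltr01 => /(_ isT).
move: yr; rewrite !ltr_norml => /andP[? ?] /andP[? ?] /andP[? ?].
by apply/andP; split; lra.
Qed.

Lemma wsol_picard a t : 0 <= t -> wsol a t = picard a (wsol a) t.
Proof.
move=> t0; apply/eqP; rewrite -subr_eq0 -normr_le0; apply/eqP.
suff : `|wsol a t - picard a (wsol a) t| <= 0 by move=> H; apply/eqP.
apply: (@half_pow_small _ (4 * (D0 a * om t))) => n.
have step : `|picard a (wsol a) t - it a n.+1 t| <= 2 * (D0 a * om t) / 2 ^+ n.
  apply: le_trans (picard_dist a a _ _ (2 * D0 a / 2 ^+ n) _ (cont_wsol a) (cont_it a n) _ t0) _.
    move=> s s0; apply: le_trans (wsolP a n s) _.
    by rewrite om_ge0// le_eqVlt; apply/orP; left; apply/eqP; ring.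
  rewrite subrr normr0 add0r om_ge0//.
  have : 0 <= D0 a / 2 ^+ n by rewrite divr_ge0// exprn_ge0.
  have := exp_ge1 t t0.
  have -> : 2 * (D0 a * expR (K * t)) / 2 ^+ n = 2 * (D0 a / 2 ^+ n) * expR (K * t) by ring.
  have -> : 2 * D0 a / 2 ^+ n = 2 * (D0 a / 2 ^+ n) by ring.
  by move: (D0 a / _) (expR _) => A E ? ?; nra.
have := wsolP a n.+1 t; rewrite exprS invfM.
have -> : 2 * (D0 a * om t) * (2^-1 / 2 ^+ n) = (D0 a * om t) / 2 ^+ n by field; rewrite expf_neq0.
have : 0 <= D0 a * om t / 2 ^+ n.
  apply: divr_ge0; last exact: exprn_ge0.
  by apply: mulr_ge0; [exact: D0_ge0|exact: expR_ge0].
move: step.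
have -> : 2 * (D0 a * om t) / 2 ^+ n = 2 * (D0 a * om t / 2 ^+ n) by ring.
have -> : 4 * (D0 a * om t) / 2 ^+ n = 4 * (D0 a * om t / 2 ^+ n) by ring.
move: (D0 a * om t / 2 ^+ n) (it a n.+1 t) (picard a (wsol a) t) (wsol a t) => B x y z.
move=> H B0 H'; have := ler_normD (z - x) (x - y).
by rewrite addrA subrK (distrC x); lra.
Qed.

Lemma wsol0 a : wsol a 0 = a.
Proof. by rewrite wsol_picard// picard_le0. Qed.

Lemma wsol'0 a : wsol' a 0 = 0.
Proof. by rewrite /wsol' wprimitive_le0// oppr0. Qed.

Let cont_fwsol a x : cont (fun y => f (wsol a y)) x.
Proof. by apply: cont_fu => y; exact: cont_wsol. Qed.

Lemma cont_wsol' a x : cont (wsol' a) x.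
Proof. by apply: contN; apply: cont_wprimitive => y; exact: cont_fwsol. Qed.

Lemma der_wsol a t : 0 < t -> der (wsol a) t (wsol' a t).
Proof.
move=> t0.
have : der (picard a (wsol a)) t (wsol' a t).
  apply: derE (derD _ _ _ _ _ (derC a t) (derN _ _ _ (der_primitive _ _ t t0))) _.
  - by move=> x; apply: cont_wprimitive => y; exact: cont_fwsol.
  - by rewrite add0r.
apply: near_eq_is_derive; near=> y; rewrite -wsol_picard//; near: y.
by near do [apply: ltW]; exact: lt_nbhsr.
Unshelve. all: by end_near. Qed.

Lemma der_wsol' a t : 0 < t ->
  der (fun y => P y * wsol' a y) t (- (P t * f (wsol a t))).
Proof.
move=> t0; have /= H := derN _ _ _ (der_wprimitive _ (cont_fwsol a) t t0).
rewrite (_ : (fun y => _) = (fun y => - (P y * wprimitive (fun z => f (wsol a z)) y)))//.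
by apply/funext => y; rewrite /wsol' mulrN.
Qed.

(** The Picard maps for [a] and [b] preserve a weighted distance of at most [2 * |a - b|], so the
    bound holds between all iterates and passes to the limit. *)
Lemma wsol_dist a b t : 0 <= t ->
  `|wsol a t - wsol b t| <= 2 * `|a - b| * expR (K * t).
Proof.
have it_dist n s : 0 <= s -> `|it a n s - it b n s| <= 2 * `|a - b| * expR (K * s).
  elim: n s => [|n IH] s s0.
    by have := exp_ge1 s s0; have := normr_ge0 (a - b); rewrite /it /=;
      move: `|_| (expR _) => A E ? ?; nra.
  apply: le_trans (picard_dist a b _ _ _ _ (cont_it a n) (cont_it b n) IH s0) _.
  by have := exp_ge1 s s0; have := normr_ge0 (a - b);
    move: `|_| (expR _) => A E ? ?; nra.
move=> t0; rewrite -subr_le0.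
apply: (@half_pow_small _ (2 * (D0 a * om t) + 2 * (D0 b * om t))) => n.
have := it_dist n t t0; have := wsolP a n t; have := wsolP b n t.
rewrite mulrDl (distrC (wsol b t)) => H1 H2 H3.
have := ler_normD (wsol a t - it a n t) (it a n t - it b n t).
have := ler_normD (wsol a t - it b n t) (it b n t - wsol b t).
by rewrite !addrA !subrK; lra.
Qed.

Lemma wsol'_dist a b t : 0 <= t ->
  `|wsol' a t - wsol' b t| <= K * `|a - b| * expR (K * t).
Proof.
move=> t0; rewrite /wsol' -opprD normrN.
apply: le_trans (wprimitive_fu_dist _ _ _ _ (cont_wsol a) (cont_wsol b)
  (fun s => @wsol_dist a b s) t0) _.
have -> : L * (2 * `|a - b|) / K = K * `|a - b|.
  by rewrite mulrA (mulrC L) -KK; field; rewrite gt_eqF.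
apply: ler_wpM2l; last by rewrite gerBl.
by rewrite mulr_ge0// ltW.
Qed.

End WeightedIVP.

(** * The radial equation *)

Section Hyperbolic.
Context {R : realType}.
Implicit Types (x y t s : R).

Definition sh t : R := (expR t - expR (- t)) / 2.
Definition ch t : R := (expR t + expR (- t)) / 2.

Lemma der_sh t : der sh t (ch t).
Proof. by rewrite /sh /ch; dtac; field. Qed.

Lemma der_ch t : der ch t (sh t).
Proof. by rewrite /sh /ch; dtac; field. Qed.

Lemma sh0 : sh 0 = 0. Proof. by rewrite /sh oppr0 subrr mul0r. Qed.
Lemma ch0 : ch 0 = 1. Proof. by rewrite /ch oppr0 expR0; field. Qed.

Lemma ch2 t : ch t ^+ 2 = 1 + sh t ^+ 2.
Proof.
have := expRxMexpNx_1 t; rewrite /ch /sh; move: (expR t) (expR (- t)) => x y xy.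
have -> : ((x + y) / 2) ^+ 2 = x * y + ((x - y) / 2) ^+ 2 by field.
by rewrite xy.
Qed.

Lemma ch_gt0 t : 0 < ch t.
Proof. by rewrite divr_gt0// addr_gt0// expR_gt0. Qed.

Lemma ch_ge1 t : 1 <= ch t.
Proof.
rewrite -(@ler_pXn2r _ 2)// ?nnegrE//; last exact: ltW (ch_gt0 t).
by rewrite expr1n ch2 lerDl sqr_ge0.
Qed.

Lemma sh_ltr x y : x < y -> sh x < sh y.
Proof.
move=> xy; apply: (mono_lt ch xy) => z _; last exact: ch_gt0.
- exact: der_cont (der_sh z).
- exact: der_sh.
Qed.

Lemma sh_gt0 t : 0 < t -> 0 < sh t.
Proof. by rewrite -{2}sh0; exact: sh_ltr. Qed.

Lemma sh_ler x y : x <= y -> sh x <= sh y.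
Proof. by rewrite le_eqVlt => /predU1P[->//|/sh_ltr/ltW]. Qed.

Lemma sh_ge0 t : 0 <= t -> 0 <= sh t.
Proof. by rewrite -{2}sh0; exact: sh_ler. Qed.

Lemma sh_lt_ch t : sh t < ch t.
Proof. by rewrite /sh /ch; have := expR_gt0 (- t); lra. Qed.

Definition coth t : R := ch t / sh t.

Lemma coth_ge1 t : 0 < t -> 1 <= coth t.
Proof. by move=> /sh_gt0 st; rewrite /coth ler_pdivlMr// mul1r ltW// sh_lt_ch. Qed.

Lemma coth_le s t : 0 < s -> s <= t -> coth t <= coth s.
Proof.
move=> s0 st; have t0 : 0 < t by exact: lt_le_trans st.
have {}s0 := sh_gt0 s s0; have {}t0 := sh_gt0 t t0.
rewrite /coth ler_pdivrMr// mulrAC ler_pdivlMr// -subr_ge0.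
suff -> : ch s * sh t - ch t * sh s = sh (t - s) by apply: sh_ge0; rewrite subr_ge0.
rewrite /ch /sh opprB !expRD.
have := expRxMexpNx_1 s; have := expRxMexpNx_1 t.
by move: (expR s) (expR (- s)) (expR t) (expR (- t)) => a b c d _ _; field.
Qed.

End Hyperbolic.

Section RadialSolution.
Context {R : realType} (k : nat) (lam q : R).
Hypothesis lam0 : 0 < lam.
Hypothesis q0 : 0 < q.
Implicit Types (x y t s a b M A : R) (U V : R -> R).

(* The radial equation in the geodesic polar coordinate t; the dimension is k + 1. *)
Definition force x : R := lam * x + spow q x.

(** Continuity is required on the whole line, but the equations only for [0 < t], because [coth] is
    singular at 0. *)
Record radial_ode a U V : Prop := RadialOde {
  ro_contU : forall t, cont U t;
  ro_contV : forall t, cont V t;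
  ro_U0 : U 0 = a;
  ro_V0 : V 0 = 0;
  ro_dU : forall t, 0 < t -> der U t (V t);
  ro_dV : forall t, 0 < t -> der V t (- (k%:R * coth t * V t) - force (U t)) }.

Definition potential x : R := lam * x ^+ 2 / 2 + ppow q x / (q + 2).
Definition energy U V t : R := V t ^+ 2 / 2 + potential (U t).

Lemma potential_ge x : lam * x ^+ 2 / 2 <= potential x.
Proof. by rewrite lerDl divr_ge0 ?ppow_ge0// addr_ge0// ltW. Qed.

Lemma ler_potential x y : `|x| <= `|y| -> potential x <= potential y.
Proof.
move=> xy; apply: lerD; last by rewrite ler_pM2r ?ler_ppow// invr_gt0 addr_gt0.
rewrite ler_pM2r// ler_pM2l//.
by rewrite -(real_normK (num_real x)) -(real_normK (num_real y)) lerXn2r ?nnegrE.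
Qed.

Lemma der_potential x : der potential x (force x).
Proof.
have H := der_ppow q q0 x.
rewrite /potential; dtac.
rewrite /force; field; rewrite gt_eqF// addr_gt0//.
Qed.

Lemma der_energy U V t d : der U t (V t) -> der V t d ->
  der (energy U V) t (V t * (d + force (U t))).
Proof.
move=> dU dV; have H := der_comp _ _ _ _ _ (der_potential (U t)) dU.
by rewrite /energy; dtac; field.
Qed.

Lemma cont_energy U V t : cont U t -> cont V t -> cont (energy U V) t.
Proof.
move=> cU cV; apply: contD; first by ctac.
by apply: (cont_comp potential U) cU; exact: der_cont (der_potential _).
Qed.

(** Truncating the argument at height [M] makes the nonlinearity globally Lipschitz; the energy
    later shows that the truncation is never active. *)
Definition clip M x : R := Num.max (- M) (Num.min x M).

Lemma clip_id M x : `|x| <= M -> clip M x = x.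
Proof.
by rewrite ler_norml /clip => /andP[? ?]; rewrite min_l// max_r.
Qed.

Lemma clip_bound M x : 0 <= M -> `|clip M x| <= M.
Proof.
move=> M0; rewrite ler_norml /clip le_max lexx ge_max ge_min lexx orbT andbT /=.
by lra.
Qed.

Lemma clip_lip M x y : 0 <= M -> `|clip M x - clip M y| <= `|x - y|.
Proof.
move=> M0; have := ler_norm (x - y); have := ler_norm (- (x - y)); rewrite normrN.
move: `|x - y| => d d1 d2; rewrite ler_norml /clip /Order.max /Order.min.
by case: (ltP x M) => xM; case: (ltP y M) => yM; case: ltP => ?; case: ltP => ?;
  apply/andP; split; lra.
Qed.

Definition cforce M x : R := lam * x + spow q (clip M x).

Lemma cforce_lip M x y : 0 <= M ->
  `|cforce M x - cforce M y| <= (lam + (q + 1) * pow q M) * `|x - y|.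
Proof.
move=> M0; have -> : cforce M x - cforce M y =
  lam * (x - y) + (spow q (clip M x) - spow q (clip M y)) by rewrite /cforce; ring.
apply: le_trans (ler_normD _ _) _; rewrite mulrDl normrM gtr0_norm// lerD2l.
apply: le_trans (spow_lipschitz q q0 M _ _ (clip_bound M x M0) (clip_bound M y M0)) _.
apply: ler_wpM2l; last exact: clip_lip.
by rewrite mulr_ge0 ?pow_ge0// addr_ge0// ltW.
Qed.

Lemma cforce_id M x : `|x| <= M -> cforce M x = force x.
Proof. by move=> xM; rewrite /cforce clip_id. Qed.

(** A height that is out of reach from an amplitude at most [A]: the potential there is at least
    [lam * M ^+ 2 / 2], which exceeds the initial energy [potential A]. *)
Definition amplitude_bound A : R := 1 + A + 2 * potential A / lam.

Lemma potential_ge0 x : 0 <= potential x.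
Proof.
by apply: le_trans (potential_ge x); rewrite divr_ge0// mulr_ge0 ?sqr_ge0// ltW.
Qed.

Lemma amplitude_boundP A : 0 <= A ->
  A < amplitude_bound A /\ potential A < lam * amplitude_bound A ^+ 2 / 2.
Proof.
move=> A0; rewrite /amplitude_bound.
have p0 : 0 <= 2 * potential A / lam.
  by rewrite divr_ge0 ?mulr_ge0 ?potential_ge0// ltW.
split; first by lra.
move: p0; set y := 2 * _ / lam => y0.
have -> : potential A = lam * y / 2 by rewrite /y; field; rewrite gt_eqF.
rewrite ltr_pM2r// ltr_pM2l//.
have : 1 <= 1 + A + y by lra.
have : y < 1 + A + y by lra.
by move: (1 + A + y) => z yz z1; nra.
Qed.

End RadialSolution.

(** * Global solutions of the radial initial value problem *)

Section RadialIVP.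
Context {R : realType} (k : nat) (lam q A : R).
Hypothesis k0 : (0 < k)%N.
Hypothesis lam0 : 0 < lam.
Hypothesis q0 : 0 < q.
Hypothesis A0 : 0 <= A.
Implicit Types (x y t s a b M : R) (U V : R -> R).

Let P t : R := sh t ^+ k.
Let M := amplitude_bound lam q A.
Let L := lam + (q + 1) * pow q M.

Let der_P t : der P t (k%:R * sh t ^+ k.-1 * ch t).
Proof. by have H := der_sh t; rewrite /P; dtac. Qed.

Let P_cont t : cont P t. Proof. exact: der_cont (der_P t). Qed.

Let P_gt0 t : 0 < t -> 0 < P t.
Proof. by move=> t0; rewrite exprn_gt0// sh_gt0. Qed.

Let P_homo x y : 0 < x -> x <= y -> P x <= P y.
Proof.
move=> x0 xy; have := sh_ler x y xy; have := sh_gt0 x x0 => sx sxy.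
by rewrite lerXn2r// ?nnegrE ltW// (lt_le_trans sx).
Qed.

Let M_gtA : A < M. Proof. by have [] := amplitude_boundP lam q lam0 q0 A A0. Qed.
Let M_ge0 : 0 <= M. Proof. by rewrite (le_trans A0)// ltW. Qed.

Let L_gt0 : 0 < L.
Proof. by rewrite ltr_wpDr// mulr_ge0 ?pow_ge0// addr_ge0// ltW. Qed.

Let f_lip x y : `|cforce lam q M x - cforce lam q M y| <= L * `|x - y|.
Proof. exact: cforce_lip. Qed.

Definition sol : R -> R -> R := wsol P (cforce lam q M) L P_cont P_gt0 P_homo L_gt0 f_lip.
Definition sol' : R -> R -> R := wsol' P (cforce lam q M) L P_cont P_gt0 P_homo L_gt0 f_lip.

Let der_sol' a t : 0 < t ->
  der (sol' a) t (- (k%:R * coth t * sol' a t) - cforce lam q M (sol a t)).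
Proof.
move=> t0; have Pt := P_gt0 t t0; have st := sh_gt0 t t0.
have H1 := der_wsol' _ _ _ P_cont P_gt0 P_homo L_gt0 f_lip a t t0.
have H2 := derV _ _ _ (der_P t) (lt0r_neq0 Pt).
have H := derM _ _ _ _ _ H1 H2.
have {}H : der (fun y => P y * sol' a y * (P y)^-1) t
  (- (k%:R * coth t * sol' a t) - cforce lam q M (sol a t)).
  apply: derE H _; rewrite -/(sol a t) -/(sol' a t).
  move: (sol a t) (sol' a t) (cforce lam q M) => u v f.
  rewrite /coth /P; case: k k0 => // n _ /=; rewrite exprS; field.
  by rewrite expf_neq0 gt_eqF.
apply: near_eq_is_derive H; near=> y.
rewrite mulrAC mulfV ?mul1r// gt_eqF// P_gt0//.
near: y; exact: lt_nbhsr.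
Unshelve. all: by end_near. Qed.

(** Until [|sol a|] first reaches [M] the truncation is inactive, so the energy does not increase;
    at that moment it would exceed its initial value. *)
Lemma sol_bounded a t : `|a| <= A -> 0 <= t -> `|sol a t| <= M.
Proof.
move=> aA t0; rewrite leNgt; apply/negP => tM.
have U0 : sol a 0 = a by exact: wsol0.
have V0 : sol' a 0 = 0 by exact: wsol'0.
have cU s : cont (sol a) s by exact: cont_wsol.
have cV s : cont (sol' a) s by exact: cont_wsol'.
pose phi s := sol a s ^+ 2 - M ^+ 2.
have sqE s : sol a s ^+ 2 = `|sol a s| ^+ 2 by rewrite real_normK ?num_real.
have phi0 : phi 0 < 0.
  rewrite subr_lt0 sqE U0 ltrXn2r ?nnegrE//.
  exact: le_lt_trans aA M_gtA.
have phit : 0 <= phi t by rewrite subr_ge0 sqE lerXn2r ?nnegrE// ltW.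
have cphi s : 0 <= s <= t -> cont phi s by move=> _; have := cU s => ?; rewrite /phi; ctac.
have [c [/andP[c0 ct] fc below]] := first_crossing t0 cphi phi0 phit.
have lt_M s : 0 < s < c -> `|sol a s| <= M.
  move=> /andP[s0 sc]; have := below s; rewrite (ltW s0) sc => /(_ isT).
  by rewrite subr_lt0 sqE ltr_pXn2r ?nnegrE// => /ltW.
have : - energy lam q (sol a) (sol' a) 0 <= - energy lam q (sol a) (sol' a) c.
  apply: (@mono_le R (fun s => - energy lam q (sol a) (sol' a) s) 0 c
    (fun s => k%:R * coth s * sol' a s ^+ 2) (ltW c0)).
  - by move=> s _; apply: contN; exact: cont_energy.
  - move=> s /[dup] /lt_M sM /andP[s0 sc].
    have dU : der (sol a) s (sol' a s) by exact: der_wsol.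
    have dE := derN _ _ _ (der_energy lam _ q0 _ _ _ _ dU (der_sol' a s s0)).
    apply: (derE dE); rewrite cforce_id//; move: (sol a s) (sol' a s) => u v; ring.
  - move=> s /andP[s0 _]; rewrite mulr_ge0 ?sqr_ge0// mulr_ge0//.
    by rewrite (le_trans ler01)// coth_ge1.
have [_ bM] := amplitude_boundP lam q lam0 q0 A A0.
have H1 := potential_ge lam q q0 (sol a c).
have H2 : potential lam q a <= potential lam q A.
  by apply: ler_potential => //; rewrite (ger0_norm A0).
have scM : sol a c ^+ 2 = M ^+ 2 by apply/eqP; rewrite -subr_eq0; apply/eqP.
move: H1 H2 bM; rewrite scM /energy U0 V0 -/M.
have := sqr_ge0 (sol' a c).
move: (M ^+ 2) (potential lam q (sol a c)) (potential lam q a) (potential lam q A) => *.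
by lra.
Qed.

Lemma radial_ode_sol a : `|a| <= A -> radial_ode k lam q a (sol a) (sol' a).
Proof.
move=> aA; split.
- by move=> t; exact: cont_wsol.
- by move=> t; exact: cont_wsol'.
- exact: wsol0.
- exact: wsol'0.
- by move=> t t0; exact: der_wsol.
- move=> t t0; rewrite -(cforce_id lam q M); first exact: der_sol'.
  by apply: sol_bounded => //; exact: ltW.
Qed.

Lemma sol_dist : exists C K : R, forall a b t, 0 <= t ->
  `|sol a t - sol b t| <= C * `|a - b| * expR (K * t) /\
  `|sol' a t - sol' b t| <= C * `|a - b| * expR (K * t).
Proof.
pose K : R := Num.sqrt (2 * L).
exists (2 + K), K => a b t t0; split.
- apply: le_trans (wsol_dist _ _ _ P_cont P_gt0 P_homo L_gt0 f_lip a b t t0) _.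
  by rewrite ler_pM2r ?expR_gt0// ler_wpM2r// lerDl sqrtr_ge0.
- apply: le_trans (wsol'_dist _ _ _ P_cont P_gt0 P_homo L_gt0 f_lip a b t t0) _.
  by rewrite ler_pM2r ?expR_gt0// ler_wpM2r// lerDr.
Qed.

End RadialIVP.

(** * Decay of radial solutions *)

Section Trap.
Context {R : realType} (k : nat) (lam q : R).
Hypothesis k0 : (0 < k)%N.
Hypothesis lam0 : 0 < lam.
Hypothesis q0 : 0 < q.
Let m : R := k%:R / 2.
Hypothesis lam_m : lam < m ^+ 2.
Implicit Types (x y t s a b T : R) (U V : R -> R).
Local Notation E := (energy lam q).
Local Notation ode := (radial_ode k lam q).

Let m0 : 0 < m. Proof. by rewrite divr_gt0// ltr0n. Qed.
Let km : k%:R = 2 * m. Proof. by rewrite /m; field. Qed.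

Lemma radial_odeN a U V : ode a U V -> ode (- a) (fun t => - U t) (fun t => - V t).
Proof.
move=> [cU cV U0 V0 dU dV]; split.
- by move=> t; exact: contN.
- by move=> t; exact: contN.
- by rewrite U0.
- by rewrite V0 oppr0.
- by move=> t t0; apply: derN; exact: dU.
- move=> t t0; apply: (derE (derN _ _ _ (dV t t0))).
  by rewrite /force spowN; ring.
Qed.

Lemma energyN U V t : E (fun t => - U t) (fun t => - V t) t = E U V t.
Proof. by rewrite /energy /potential ppowN !sqrrN. Qed.

Lemma energy_ge0 U V t : 0 <= E U V t.
Proof.
by rewrite addr_ge0// ?potential_ge0//; rewrite divr_ge0// sqr_ge0.
Qed.

Lemma radial_energy_der a U V t : ode a U V -> 0 < t ->
  der (E U V) t (- (k%:R * coth t * V t ^+ 2)).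
Proof.
move=> o t0.
apply: (derE (der_energy lam q q0 _ _ _ _ (ro_dU _ _ _ _ _ _ o t t0) (ro_dV _ _ _ _ _ _ o t t0))).
by ring.
Qed.

Lemma radial_energy_cont a U V t : ode a U V -> cont (E U V) t.
Proof.
by move=> o; apply: cont_energy => //; [exact: ro_contU o t|exact: ro_contV o t].
Qed.

Lemma coth_gt0 t : 0 < t -> 0 < coth t.
Proof. by move=> t0; rewrite (lt_le_trans ltr01)// coth_ge1. Qed.

Lemma radial_energy_le a U V s t : ode a U V -> 0 <= s -> s <= t -> E U V t <= E U V s.
Proof.
move=> o s0 st; rewrite -lerN2.
apply: (@mono_le R (fun t => - E U V t) s t (fun t => k%:R * coth t * V t ^+ 2) st).
- by move=> x _; apply: contN; exact: radial_energy_cont o.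
- move=> x /andP[sx _]; have x0 : 0 < x by exact: le_lt_trans sx.
  by apply: (derE (derN _ _ _ (radial_energy_der _ _ _ _ o x0))); rewrite opprK.
- move=> x /andP[sx _]; have x0 : 0 < x by exact: le_lt_trans sx.
  by rewrite mulr_ge0 ?sqr_ge0// mulr_ge0// ltW// coth_gt0.
Qed.

(** The friction can destroy energy only at a bounded relative rate: [E * sh ^+ (2 * k)] is
    nondecreasing, its derivative being a positive multiple of the potential. This replaces backward
    uniqueness and excludes double zeros. *)
Lemma radial_energy_gt0 a U V t : ode a U V -> a != 0 -> 0 <= t -> 0 < E U V t.
Proof.
move=> o an0 t0.
have E0 : 0 < E U V 0.
  rewrite /energy (ro_V0 _ _ _ _ _ _ o) expr0n /= mul0r add0r (ro_U0 _ _ _ _ _ _ o).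
  apply: lt_le_trans (potential_ge _ _ q0 _).
  by rewrite divr_gt0// mulr_gt0// exprn_even_gt0.
move: t0; rewrite le_eqVlt => /predU1P[<-//|t0].
have /contP/(_ _ E0)[r r0 rP] := radial_energy_cont _ _ _ 0 o.
pose s := Num.min (r / 2) (t / 2).
have s0 : 0 < s by rewrite lt_min !divr_gt0.
have sr : s <= r / 2 by rewrite ge_min lexx.
have st : s <= t / 2 by rewrite ge_min lexx orbT.
have Es : 0 < E U V s.
  have := rP s; rewrite subr0 gtr0_norm// => /(_ _)/wrap[|]; first by lra.
  by rewrite ltr_norml => /andP[]; lra.
have : E U V s * sh s ^+ (2 * k) <= E U V t * sh t ^+ (2 * k).
  apply: (@mono_le R (fun t => E U V t * sh t ^+ (2 * k)) s t
    (fun x => (2 * k)%:R * sh x ^+ (2 * k).-1 * ch x * potential lam q (U x))); first by lra.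
  - move=> x _; apply: contM; first exact: radial_energy_cont o.
    by apply: contX; exact: der_cont (der_sh x).
  - move=> x /andP[sx _]; have x0 : 0 < x by exact: lt_trans sx.
    have sx0 := sh_gt0 x x0.
    have H1 := radial_energy_der _ _ _ _ o x0; have H2 := der_sh x.
    have H3 := derX (@sh R) (2 * k) _ _ H2.
    apply: (derE (derM _ _ _ _ _ H1 H3)).
    rewrite /energy /coth natrM; move: (potential _ _ _) (V x) => p v.
    have -> : sh x ^+ (2 * k) = sh x * sh x ^+ (2 * k).-1.
      by rewrite -exprS prednK// muln_gt0.
    by field; rewrite gt_eqF.
  - move=> x /andP[sx _]; have x0 : 0 < x by exact: lt_trans sx.
    rewrite mulr_ge0 ?potential_ge0// mulr_ge0 ?(ltW (ch_gt0 x))// mulr_ge0//.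
    by rewrite exprn_ge0// ltW// sh_gt0.
move=> H; have : 0 < E U V t * sh t ^+ (2 * k).
  by apply: lt_le_trans H; rewrite mulr_gt0// exprn_gt0// sh_gt0.
by rewrite pmulr_lgt0// exprn_gt0// sh_gt0.
Qed.

(** Half the distance from [lam] to the critical value [m ^+ 2]. Below [trap_level] the coefficient
    [|U|^q] is at most [rate2], so the equation stays close to [U'' + 2 m U' + lam U = 0], whose
    exponents lie on either side of [- m]. *)
Definition rate2 : R := (m ^+ 2 - lam) / 2.
Definition trap_level : R := lam * (rate2 `^ q^-1) ^+ 2 / 2.

Lemma rate2_gt0 : 0 < rate2.
Proof. by rewrite divr_gt0// subr_gt0. Qed.

Lemma trap_level_gt0 : 0 < trap_level.
Proof. by rewrite divr_gt0// mulr_gt0// exprn_gt0// powR_gt0// rate2_gt0. Qed.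

Lemma trap_level_pow U V t : E U V t < trap_level -> pow q (U t) <= rate2.
Proof.
move=> Et; have : lam * U t ^+ 2 / 2 < trap_level.
  apply: le_lt_trans Et; apply: le_trans (potential_ge _ q q0 _) _.
  by rewrite lerDr divr_ge0// sqr_ge0.
rewrite ltr_pM2r// ltr_pM2l// => H.
have := ler_pow q q0 (U t) (rate2 `^ q^-1).
rewrite powK// (ltW rate2_gt0); apply.
by rewrite -ler_sqr ?nnegrE// !real_normK ?num_real// ltW.
Qed.

(** On the edge [V = - m * U] with [U > 0], the derivative of [V + m * U] is [(m ^+ 2 * (2 * coth -
    1) - lam - |U|^q) * U > 0], so the edge is a barrier; and while [V + m * U > 0], the function
    [expR (m * t) * U] increases, so [U] stays positive. *)
Lemma trap a U V T : ode a U V -> 0 <= T -> E U V T < trap_level ->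
  0 <= U T -> 0 < V T + m * U T ->
  forall t, T < t -> 0 < U t /\ 0 < V t + m * U t.
Proof.
move=> o T0 ET UT QT.
have cU s : cont U s by exact: ro_contU o s.
have cV s : cont V s by exact: ro_contV o s.
have Upos c : T < c -> (forall s, T <= s < c -> 0 < V s + m * U s) -> 0 < U c.
  move=> Tc Q.
  have : expR (m * T) * U T < expR (m * c) * U c.
    apply: (@mono_lt R (fun s => expR (m * s) * U s) T c
      (fun s => expR (m * s) * (V s + m * U s)) Tc).
    - move=> s _; apply: contM => //.
      have H : der (fun x => expR (m * x)) s (expR (m * s) * m) by dtac; ring.
      exact: der_cont H.
    - move=> s /andP[Ts _]; have dU := ro_dU _ _ _ _ _ _ o s (le_lt_trans T0 Ts).
      by dtac; ring.
    - move=> s /andP[Ts sc]; by rewrite mulr_gt0 ?expR_gt0// Q// (ltW Ts) sc.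
  have : 0 <= expR (m * T) * U T by rewrite mulr_ge0// expR_ge0.
  by move=> H1 /(le_lt_trans H1); rewrite pmulr_rgt0 ?expR_gt0.
have Qpos t : T <= t -> 0 < V t + m * U t.
  move=> Tt; rewrite -oppr_lt0.
  apply: (@barrier R (fun s => - (V s + m * U s)) T t _ _ _ t); last by rewrite Tt lexx.
  - by move=> s _; have := cU s; have := cV s => ? ?; ctac.
  - by rewrite oppr_lt0.
  move=> c /andP[Tc ct] below /eqP; rewrite oppr_eq0 => /eqP Qc.
  have Uc : 0 < U c.
    by apply: Upos => // s /below; rewrite oppr_lt0.
  have c0 : 0 < c by exact: le_lt_trans Tc.
  have dU := ro_dU _ _ _ _ _ _ o c c0.
  have dV := ro_dV _ _ _ _ _ _ o c c0.
  eexists; first by repeat dstep.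
  cbv beta; have -> : V c = - (m * U c) by lra.
  have Ec : E U V c < trap_level.
    by apply: le_lt_trans ET; exact: (radial_energy_le _ _ _ _ _ o T0 (ltW Tc)).
  have := trap_level_pow _ _ _ Ec; have := coth_ge1 c c0.
  rewrite /rate2 /force /spow km; move: Uc; move: (coth c) (pow q (U c)) => C p.
  move: (U c) => u u0 C1 pr; rewrite oppr_lt0.
  rewrite [X in 0 < X](_ : _ = (m ^+ 2 * (2 * C - 1) - lam - p) * u); last by ring.
  rewrite mulr_gt0//.
  have : m ^+ 2 * 1 <= m ^+ 2 * (2 * C - 1) by rewrite ler_wpM2l ?sqr_ge0//; lra.
  by have := lam_m; lra.
move=> t Tt; split; last exact: Qpos (ltW Tt).
by apply: Upos => // s /andP[Ts _]; exact: Qpos.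
Qed.

Lemma sqr_le1D x y : x ^+ 2 <= y -> `|x| <= 1 + y.
Proof.
move=> xy; have x0 := normr_ge0 x.
by move: xy; rewrite -(real_normK (num_real x)); move: `|x| x0 => z z0 zy; nra.
Qed.

Lemma radial_bound a U V : ode a U V ->
  exists B, forall t, 0 <= t -> `|U t| <= B /\ `|V t| <= B.
Proof.
move=> o; pose e := E U V 0.
have e0 : 0 <= e by exact: energy_ge0.
exists (1 + 2 * e + 2 * e / lam) => t t0.
have Et : E U V t <= e by exact: radial_energy_le o _ t0.
have P := potential_ge lam q q0 (U t).
have el : 0 <= 2 * e / lam by rewrite divr_ge0 ?mulr_ge0// ltW.
have V2 := sqr_ge0 (V t); have U2 := sqr_ge0 (U t).
split.
- apply: le_trans (sqr_le1D _ (2 * e / lam) _) _; last by lra.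
  rewrite ler_pdivlMr//; move: Et P; rewrite /energy; move: (potential _ _ _) => p.
  by rewrite (mulrC (U t ^+ 2)); lra.
- apply: le_trans (sqr_le1D _ (2 * e) _) _; last by lra.
  have : 0 <= lam * U t ^+ 2 by rewrite mulr_ge0// ltW.
  by move: Et P; rewrite /energy; move: (potential _ _ _) => p; lra.
Qed.

(** The energy is dissipated through [V] only. Adding the small cross term [h * (U * V)] yields a
    nonnegative function that decreases at the rate [h * e] at least as long as the energy is at
    least [e], which cannot last. *)
Lemma radial_energy_small a U V e : ode a U V -> 0 < e ->
  exists2 T, 0 < T & E U V T < e.
Proof.
move=> o e0; apply: contrapT => /forall2NP H.
have {}H t : 1 <= t -> e <= E U V t.
  move=> t1; have [/(_ (lt_le_trans ltr01 t1))//|/negP] := H t.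
  by rewrite -leNgt.
pose b := k%:R * coth (1 : R).
have b0 : 0 < b by rewrite mulr_gt0 ?ltr0n// coth_gt0.
(* [D] collects the [V ^+ 2] terms created by the cross term, the friction part through Young's
   inequality. The first two bounds on [h] make [F] nonnegative, the third lets the friction absorb
   [h * D * V ^+ 2]. *)
pose D := 1 + b ^+ 2 / (2 * lam).
have D0 : 0 < D by rewrite addr_gt0// divr_gt0 ?exprn_gt0// mulr_gt0.
pose h := Num.min (Num.min 1 lam) (m / D).
have h0 : 0 < h by rewrite !lt_min ltr01 lam0 divr_gt0.
have h1 : h <= 1 by rewrite !ge_min lexx.
have hlam : h <= lam by rewrite !ge_min lexx orbT.
have hD : h * D <= m by rewrite -ler_pdivlMr// !ge_min lexx orbT.
pose F t := E U V t + h * (U t * V t).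
have F0 t : 0 <= F t.
  have P := potential_ge lam q q0 (U t).
  rewrite /F /energy; move: P; move: (potential _ _ _) => p; move: (U t) (V t) => u v P.
  have : - (u ^+ 2 + v ^+ 2) <= 2 * (u * v).
    by have := sqr_ge0 (u + v); lra.
  move=> /(ler_wpM2l (ltW h0)).
  have : h * u ^+ 2 <= lam * u ^+ 2 by rewrite ler_wpM2r ?sqr_ge0.
  have : h * v ^+ 2 <= 1 * v ^+ 2 by rewrite ler_wpM2r ?sqr_ge0.
  by rewrite mulrN mulrDr; lra.
(* By this time the decrease [h * e * (T - 1) = h * e + F 1] exceeds [F 1]. *)
pose T := 2 + F 1 / (h * e).
have T1 : 1 <= T.
  rewrite /T; have : 0 <= F 1 / (h * e) by rewrite divr_ge0// mulr_ge0// ltW.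
  by lra.
suff : - F 1 + h * e * 1 <= - F T + h * e * T - h * e * 0 - h * e * T + h * e * 1 + - (h * e * (T - 1)).
  have -> : h * e * (T - 1) = h * e + F 1.
    by rewrite /T; field; rewrite !gt_eqF.
  by have := F0 T; have : 0 < h * e by [rewrite mulr_gt0]; lra.
suff : - F 1 - h * e * 1 <= - F T - h * e * T by lra.
apply: (@mono_le R (fun t => - F t - h * e * t) 1 T
  (fun t => k%:R * coth t * V t ^+ 2 - h * (V t ^+ 2 +
     U t * (- (k%:R * coth t * V t) - force lam q (U t))) - h * e) T1).
- move=> t _; have cU := ro_contU _ _ _ _ _ _ o t; have cV := ro_contV _ _ _ _ _ _ o t.
  have cE := radial_energy_cont _ _ _ t o.
  by rewrite /F; ctac.
- move=> t /andP[t1 _]; have t0 : 0 < t by exact: lt_trans t1.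
  have dU := ro_dU _ _ _ _ _ _ o t t0.
  have dV := ro_dV _ _ _ _ _ _ o t t0.
  have dE := radial_energy_der _ _ _ _ o t0.
  by rewrite /F; dtac; ring.
- move=> t /andP[t1 _]; have t0 : 0 < t by exact: lt_trans t1.
  have := H t (ltW t1).
  have kc : 2 * m <= k%:R * coth t.
    by rewrite -km ler_peMr ?ler0n// coth_ge1.
  have cb : k%:R * coth t <= b.
    by rewrite ler_wpM2l ?ler0n// coth_le// ltW.
  move: (k%:R * coth t) kc cb => c kc cb.
  rewrite /energy /potential /force /spow.
  have p0 := ppow_ge0 q (U t).
  have pE : U t * (pow q (U t) * U t) = ppow q (U t) by rewrite /ppow; ring.
  move: p0 pE; move: (ppow q (U t)) (pow q (U t)) => p r; move: (U t) (V t) => u v p0 pE EE.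
  have -> : u * (- (c * v) - (lam * u + r * u)) = - (c * (u * v)) - lam * u ^+ 2 - p.
    by rewrite -pE; ring.
  have pq : p / (q + 2) <= p.
    by rewrite ler_pdivrMr ?addr_gt0// ler_peMr//; have := q0; lra.
  have young : - (c * (u * v)) <= lam / 2 * u ^+ 2 + b ^+ 2 / (2 * lam) * v ^+ 2.
    rewrite -subr_ge0.
    have -> : lam / 2 * u ^+ 2 + b ^+ 2 / (2 * lam) * v ^+ 2 - - (c * (u * v)) =
      (lam * u + c * v) ^+ 2 / (2 * lam) + (b ^+ 2 - c ^+ 2) / (2 * lam) * v ^+ 2.
      by field; rewrite gt_eqF.
    have l2 : 0 < 2 * lam by rewrite mulr_gt0.
    apply: addr_ge0; first by rewrite divr_ge0 ?sqr_ge0// ltW.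
    apply: mulr_ge0; last exact: sqr_ge0.
    apply: divr_ge0; last exact: ltW.
    rewrite subr_ge0 lerXn2r ?nnegrE ?(ltW b0)//.
    by apply: le_trans kc; rewrite mulr_ge0// ltW.
  have A1 : h * D * v ^+ 2 <= m * v ^+ 2 by rewrite ler_wpM2r// sqr_ge0.
  have A2 : 2 * m * v ^+ 2 <= c * v ^+ 2 by rewrite ler_wpM2r// sqr_ge0.
  have A3 := ler_wpM2l (ltW h0) young.
  have A4 := ler_wpM2l (ltW h0) EE.
  have A5 := ler_wpM2l (ltW h0) pq.
  have A6 : h * v ^+ 2 <= h * D * v ^+ 2.
    rewrite ler_wpM2r ?sqr_ge0// ler_peMr ?(ltW h0)// lerDl.
    by rewrite divr_ge0 ?sqr_ge0// mulr_ge0// ltW.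
  have A7 : 0 <= h * v ^+ 2 by rewrite mulr_ge0 ?sqr_ge0// ltW.
  move: A1 A2 A3 A4 A5 A6 A7; rewrite /D.
  move: (b ^+ 2 / (2 * lam)) (p / (q + 2)) => z w.
  by move: (v ^+ 2) (sqr_ge0 v) (u ^+ 2) (u * v) => *; lra.
Qed.

(** With [y = expR (m * t) * U] and [z = y'] the equation becomes [z' = w >= r ^+ 2 * y]. Here [y]
    is positive and nonincreasing, so the growing mode [z + r * y] cannot be positive; then
    [y' <= - r * y], which improves the exponent [m] by [r]. *)
Lemma radial_fast_decay a U V T : ode a U V -> 0 < T -> E U V T < trap_level ->
  (forall t, T <= t -> 0 < U t) -> (forall t, T <= t -> V t + m * U t <= 0) ->
  exists C r, 0 < r /\ forall t, 0 <= t ->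
    `|U t| <= C * expR (- (m + r) * t) /\ `|V t| <= C * expR (- (m + r) * t).
Proof.
move=> o T0 ET Upos Qneg; pose r := Num.sqrt rate2.
have r0 : 0 < r by rewrite sqrtr_gt0 rate2_gt0.
have rr : r * r = rate2 by rewrite -expr2 sqr_sqrtr// ltW// rate2_gt0.
pose y t := expR (m * t) * U t.
pose z t := expR (m * t) * (V t + m * U t).
pose w t := (m ^+ 2 - lam - pow q (U t) + 2 * m ^+ 2 * (coth t - 1)) * y t
  - 2 * m * (coth t - 1) * z t.
have y0 t : T <= t -> 0 < y t by move=> Tt; rewrite mulr_gt0 ?expR_gt0// Upos.
have z0 t : T <= t -> z t <= 0 by move=> Tt; rewrite pmulr_rle0 ?expR_gt0// Qneg.
have gt0 t : T <= t -> 0 < t by exact: lt_le_trans.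
have dy t : T <= t -> der y t (z t).
  move=> Tt; have dU := ro_dU _ _ _ _ _ _ o t (gt0 t Tt).
  by rewrite /y /z; dtac; ring.
have dz t : T <= t -> der z t (w t).
  move=> Tt; have dU := ro_dU _ _ _ _ _ _ o t (gt0 t Tt).
  have dV := ro_dV _ _ _ _ _ _ o t (gt0 t Tt).
  by rewrite /z; dtac; rewrite /w /z /y /force /spow km; ring.
have wy t : T <= t -> r * r * y t <= w t.
  move=> Tt; have := z0 t Tt; have := y0 t Tt; have := coth_ge1 t (gt0 t Tt).
  have Et : E U V t < trap_level.
    by apply: le_lt_trans ET; exact: (radial_energy_le _ _ _ _ _ o (ltW T0) Tt).
  have := trap_level_pow _ _ _ Et; rewrite rr /w.
  move: (z t) (y t) (coth t) (pow q (U t)) => Z Y c p pr c1 Y0 Z0.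
  have A1 : 0 <= 2 * m * (c - 1) * - Z.
    by rewrite mulr_ge0 ?oppr_ge0// mulr_ge0 ?subr_ge0// mulr_ge0// ltW.
  have A2 : 0 <= (2 * m ^+ 2 * (c - 1)) * Y.
    by rewrite mulr_ge0 ?(ltW Y0)// mulr_ge0 ?subr_ge0// mulr_ge0// sqr_ge0.
  have A3 : 0 <= (rate2 - p) * Y by rewrite mulr_ge0 ?subr_ge0// ltW.
  by move: A1 A2 A3; rewrite /rate2; lra.
have cy t : T <= t -> cont y t by move=> Tt; exact: der_cont (dy t Tt).
have cz t : T <= t -> cont z t by move=> Tt; exact: der_cont (dz t Tt).
have yT t : T <= t -> y t <= y T.
  move=> Tt; rewrite -lerN2.
  apply: (@mono_le R (fun t => - y t) T t (fun t => - z t) Tt).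
  - by move=> s /andP[Ts _]; apply: contN; exact: cy.
  - by move=> s /andP[Ts _]; apply: derN; apply: dy; exact: ltW.
  - by move=> s /andP[Ts _]; rewrite oppr_ge0 z0// ltW.
have zmono s t : T <= s -> s <= t -> z s <= z t.
  move=> Ts st; apply: (@mono_le R z s t w st).
  - by move=> x /andP[sx _]; apply: cz; exact: le_trans sx.
  - by move=> x /andP[sx _]; apply: dz; rewrite (le_trans Ts)// ltW.
  - move=> x /andP[sx _]; have Tx : T <= x by rewrite (le_trans Ts)// ltW.
    by apply: le_trans (wy x Tx); rewrite mulr_ge0 ?(ltW (y0 x Tx))// mulr_ge0// ltW.
have zy t : T <= t -> z t + r * y t <= 0.
  move=> Tt; rewrite leNgt; apply/negP => pos.
  (* A positive [z + r * y] grows at least like [expR (r * (b - t)) >= 1 + r * (b - t)], so at [b]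
     it exceeds [r * y T], although [z b <= 0] and [y b <= y T]. *)
  pose b := t + r * y T / (r * (z t + r * y t)).
  have pos' : 0 < r * (z t + r * y t) by rewrite mulr_gt0.
  have yT0 := y0 T (lexx T).
  have tb : t <= b.
    by rewrite lerDl; exact: divr_ge0 (mulr_ge0 (ltW r0) (ltW yT0)) (ltW pos').
  have Tb := le_trans Tt tb.
  have : (z t + r * y t) * expR (- r * t) <= (z b + r * y b) * expR (- r * b).
    apply: (@mono_le R (fun t => (z t + r * y t) * expR (- r * t)) t b
      (fun t => (w t - r * r * y t) * expR (- r * t)) tb).
    - move=> x /andP[tx _]; have Tx := le_trans Tt tx.
      have H : der (fun x => expR (- r * x)) x (expR (- r * x) * - r) by dtac; ring.
      have ? := der_cont H; have ? := cy x Tx; have ? := cz x Tx.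
      by ctac.
    - move=> x /andP[tx _]; have Tx := le_trans Tt (ltW tx).
      have ? := dy x Tx; have ? := dz x Tx.
      by dtac; ring.
    - move=> x /andP[tx _]; have Tx := le_trans Tt (ltW tx).
      by rewrite mulr_ge0 ?expR_ge0// subr_ge0 wy.
  have E1 : expR (- r * t) = expR (- r * b) * expR (r * (b - t)).
    by rewrite -expRD; congr expR; ring.
  rewrite E1 mulrCA mulrC ler_pM2r ?expR_gt0//.
  have := expR_ge1Dx (r * (b - t)); have := yT b Tb; have := z0 b Tb.
  have E2 : (z t + r * y t) * (r * (b - t)) = r * y T.
    rewrite /b; move: pos; move: (z t + r * y t) => p p0.
    by field; rewrite ?gt_eqF// mulf_neq0 ?gt_eqF.
  move=> zb0 ybT; rewrite -(ler_pM2l pos) => e1.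
  have e2 : r * y b <= r * y T by rewrite ler_pM2l.
  rewrite mulrDr mulr1 E2 in e1.
  by move=> H; clear - pos e1 e2 H zb0; lra.
have decay t : T <= t -> y t <= y T * expR (r * T) * expR (- r * t).
  move=> Tt.
  have : - (y T * expR (r * T)) <= - (y t * expR (r * t)).
    apply: (@mono_le R (fun t => - (y t * expR (r * t))) T t
      (fun t => - (z t + r * y t) * expR (r * t)) Tt).
    - move=> x /andP[Tx _].
      have H : der (fun x => expR (r * x)) x (expR (r * x) * r) by dtac; ring.
      by have ? := der_cont H; have ? := cy x Tx; ctac.
    - by move=> x /andP[Tx _]; have ? := dy x (ltW Tx); dtac; ring.
    - by move=> x /andP[Tx _]; rewrite mulr_ge0 ?expR_ge0// oppr_ge0 zy// ltW.
  rewrite lerN2 => H; rewrite -(ler_pM2r (expR_gt0 (r * t))) -[leRHS]mulrA -expRD.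
  by rewrite mulNr addNr expR0 mulr1.
pose C1 := y T * expR (r * T) * expR r.
have yTr : 0 < y T * expR (r * T) := mulr_gt0 (y0 T (lexx T)) (expR_gt0 _).
have C10 : 0 < C1 := mulr_gt0 yTr (expR_gt0 _).
have decay1 t : T <= t -> y t <= C1 * expR (- r * t).
  move=> Tt; apply: le_trans (decay t Tt) _; rewrite ler_pM2r ?expR_gt0//.
  by rewrite (ler_peMr (ltW yTr))// -expR0 ler_expR ltW.
(* [z] is nondecreasing and nonpositive, so [- z t] is at most its average over the preceding unit
   of time, which is at most [y (t - 1)]; the factor [expR r] in [C1] pays for the shift. *)
have decayz t : T + 1 <= t -> - z t <= C1 * expR (- r * t).
  move=> Tt; have T1 : T <= t - 1 by lra.
  have t1 : t - 1 < t by lra.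
  have [||x /andP[x1 xt] E] := @mean_value R y (t - 1) t z t1.
  - by move=> x /andP[? _]; apply: cy; lra.
  - by move=> x /andP[? _]; apply: dy; lra.
  have E' : t - (t - 1) = 1 by ring.
  rewrite E' mulr1 in E.
  have Tx : T <= x by lra.
  have := zmono x t Tx (ltW xt); have := decay (t - 1) T1.
  have -> : y T * expR (r * T) * expR (- r * (t - 1)) = C1 * expR (- r * t).
    by rewrite /C1 -[RHS]mulrA -expRD; congr (_ * expR _); ring.
  have Tt' : T <= t by lra.
  by have := y0 t Tt'; move: E; move: (z x) (z t) (y t) (y (t - 1)) (C1 * _) => *; lra.
have [B HB] := radial_bound _ _ _ o.
exists ((1 + m) * C1 + B * expR ((m + r) * (T + 1))), r; split => // t t0.
have B0 : 0 <= B by have [+ _] := HB 0 (lexx 0); exact: le_trans.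
have mr0 : 0 < m + r by rewrite addr_gt0.
have eS : expR (- (m + r) * t) = expR (- m * t) * expR (- r * t).
  by rewrite -expRD; congr expR; ring.
have m1 : 0 <= (1 + m) * C1 by apply: mulr_ge0 (ltW C10); rewrite addr_ge0// ltW.
have [tT|Tt] := leP t (T + 1).
  suff key : B <= ((1 + m) * C1 + B * expR ((m + r) * (T + 1))) * expR (- (m + r) * t).
    by have [H1 H2] := HB t t0; split; exact: le_trans key.
  apply: (@le_trans _ _ (B * expR ((m + r) * (T + 1)) * expR (- (m + r) * t))).
    rewrite -mulrA -expRD ler_peMr//.
    apply: le_trans (expR_ge1Dx _); rewrite lerDl.
    have -> : (m + r) * (T + 1) + - (m + r) * t = (m + r) * (T + 1 - t) by ring.
    by rewrite mulr_ge0 ?(ltW mr0)// subr_ge0.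
  by rewrite ler_pM2r ?expR_gt0// lerDr.
have Tt' : T <= t by lra.
have Uy : U t = expR (- m * t) * y t.
  by rewrite /y mulrA -expRD mulNr addNr expR0 mul1r.
have Vz : V t = expR (- m * t) * (z t - m * y t).
  by rewrite /z /y mulrCA -mulrBr mulrA -expRD mulNr addNr expR0 mul1r; ring.
have yt0 := y0 t Tt'; have zt0 := z0 t Tt'.
have key x : `|x| <= (1 + m) * (C1 * expR (- r * t)) -> `|expR (- m * t) * x| <=
   ((1 + m) * C1 + B * expR ((m + r) * (T + 1))) * expR (- (m + r) * t).
  move=> H; rewrite normrM (gtr0_norm (expR_gt0 _)).
  apply: (@le_trans _ _ ((1 + m) * C1 * expR (- (m + r) * t))).
    by rewrite eS mulrCA ler_pM2l ?expR_gt0// -mulrA.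
  by rewrite ler_pM2r ?expR_gt0// lerDl mulr_ge0// expR_ge0.
have D1 := decay1 t Tt'; have D2 := decayz t (ltW Tt).
have D3 : m * y t <= m * (C1 * expR (- r * t)) by rewrite ler_pM2l.
have D4 : 0 < m * y t := mulr_gt0 m0 yt0.
have D5 : 0 < C1 * expR (- r * t) := mulr_gt0 C10 (expR_gt0 _).
have D6 : 0 < m * (C1 * expR (- r * t)) := mulr_gt0 m0 D5.
split; [rewrite Uy|rewrite Vz]; apply: key.
- by rewrite gtr0_norm//; move: D1 D5 D6; move: (C1 * _) => *; lra.
- rewrite ler0_norm; last by lra.
  by move: D2 D3 D5; move: (C1 * _) => *; lra.
Qed.

End Trap.

(** * Shooting *)

Section Threshold.
Context {R : realType}.
Implicit Types (a b x y t s : R).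

Lemma near_lt (f : R -> R) a c : cont f a -> f a < c -> \forall b \near a, f b < c.
Proof. by move=> cf fa; apply: (cf [set y | y < c]%classic); exact: lt_nbhsl. Qed.

Lemma near_gt (f : R -> R) a c : cont f a -> c < f a -> \forall b \near a, c < f b.
Proof. by move=> cf fa; apply: (cf [set y | c < y]%classic); exact: lt_nbhsr. Qed.

(** The infimum of the set is outside it by openness, but points of the set accumulate there. Any
    property that holds for all nearby amplitudes and excludes [P] is thus refuted at the
    infimum. *)
Lemma threshold (P : R -> Prop) A a0 : 0 < a0 -> 0 < A -> P A ->
  (forall a, 0 < a < a0 -> ~ P a) -> (forall a, P a -> \forall b \near a, P b) ->
  exists a, [/\ 0 < a <= A, ~ P a &
    ~ \forall b \near a, 0 < b <= A -> ~ P b].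
Proof.
move=> a00 A0 PA Psmall Popen.
pose S : set R := [set a | 0 < a <= A /\ P a]%classic.
have SA : S A by split; rewrite // A0 lexx.
have Slb x : S x -> a0 <= x.
  by move=> [/andP[x0 _] Px]; rewrite leNgt; apply/negP => xa; apply: (Psmall x) => //; rewrite x0.
have Sinf : has_inf S by split; [exists A|exists a0].
have aS : a0 <= inf S by apply: lb_le_inf => //; exists A.
have SleA : inf S <= A by apply: (ge_inf Sinf.2).
have S0 : 0 < inf S by exact: lt_le_trans aS.
exists (inf S); split; first by rewrite S0.
- move=> /Popen /nbhs_ballP[r /= r0 rP].
  pose b := Num.max (inf S / 2) (inf S - r / 2).
  have b1 : inf S / 2 <= b by rewrite /b le_max lexx.
  have b2 : inf S - r / 2 <= b by rewrite /b le_max lexx orbT.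
  have bS : b < inf S by rewrite /b gt_max; apply/andP; split; lra.
  have Pb : P b by apply: rP; rewrite /ball /= gtr0_norm; lra.
  have : inf S <= b; last by rewrite leNgt bS.
  by apply: (ge_inf Sinf.2); split => //; apply/andP; split; lra.
- move=> /nbhs_ballP[r /= r0 rP].
  have [b [bA Pb] br] := inf_adherent r0 Sinf.
  have Sb : inf S <= b by apply: (ge_inf Sinf.2).
  apply: (rP b) => //; rewrite /ball /= ler0_norm ?subr_le0//.
  by rewrite opprB ltrBlDl.
Qed.

End Threshold.

Section Shooting.
Context {R : realType} (k : nat) (lam q : R).
Hypothesis k0 : (0 < k)%N.
Hypothesis lam0 : 0 < lam.
Hypothesis q0 : 0 < q.
Let m : R := k%:R / 2.
Hypothesis lam_m : lam < m ^+ 2.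
Implicit Types (x y t s a b T : R) (U V : R -> R).
Local Notation E := (energy lam q).
Local Notation ode := (radial_ode k lam q).
Local Notation level := (trap_level k lam q).

Definition goes_neg U : Prop := exists2 t, 0 < t & U t < 0.
Definition goes_neg_pos U : Prop :=
  exists t1 t2, [/\ 0 < t1, t1 < t2, U t1 < 0 & 0 < U t2].

Lemma transversal a U V t : ode a U V -> a != 0 -> 0 <= t -> U t = 0 -> V t != 0.
Proof.
move=> o an0 t0 Ut; apply/eqP => Vt.
have := radial_energy_gt0 k lam q k0 lam0 q0 _ _ _ _ o an0 t0.
by rewrite /energy /potential /ppow Ut Vt expr0n /= !(mulr0, mul0r, addr0) ltxx.
Qed.

(** A zero at [t] would be an interior minimum, hence a double zero, which [transversal]
    excludes. *)
Lemma no_touch a U V s t r : ode a U V -> a != 0 -> 0 <= s -> s < t -> t < r ->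
  (forall x, s < x < r -> 0 <= U x) -> 0 < U t.
Proof.
move=> o an0 s0 st tr Upos; have t0 : 0 < t by exact: le_lt_trans st.
have Ut : 0 <= U t by apply: Upos; rewrite st.
rewrite lt_neqAle Ut andbT; apply/eqP => Ut0.
have /negP := transversal _ _ _ t o an0 (ltW t0) (esym Ut0); apply; apply/eqP.
have dU := ro_dU _ _ _ _ _ _ o t t0.
have ar : s <= r by rewrite ltW// (lt_trans st).
have H0 : is_derive t 1 U 0.
  apply: (@derive1_at_min R U s r t ar); last 2 first.
  - by rewrite in_itv /= st.
  - by move=> x; rewrite in_itv /= -Ut0; exact: Upos.
  move=> x; rewrite in_itv /= => /andP[sx _].
  by have [] := ro_dU _ _ _ _ _ _ o x (le_lt_trans s0 sx).
exact: der_unique dU H0.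
Qed.

Lemma cont_min_pos U s t : s <= t -> (forall x, s <= x <= t -> cont U x) ->
  (forall x, s <= x <= t -> 0 < U x) ->
  exists2 c, 0 < c & forall x, s <= x <= t -> c <= U x.
Proof.
move=> st cU Upos.
have [c + H] := EVT_min st (cont_within _ _ _ cU).
rewrite in_itv /= => sct; exists (U c); first exact: Upos.
by move=> x sxt; apply: H; rewrite in_itv.
Qed.

Variables (u v : R -> R -> R) (A C K : R).
Hypothesis uv_ode : forall a, 0 <= a <= A -> ode a (u a) (v a).
Hypothesis uv_dist : forall a b t, 0 <= t ->
  `|u a t - u b t| <= C * `|a - b| * expR (K * t) /\
  `|v a t - v b t| <= C * `|a - b| * expR (K * t).

Lemma unif_close a T e : 0 < e -> \forall b \near a, forall t, 0 <= t <= T ->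
  `|u a t - u b t| < e /\ `|v a t - v b t| < e.
Proof.
move=> e0; pose D := (`|C| + 1) * expR (`|K| * `|T|).
have D0 : 0 < D by rewrite mulr_gt0 ?expR_gt0// ltr_wpDl.
apply/nbhs_ballP; exists (e / D); first exact: divr_gt0.
move=> b; rewrite /ball /= ltr_pdivlMr// => ab t /andP[t0 tT].
have key : C * `|a - b| * expR (K * t) < e.
  apply: le_lt_trans ab; rewrite /D mulrA (mulrC `|a - b|).
  apply: ler_pM => //.
  - have := uv_dist a b 0 (lexx 0); rewrite mulr0 expR0 mulr1 => -[H _].
    exact: le_trans (normr_ge0 _) H.
  - by rewrite ler_wpM2r// (le_trans (ler_norm C))// lerDl.
  - rewrite ler_expR (le_trans (ler_norm _))// normrM (ger0_norm t0).
    by rewrite ler_wpM2l// (le_trans tT)// ler_norm.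
by have [H1 H2] := uv_dist a b t t0; split; apply: le_lt_trans key.
Qed.

Lemma cont_param t : 0 <= t -> forall a, cont (fun b => u b t) a /\ cont (fun b => v b t) a.
Proof.
move=> t0 a; split; apply/contP => e e0.
- have /nbhs_ballP[r /= r0 rP] := unif_close a t e e0.
  exists r => // b ba; rewrite distrC.
  by have [] := rP b _ t _; rewrite /ball /= ?t0 ?lexx// distrC.
- have /nbhs_ballP[r /= r0 rP] := unif_close a t e e0.
  exists r => // b ba; rewrite distrC.
  by have [] := rP b _ t _; rewrite /ball /= ?t0 ?lexx// distrC.
Qed.

Lemma near_energy a t c : 0 <= t -> E (u a) (v a) t < c ->
  \forall b \near a, E (u b) (v b) t < c.
Proof.
move=> t0; have [cu cv] := cont_param t t0 a.
apply: (@near_lt R (fun b => E (u b) (v b) t)).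
exact: (@cont_energy R lam q q0 (fun b => u b t) (fun b => v b t) a cu cv).
Qed.

Lemma goes_neg_open a : goes_neg (u a) -> \forall b \near a, goes_neg (u b).
Proof.
move=> [t t0 ut]; have [cu _] := cont_param t (ltW t0) a.
by near=> b; exists t => //; near: b; exact: near_lt cu ut.
Unshelve. all: by end_near. Qed.

Lemma goes_neg_pos_open a : goes_neg_pos (u a) -> \forall b \near a, goes_neg_pos (u b).
Proof.
move=> [t [s [t0 ts ut us]]]; have [cu _] := cont_param t (ltW t0) a.
have [cu' _] := cont_param s (ltW (lt_trans t0 ts)) a.
near=> b; exists t, s; split => //; near: b; first exact: near_lt cu ut.
exact: near_gt cu' us.
Unshelve. all: by end_near. Qed.

(** A small amplitude is trapped from the time 0 on: its energy is below the level and
    [V + m * U = m * a > 0] there. *)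
Lemma small_stays_pos : exists2 a0, 0 < a0 & forall a, 0 < a <= A -> a < a0 ->
  forall t, 0 < t -> 0 < u a t.
Proof.
have l0 := trap_level_gt0 k lam q lam0 lam_m.
have c0 : cont (potential lam q) 0 by exact: der_cont (der_potential lam q q0 0).
have p0 : potential lam q (0 : R) = 0.
  by rewrite /potential /ppow expr0n /= !(mulr0, mul0r, addr0).
have /contP/(_ _ l0)[r r0 rP] := c0.
exists r => // a /andP[a0 aA] ar t t0.
have o : ode a (u a) (v a) by apply: uv_ode; rewrite (ltW a0).
have [] // := trap k lam q lam0 q0 lam_m _ _ _ 0 o (lexx 0) _ _ _ t t0.
- rewrite /energy (ro_V0 _ _ _ _ _ _ o) (ro_U0 _ _ _ _ _ _ o) expr0n /= mul0r add0r.
  have := rP a; rewrite subr0 gtr0_norm// p0 subr0 => /(_ ar).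
  exact: le_lt_trans (ler_norm _).
- by rewrite (ro_U0 _ _ _ _ _ _ o) ltW.
- rewrite (ro_V0 _ _ _ _ _ _ o) (ro_U0 _ _ _ _ _ _ o) add0r mulr_gt0//.
  by rewrite divr_gt0// ltr0n.
Qed.

(** Being in the trap is a strict condition on the values at the single time [t], hence open in the
    amplitude, and it controls all later times. *)
Lemma near_trapped_pos a t : 0 < a -> 0 <= t -> E (u a) (v a) t < level ->
  0 < u a t -> 0 < v a t + m * u a t ->
  \forall b \near a, 0 < b <= A -> forall s, t <= s -> 0 < u b s.
Proof.
move=> a0 t0 Et ut qt; have [cu cv] := cont_param t t0 a.
have cq : cont (fun b => v b t + m * u b t) a by ctac.
near=> b => /andP[b0 bA] s; rewrite le_eqVlt => /predU1P[<-|ts].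
  by near: b; exact: near_gt cu ut.
have o : ode b (u b) (v b) by apply: uv_ode; rewrite ltW.
have [] // := trap k lam q lam0 q0 lam_m _ _ _ t o t0 _ _ _ s ts.
- by near: b; exact: near_energy.
- by rewrite ltW//; near: b; exact: near_gt cu ut.
- by near: b; exact: near_gt cq qt.
Unshelve. all: by end_near. Qed.

Lemma near_trapped_neg a t : 0 < a -> 0 <= t -> E (u a) (v a) t < level ->
  u a t < 0 -> v a t + m * u a t < 0 ->
  \forall b \near a, 0 < b <= A -> forall s, t <= s -> u b s < 0.
Proof.
move=> a0 t0 Et ut qt; have [cu cv] := cont_param t t0 a.
have cq : cont (fun b => v b t + m * u b t) a by ctac.
near=> b => /andP[b0 bA] s; rewrite le_eqVlt => /predU1P[<-|ts].
  by near: b; exact: near_lt cu ut.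
have o : ode b (u b) (v b) by apply: uv_ode; rewrite ltW.
have [] // := trap k lam q lam0 q0 lam_m _ _ _ t (radial_odeN _ _ _ _ _ _ o) t0 _ _ _ s ts.
- by rewrite energyN; near: b; exact: near_energy.
- by rewrite oppr_ge0 ltW//; near: b; exact: near_lt cu ut.
- by rewrite mulrN -opprD oppr_gt0; near: b; exact: near_lt cq qt.
- by rewrite oppr_gt0.
Unshelve. all: by end_near. Qed.

Lemma near_pos_segment a T : 0 <= a <= A -> (forall t, 0 <= t <= T -> 0 < u a t) ->
  0 <= T -> \forall b \near a, forall t, 0 <= t <= T -> 0 < u b t.
Proof.
move=> aA upos T0.
have [|c c0 cP] := cont_min_pos _ _ _ T0 _ upos.
  by move=> x _; exact: ro_contU (uv_ode a aA) x.
near=> b => t tT.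
have /(_ t tT)[+ _] : forall t, 0 <= t <= T -> `|u a t - u b t| < c /\ `|v a t - v b t| < c.
  by near: b; exact: unif_close.
by have := cP t tT; rewrite ltr_norml => + /andP[]; lra.
Unshelve. all: by end_near. Qed.

Lemma goes_negN_pos a U V : 0 < a -> ode a U V -> ~ goes_neg U ->
  forall t, 0 <= t -> 0 < U t.
Proof.
move=> a0 o H t; rewrite le_eqVlt => /predU1P[<-|t0].
  by rewrite (ro_U0 _ _ _ _ _ _ o).
have t1 : t < t + 1 by rewrite ltrDl.
apply: (no_touch a U V 0 t (t + 1) o) => //; first by rewrite gt_eqF.
move=> x /andP[x0 _]; rewrite leNgt; apply/negP => Ux.
by apply: H; exists x.
Qed.

(** The first zero is crossed transversally, so [U] is negative just after it and cannot be positive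
    later without going negative and then positive; [no_touch] applied to [- U] removes later
    zeros. *)
Lemma goes_neg_posN_structure a U V : 0 < a -> ode a U V -> goes_neg U ->
  ~ goes_neg_pos U -> exists z, [/\ 0 < z, U z = 0, V z < 0,
    forall t, 0 <= t < z -> 0 < U t & forall t, z < t -> U t < 0].
Proof.
move=> a0 o [t1 t10 Ut1] H.
have an0 : a != 0 by rewrite gt_eqF.
have cU t : cont U t by exact: ro_contU o t.
have [||||z [/andP[z0 zt1] Uz below]] := @first_crossing R (fun t => - U t) 0 t1.
- exact: ltW.
- by move=> x _; apply: contN.
- by rewrite oppr_lt0 (ro_U0 _ _ _ _ _ _ o).
- by rewrite oppr_ge0 ltW.
have {}Uz : U z = 0 by apply/eqP; rewrite -oppr_eq0; apply/eqP.
have {}below t : 0 <= t < z -> 0 < U t by move=> /below; rewrite oppr_lt0.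
have dU := ro_dU _ _ _ _ _ _ o z z0.
have Vz : V z < 0.
  rewrite lt_neqAle (transversal a U V z o an0 (ltW z0) Uz)/= -oppr_ge0.
  apply: (der_ge0_left (derN _ _ _ dU) z0) => y /andP[y0 yz].
  by rewrite Uz oppr0 oppr_le0 ltW// below// (ltW y0).
have [r r0 rP] := der_lt0_near dU Vz.
have Ule t : z < t -> U t <= 0.
  move=> zt; rewrite leNgt; apply/negP => Ut.
  apply: H; exists (z + Num.min (r / 2) ((t - z) / 2)), t.
  set e := Num.min _ _.
  have e0 : 0 < e by rewrite lt_min !divr_gt0 ?subr_gt0.
  have er : e <= r / 2 by rewrite ge_min lexx.
  have et : e <= (t - z) / 2 by rewrite ge_min lexx orbT.
  have ez : z < z + e by rewrite ltrDl.
  split => //; [by rewrite addr_gt0|by lra|].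
  by have [|/(_ ez) + _] := rP (z + e); [rewrite addrC addKr gtr0_norm//; lra|rewrite Uz].
exists z; split => // t zt.
have t1' : t < t + 1 by rewrite ltrDl.
rewrite -oppr_gt0.
apply: (no_touch (- a) (fun t => - U t) (fun t => - V t) z t (t + 1)) => //.
- exact: radial_odeN.
- by rewrite oppr_eq0.
- exact: ltW.
- by move=> x /andP[zx _]; rewrite oppr_ge0 Ule.
Qed.

(** The hyperbolic volume grows like [expR (k * t)], which squares of size [expR (- 2 * m * t)] just
    balance; any [r > 0] makes the energy integral converge. *)
Definition decaying U V : Prop := exists C r, 0 < r /\ forall t, 0 <= t ->
  `|U t| <= C * expR (- (m + r) * t) /\ `|V t| <= C * expR (- (m + r) * t).

(** The energy eventually drops below the level; from then on the last hypothesis keeps the solution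
    on the side of the edge where [radial_fast_decay] applies. *)
Lemma decaying_of_trap a U V T0 : ode a U V -> 0 <= T0 ->
  (forall t, T0 <= t -> 0 < U t) ->
  (forall t, T0 <= t -> E U V t < level -> V t + m * U t <= 0) -> decaying U V.
Proof.
move=> o T00 Upos Q.
have [T T1 ET] := radial_energy_small k lam q k0 lam0 q0 _ _ _ _ o
  (trap_level_gt0 k lam q lam0 lam_m).
have T'0 : 0 < Num.max T T0 by rewrite lt_max T1.
have T'1 : T0 <= Num.max T T0 by rewrite le_max lexx orbT.
have ET' t : Num.max T T0 <= t -> E U V t < level.
  move=> Tt; apply: le_lt_trans ET.
  by apply: (radial_energy_le _ _ _ _ _ _ _ _ _ o (ltW T1)) => //; rewrite (le_trans _ Tt)// le_max lexx.
apply: (radial_fast_decay k lam q k0 lam0 q0 lam_m _ _ _ (Num.max T T0) o T'0).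
- exact: ET'.
- by move=> t Tt; apply: Upos; exact: le_trans Tt.
- by move=> t Tt; apply: Q; [exact: le_trans Tt|exact: ET'].
Qed.

(** If the threshold profile entered the trap at [t], the profiles nearby would be positive on
    [[0, t]] by uniform closeness and afterwards by trapping, so none of them would go negative. *)
Lemma positive_profile : 0 < A -> goes_neg (u A) ->
  exists a, [/\ 0 < a <= A, forall t, 0 <= t -> 0 < u a t & decaying (u a) (v a)].
Proof.
move=> A0 PA; have [a0 a00 small] := small_stays_pos.
have [||a [aA na nnear]] := threshold (fun a => goes_neg (u a)) A (Num.min a0 A) _ A0 PA _ goes_neg_open.
- by rewrite lt_min a00.
- move=> a /andP[a1]; rewrite lt_min => /andP[a2 aA] [t t0].
  by apply/negP; rewrite -leNgt ltW// small// a1 ltW.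
have a1 : 0 < a by case/andP: aA.
have aA' : 0 <= a <= A by case/andP: aA => /ltW -> ->.
have o := uv_ode a aA'.
have pos := goes_negN_pos a _ _ a1 o na.
exists a; split => //; apply: (decaying_of_trap a _ _ 0 o) => // t t0 Et.
rewrite leNgt; apply/negP => Q; apply: nnear.
near=> b => bA [s s0]; apply/negP; rewrite -leNgt ltW//.
have [st|ts] := leP s t.
  have : forall x, 0 <= x <= t -> 0 < u b x; last by apply; rewrite (ltW s0).
  by near: b; apply: near_pos_segment => // x /andP[x0 _]; exact: pos.
have : 0 < b <= A -> forall x, t <= x -> 0 < u b x; last by apply=> //; exact: ltW.
by near: b; apply: near_trapped_pos => //; exact: pos.
Unshelve. all: by end_near. Qed.

Lemma sign_changing_profile : 0 < A -> goes_neg_pos (u A) ->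
  exists a, [/\ 0 < a <= A, goes_neg (u a) & decaying (u a) (v a)].
Proof.
move=> A0 PA; have [a0 a00 small] := small_stays_pos.
have [||a [aA na nnear]] := threshold (fun a => goes_neg_pos (u a)) A (Num.min a0 A) _ A0 PA _
  goes_neg_pos_open.
- by rewrite lt_min a00.
- move=> a /andP[a1]; rewrite lt_min => /andP[a2 aA] [t [s [t0 ts ut us]]].
  by move: ut; apply/negP; rewrite -leNgt ltW// small// a1 ltW.
have a1 : 0 < a by case/andP: aA.
have aA' : 0 <= a <= A by case/andP: aA => /ltW -> ->.
have o := uv_ode a aA'.
have an0 : a != 0 by rewrite gt_eqF.
(* Otherwise the threshold profile is positive, and nearby profiles are positive up to [T] with
   small energy there. If one becomes negative later, the mean value theorem for
   [expR (m * x) * u b x] gives a point where both [u b] and [v b + m * u b] are negative: it is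
   trapped on the negative side and never becomes positive again. *)
have neg : goes_neg (u a).
  apply: contrapT => neg; have pos := goes_negN_pos a _ _ a1 o neg.
  have [T T0 ET] := radial_energy_small k lam q k0 lam0 q0 _ _ _ _ o
    (trap_level_gt0 k lam q lam0 lam_m).
  apply: nnear; near=> b => bA [t [s [t0 ts ut us]]].
  have bpos : forall x, 0 <= x <= T -> 0 < u b x.
    by near: b; apply: near_pos_segment => //; [move=> x /andP[x0 _]; exact: pos|exact: ltW].
  have Eb : E (u b) (v b) T < level by near: b; apply: near_energy => //; exact: ltW.
  have Tt : T < t.
    rewrite ltNge; apply/negP => tT.
    by move: ut; apply/negP; rewrite -leNgt ltW// bpos// (ltW t0).
  have bA' : 0 <= b <= A by case/andP: bA => /ltW -> ->.
  have ob := uv_ode b bA'.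
  have [|||c [/andP[Tc ct] uc cneg]] := @last_crossing R (u b) T t (ltW Tt).
  - by move=> x _; exact: ro_contU ob x.
  - by rewrite ltW// bpos// (ltW T0) lexx.
  - by [].
  have c0 : 0 < c := lt_le_trans T0 Tc.
  have [||x /andP[cx xt] Ex] := @mean_value R (fun x => expR (m * x) * u b x) c t
    (fun x => expR (m * x) * (v b x + m * u b x)) ct.
  - move=> x _; apply: contM; last exact: ro_contU ob x.
    have H : der (fun x => expR (m * x)) x (expR (m * x) * m) by dtac; ring.
    exact: der_cont H.
  - move=> x /andP[cx _]; have dU := ro_dU _ _ _ _ _ _ ob x (lt_trans c0 cx).
    by dtac; ring.
  have qx : v b x + m * u b x < 0.
    have : expR (m * t) * u b t < 0 by rewrite pmulr_rlt0 ?expR_gt0.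
    rewrite uc mulr0 subr0 in Ex; rewrite Ex.
    by rewrite pmulr_llt0 ?subr_gt0// pmulr_rlt0 ?expR_gt0.
  have ux : u b x < 0 by apply: cneg; rewrite cx ltW.
  have x0 : 0 <= x by rewrite ltW// (lt_trans c0).
  have Ex' : E (u b) (v b) x < level.
    apply: le_lt_trans Eb; apply: (radial_energy_le _ _ _ _ _ _ _ _ _ ob (ltW T0)) => //.
    by rewrite (le_trans Tc)// ltW.
  have [||||+ _] := trap k lam q lam0 q0 lam_m _ _ _ x (radial_odeN _ _ _ _ _ _ ob) x0 _ _ _ s.
  - by rewrite energyN.
  - by rewrite oppr_ge0 ltW.
  - by rewrite mulrN -opprD oppr_gt0.
  - exact: lt_trans xt ts.
  by rewrite oppr_gt0 => /(lt_trans us); rewrite ltxx.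
have [z [z0 uz vz pos neg']] := goes_neg_posN_structure a _ _ a1 o neg na.
exists a; split => //.
suff [D [r [r0 H]]] : decaying (fun t => - u a t) (fun t => - v a t).
  by exists D, r; split=> // t /H; rewrite !normrN.
apply: (decaying_of_trap (- a) _ _ (z + 1) (radial_odeN _ _ _ _ _ _ o)).
- by rewrite addr_ge0// ltW.
- by move=> t zt; rewrite oppr_gt0 neg'// (lt_le_trans _ zt)// ltrDl.
move=> t zt; rewrite energyN mulrN -opprD oppr_le0 => Et.
(* Suppose the threshold profile is trapped on the negative side at [t]. A nearby profile is
   positive up to [z - r], decreasing between [z - r] and [z + r], negative from [z + r] to [t] by
   closeness and after [t] by trapping, so it is never positive after a negative value. *)
rewrite leNgt; apply/negP => Q; apply: nnear.
have zt' : z < t by rewrite (lt_le_trans _ zt)// ltrDl.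
have cv : cont (v a) z by exact: ro_contV o z.
have vz2 : 0 < - v a z / 2 by rewrite divr_gt0// oppr_gt0.
have /contP/(_ _ vz2)[r1 r10 r1P] := cv.
pose r := Num.min (Num.min (r1 / 2) (z / 2)) ((t - z) / 2).
have r0 : 0 < r by rewrite !lt_min !divr_gt0// subr_gt0.
have rr1 : r <= r1 / 2 by rewrite !ge_min lexx.
have rz : r <= z / 2 by rewrite !ge_min lexx orbT.
have rt : r <= (t - z) / 2 by rewrite ge_min lexx orbT.
move: r r0 rr1 rz rt => r r0 rr1 rz rt.
have cU x : cont (u a) x by exact: ro_contU o x.
have zr0 : 0 <= z - r by lra.
have [||c1 c10 c1P] := cont_min_pos (u a) 0 (z - r) zr0.
- by move=> x _.
- by move=> x /andP[x0 xz]; apply: pos; rewrite x0; lra.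
have zrt : z + r <= t by lra.
have [||c2 c20 c2P] := cont_min_pos (fun x => - u a x) (z + r) t zrt.
- by move=> x _; exact: contN.
- by move=> x /andP[xz _]; rewrite oppr_gt0; apply: neg'; lra.
pose e := Num.min (Num.min c1 c2) (- v a z / 2).
have e0 : 0 < e by rewrite !lt_min c10 c20.
have e1 : e <= c1 by rewrite !ge_min lexx.
have e2 : e <= c2 by rewrite !ge_min lexx orbT.
have e3 : e <= - v a z / 2 by rewrite ge_min lexx orbT.
move: e e0 e1 e2 e3 => e e0 e1 e2 e3.
have t0 : 0 <= t by rewrite ltW// (lt_trans z0).
near=> b => bA [s1 [s2 [s10 s12 us1 us2]]].
have close : forall x, 0 <= x <= t -> `|u a x - u b x| < e /\ `|v a x - v b x| < e.
  by near: b; exact: unif_close.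
have trapped : 0 < b <= A -> forall x, t <= x -> u b x < 0.
  by near: b; apply: near_trapped_neg => //; exact: neg'.
have s2t : s2 < t.
  by rewrite ltNge; apply/negP => /(trapped bA) H; move: us2; rewrite ltNge ltW.
have s2r : s2 < z + r.
  rewrite ltNge; apply/negP => H; have := c2P s2; rewrite H (ltW s2t) => /(_ isT).
  have [|+ _] := close s2; first by rewrite (ltW (lt_trans s10 s12)) ltW.
  by rewrite ltr_norml => /andP[]; lra.
have s1r : z - r < s1.
  rewrite ltNge; apply/negP => H; have := c1P s1; rewrite H (ltW s10) => /(_ isT).
  have [|+ _] := close s1; first by rewrite (ltW s10) ltW// (lt_trans s12).
  by rewrite ltr_norml => /andP[]; lra.
have bA' : 0 <= b <= A by case/andP: bA => /ltW -> ->.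
have ob := uv_ode b bA'.
have : - u b s1 < - u b s2; last by lra.
apply: (@mono_lt R (fun x => - u b x) s1 s2 (fun x => - v b x) s12).
- by move=> x _; apply: contN; exact: ro_contU ob x.
- move=> x /andP[x1 _]; apply: derN; exact: (ro_dU _ _ _ _ _ _ ob x (lt_trans s10 x1)).
- move=> x /andP[x1 x2]; have [|_ +] := close x.
    by apply/andP; split; rewrite ltW//; [exact: lt_trans x1|exact: lt_trans s2t].
  have := r1P x; have -> : `|x - z| < r1 by rewrite ltr_norml; apply/andP; split; lra.
  by move=> /(_ isT); rewrite !ltr_norml => /andP[? ?] /andP[? ?]; lra.
Unshelve. all: by end_near. Qed.

End Shooting.

(** * Large amplitudes *)

Section EmdenFowler.
Context {R : realType} (nu mu q : R) (rho drho : R -> R).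
Hypothesis mu0 : 0 < mu.
Hypothesis q0 : 0 < q.
Hypothesis rho_gt : forall s : R, s < 0 -> expR s <= rho s.
Hypothesis der_rho : forall s : R, s < 0 -> der rho s (drho s).
Hypothesis drho_ge : forall s : R, s < 0 -> rho s <= drho s.
Implicit Types (s x y c d t : R) (w z : R -> R).

Let n2 s : R := nu ^+ 2 - mu * rho s ^+ 2.

(** The equation [w'' = (nu ^+ 2 - mu * rho ^+ 2 - |w|^q) * w]. For [rho = 0] it is autonomous and
    its homoclinic orbit is the bubble; where [w] is small it behaves like [expR (nu * s)] or
    [expR (- nu * s)]. *)
Record ef_sol w z : Prop := EfSol {
  ef_dw : forall s, s < 0 -> der w s (z s);
  ef_dz : forall s, s < 0 -> der z s ((n2 s - pow q (w s)) * w s) }.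

Definition ef_energy w z s : R :=
  z s ^+ 2 / 2 - n2 s * w s ^+ 2 / 2 + ppow q (w s) / (q + 2).

Lemma ef_solN w z : ef_sol w z -> ef_sol (fun s => - w s) (fun s => - z s).
Proof.
move=> [dw dz]; split=> s s0; first by apply: derN; exact: dw.
by apply: (derE (derN _ _ _ (dz s s0))); rewrite powN; ring.
Qed.

Lemma ef_energyN w z s : ef_energy (fun s => - w s) (fun s => - z s) s = ef_energy w z s.
Proof. by rewrite /ef_energy ppowN !sqrrN. Qed.

Lemma der_ef_energy w z s : ef_sol w z -> s < 0 ->
  der (ef_energy w z) s (mu * rho s * drho s * w s ^+ 2).
Proof.
move=> [dw dz] s0; have Hw := dw s s0; have Hz := dz s s0; have Hr := der_rho s s0.
have Hp := der_comp _ _ _ _ _ (der_ppow q q0 (w s)) Hw.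
rewrite /ef_energy /n2; dtac.
rewrite /spow /n2; field; rewrite gt_eqF// addr_gt0//.
Qed.

Let rho_gt0 s : s < 0 -> 0 < rho s.
Proof. by move=> /rho_gt; exact: lt_le_trans (expR_gt0 s). Qed.

Lemma ef_energy_le w z s t : ef_sol w z -> s <= t -> t < 0 ->
  ef_energy w z s <= ef_energy w z t.
Proof.
move=> o st t0.
apply: (@mono_le R (ef_energy w z) s t (fun s => mu * rho s * drho s * w s ^+ 2) st).
- move=> x /andP[_ xt]; exact: der_cont (der_ef_energy w z x o (le_lt_trans xt t0)).
- move=> x /andP[_ xt]; exact: (der_ef_energy w z x o (lt_trans xt t0)).
- move=> x /andP[_ xt]; have x0 := lt_trans xt t0.
  have r0 := rho_gt0 x x0; have dr := lt_le_trans r0 (drho_ge x x0).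
  by rewrite mulr_ge0 ?sqr_ge0// mulr_ge0 ?(ltW dr)// mulr_ge0// ltW.
Qed.

(** Slopes slightly below [nu]: [nu2 ^+ 2] bounds the linear coefficient from below up to [S],
    slopes up to [nu3] are forced to decrease, and [nu1] is the rate of growth and decay that is
    finally guaranteed. *)
Variables (nu1 nu2 nu3 S : R).
Hypothesis nu1_gt0 : 0 < nu1.
Hypothesis nu13 : nu1 < nu3.
Hypothesis nu32 : nu3 < nu2.
Hypothesis nu2_nu : nu2 < nu.
Hypothesis S0 : S < 0.
Hypothesis n2_ge : forall s, s <= S -> nu2 ^+ 2 <= n2 s.

Let n2_le s : n2 s <= nu ^+ 2.
Proof. by rewrite gerBl mulr_ge0 ?sqr_ge0// ltW. Qed.

Let nu3_gt0 : 0 < nu3. Proof. exact: lt_trans nu13. Qed.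
Let nu2_gt0 : 0 < nu2. Proof. exact: lt_trans nu32. Qed.
Let nu_gt0 : 0 < nu. Proof. exact: lt_trans nu2_nu. Qed.
Let q2_gt0 : 0 < q + 2. Proof. by rewrite addr_gt0. Qed.

(** Half of the rate [q / 2 * (nu2 ^+ 2 - nu3 ^+ 2)] provided by a nonnegative energy; the other
    half keeps the inequality strict. *)
Let D : R := q / 4 * (nu2 ^+ 2 - nu3 ^+ 2).
Let D_gt0 : 0 < D.
Proof.
rewrite mulr_gt0 ?divr_gt0// subr_gt0 ltrXn2r ?nnegrE//.
exact: ltW.
Qed.

(* If [z = c w] with [w > 0], nonnegative energy forces [|w|^q] above
   [(q + 2) / 2 * (n2 - c^2)], so that [z / w] decreases. *)
Lemma slope_decreases w z s c : s <= S -> 0 <= ef_energy w z s -> 0 < w s ->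
  z s = c * w s -> c ^+ 2 <= nu3 ^+ 2 ->
  (n2 s - c ^+ 2 - pow q (w s)) * w s + D * w s < 0.
Proof.
move=> sS; rewrite /ef_energy /ppow => G ws zs c3; rewrite zs in G.
have n2s := n2_ge s sS.
rewrite -mulrDl pmulr_llt0//.
have W2 : 0 < w s ^+ 2 by rewrite exprn_gt0.
have Eq : (c ^+ 2 / 2 - n2 s / 2 + pow q (w s) / (q + 2)) * w s ^+ 2 =
  (c * w s) ^+ 2 / 2 - n2 s * w s ^+ 2 / 2 + pow q (w s) * w s ^+ 2 / (q + 2).
  by field; rewrite gt_eqF.
rewrite -Eq pmulr_lge0// in G.
have {G} : (q + 2) * (n2 s / 2 - c ^+ 2 / 2) <= pow q (w s).
  rewrite mulrC -ler_pdivlMr//; lra.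
have := D_gt0; rewrite /D.
have A : 0 <= q * (n2 s - nu2 ^+ 2) by rewrite mulr_ge0 ?subr_ge0// ltW.
have B : 0 <= q * (nu3 ^+ 2 - c ^+ 2) by rewrite mulr_ge0 ?subr_ge0// ltW.
by lra.
Qed.

(** Two reference heights: below [wstar] the nonlinear coefficient is at most [nu2 ^+ 2], and from
    [M] on it is at least twice the linear one. *)
Let wstar : R := (nu2 ^+ 2) `^ q^-1.
Let M : R := (2 * nu ^+ 2) `^ q^-1.

Let pow_wstar : pow q wstar = nu2 ^+ 2.
Proof. by rewrite powK// sqr_ge0. Qed.
Let pow_M : pow q M = 2 * nu ^+ 2.
Proof. by rewrite powK// mulr_ge0// sqr_ge0. Qed.
Let wstar_gt0 : 0 < wstar. Proof. by rewrite powR_gt0// exprn_gt0. Qed.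
Let M_gt0 : 0 < M. Proof. by rewrite powR_gt0// mulr_gt0// exprn_gt0. Qed.

Let le_M x : 0 <= x -> pow q x <= 2 * nu ^+ 2 -> x <= M.
Proof.
move=> x0 px; rewrite leNgt; apply/negP => Mx.
have := ltr_pow q q0 M x; rewrite pow_M !ger0_norm ?(ltW M_gt0)// => /(_ Mx).
by rewrite ltNge px.
Qed.

Let M_le x : M <= x -> 2 * nu ^+ 2 <= pow q x.
Proof.
move=> Mx; rewrite -pow_M; apply: ler_pow => //.
by rewrite !ger0_norm ?(ltW M_gt0)// (le_trans (ltW M_gt0)).
Qed.

(* Near the axis [w = 0] the energy bounds the speed from below. *)
Lemma speed_ge w z s e : s <= S -> 0 <= w s -> w s <= wstar -> 0 <= e ->
  e ^+ 2 / 2 <= ef_energy w z s -> e ^+ 2 <= z s ^+ 2.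
Proof.
move=> sS ws wW e0; rewrite /ef_energy /ppow => G.
have := n2_ge s sS; rewrite -pow_wstar => n2s.
have pw : pow q (w s) <= pow q wstar.
  by apply: ler_pow => //; rewrite !ger0_norm// ltW.
have W2 := sqr_ge0 (w s).
have : pow q (w s) * w s ^+ 2 / (q + 2) <= n2 s * w s ^+ 2 / 2.
  apply: (@le_trans _ _ (n2 s * w s ^+ 2 / (q + 2))).
    by rewrite ler_pM2r ?invr_gt0// ler_wpM2r// (le_trans pw).
  have A : 0 <= n2 s * w s ^+ 2 by rewrite mulr_ge0// (le_trans _ n2s)// pow_ge0.
  by rewrite ler_wpM2l// lef_pV2 ?posrE// lerDr ltW.
by lra.
Qed.

Variable b0 : R.
Hypothesis b0_gt0 : 0 < b0.

(* The solution has left a bubble located at the scale [expR s]. *)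
Definition bubble_exit w z s : Prop :=
  [/\ 0 < w s, z s <= nu1 * w s & (b0 * expR s) ^+ 2 / 2 <= ef_energy w z s].

(** Together with [- s / nu1] these are the durations of the four stages of [descent]: the slope
    [z / w] sinks below [- nu1], [w] falls to [M], [w] decays at the rate [nu1] from [M] to
    [b0 * expR s], and one unit of time leads to the axis. *)
Definition descent_cst : R := (nu3 + nu1) / D + nu1^-1 + ln (M / b0) / nu1 + 1.

Lemma der_ratio w z x : ef_sol w z -> x < 0 -> z x != 0 ->
  der (fun y => w y / z y) x (1 - (n2 x - pow q (w x)) * w x ^+ 2 / z x ^+ 2).
Proof.
move=> [dw dz] x0 zx; have Hw := dw x x0; have Hz := dz x x0.
dtac; by field.
Qed.

Let exp_tau s : b0 * expR s * expR (nu1 * ((ln (M / b0) - s) / nu1)) = M.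
Proof.
rewrite mulrCA divff ?mulr1; last by rewrite gt_eqF.
rewrite expRB lnK ?posrE ?divr_gt0//; field; rewrite !gt_eqF// expR_gt0//.
Qed.


(** For a large nonlinear coefficient [(w / z)' >= 1]. As [w / z] stays within an interval of length
    [1 / nu1] during a descent or an ascent, the time spent above the height [M] is at most
    [1 / nu1]. *)
Lemma ratio_increases w z s t : ef_sol w z -> s <= t -> t < 0 ->
  (forall x, s <= x <= t -> z x != 0) ->
  (forall x, s <= x <= t -> 2 * nu ^+ 2 <= pow q (w x)) ->
  w s / z s + (t - s) <= w t / z t.
Proof.
move=> o st t0 zn0 pw.
suff : w s / z s - s <= w t / z t - t by lra.
apply: (@mono_le R (fun x => w x / z x - x) s t
  (fun x => 1 - (n2 x - pow q (w x)) * w x ^+ 2 / z x ^+ 2 - 1) st).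
- move=> x /andP[sx xt]; have x0 := le_lt_trans xt t0.
  have zx : z x != 0 by apply: zn0; rewrite sx.
  by have ? := der_cont (der_ratio w z x o x0 zx); ctac.
- move=> x /andP[sx xt]; have x0 := lt_trans xt t0.
  have zx : z x != 0 by apply: zn0; rewrite !ltW.
  by have ? := der_ratio w z x o x0 zx; dtac.
- move=> x /andP[sx xt]; have px : 2 * nu ^+ 2 <= pow q (w x) by apply: pw; rewrite !ltW.
  rewrite addrAC subrr add0r -mulNr -mulNr opprB divr_ge0 ?sqr_ge0//.
  rewrite mulr_ge0 ?sqr_ge0// subr_ge0 (le_trans (n2_le x))// (le_trans _ px)//.
  by rewrite ler_peMl ?sqr_ge0//; lra.
Qed.

(** If [w] stayed positive up to [T], the stages counted in [descent_cst] would lead to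
    [w <= b0 * expR s] at [s4]. The energy kept since [s] then forces [- z >= b0 * expR s] by
    [speed_ge], and [w] would lose its whole height within one unit of time. *)
Lemma descent w z s : ef_sol w z -> bubble_exit w z s -> b0 * expR s <= wstar ->
  s + (descent_cst - s / nu1) <= S ->
  exists2 t, s < t <= s + (descent_cst - s / nu1) &
    w t = 0 /\ forall x, s <= x < t -> 0 < w x.
Proof.
move=> o [ws zs Gs] es; set T := s + _ => TS.
have h1 := nu1_gt0; have h13 := nu13; have h32 := nu32; have h2 := nu2_nu.
have T0 : T < 0 by exact: le_lt_trans S0.
have es0 : 0 < b0 * expR s by rewrite mulr_gt0// expR_gt0.
have wM : wstar <= M.
  apply: le_M; first exact: ltW.
  rewrite pow_wstar (@le_trans _ _ (nu ^+ 2))// ?lerXn2r ?nnegrE ?(ltW nu2_gt0) ?(ltW nu_gt0) ?(ltW nu2_nu)//.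
  by rewrite ler_peMl ?sqr_ge0//; lra.
pose C1 := (nu3 + nu1) / D; pose tau := (ln (M / b0) - s) / nu1.
have C10 : 0 < C1 by rewrite divr_gt0// addr_gt0.
have tau0 : 0 <= tau.
  rewrite divr_ge0 ?(ltW nu1_gt0)// subr_ge0 -(expRK s) ler_ln ?posrE ?expR_gt0 ?divr_gt0//.
  by rewrite ler_pdivlMr// mulrC (le_trans es).
have TE : T = s + C1 + nu1^-1 + tau + 1.
  rewrite /T /descent_cst /tau -/C1; field; rewrite gt_eqF//.
have nu1V : 0 < nu1^-1 by rewrite invr_gt0.
have sT : s <= T by rewrite TE; lra.
have cw x : x <= T -> cont w x by move=> xT; exact: der_cont (ef_dw _ _ o x (le_lt_trans xT T0)).
have cz x : x <= T -> cont z x by move=> xT; exact: der_cont (ef_dz _ _ o x (le_lt_trans xT T0)).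
have [[x /andP[sx xT] wx]|allpos] := pselect (exists2 x, s <= x <= T & w x <= 0).
  have [|||c [/andP[sc cx] wc below]] := @first_crossing R (fun x => - w x) s x sx.
  - by move=> y /andP[_ yx]; apply: contN; apply: cw; exact: le_trans xT.
  - by rewrite oppr_lt0.
  - by rewrite oppr_ge0.
  exists c; first by rewrite sc (le_trans cx).
  split; first by apply/eqP; rewrite -oppr_eq0; apply/eqP.
  by move=> y /below; rewrite oppr_lt0.
exfalso.
have wpos x : s <= x -> x <= T -> 0 < w x.
  by move=> sx xT; rewrite ltNge; apply/negP => wx; apply: allpos; exists x; rewrite ?sx.
have Gx x : s <= x -> x <= T -> (b0 * expR s) ^+ 2 / 2 <= ef_energy w z x.
  by move=> sx xT; apply: le_trans Gs _; apply: ef_energy_le => //; exact: le_lt_trans T0.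
have Gx0 x : s <= x -> x <= T -> 0 <= ef_energy w z x.
  by move=> sx xT; apply: le_trans (Gx x sx xT); rewrite divr_ge0// sqr_ge0.
have slope x c : s <= x -> x <= T -> z x = c * w x -> - nu1 <= c <= nu3 ->
    (n2 x - c ^+ 2 - pow q (w x)) * w x + D * w x < 0.
  move=> sx xT zx /andP[c1 c2]; apply: (slope_decreases w z x c) => //.
  - exact: le_trans TS.
  - exact: Gx0.
  - exact: wpos.
  - rewrite -(real_normK (num_real c)) lerXn2r ?nnegrE ?(ltW nu3_gt0)// ler_norml c2 andbT.
    by rewrite (le_trans _ c1)// lerN2 ltW.
have C1T : s + C1 <= T by rewrite TE; lra.
have C1D : C1 * D = nu3 + nu1 by rewrite /C1 divfK// gt_eqF.
(* A barrier whose slope moves from [nu3] down to [- nu1] at the speed [D], the rate granted by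
   [slope_decreases]. *)
have moving x : s <= x <= s + C1 -> z x - (nu3 - D * (x - s)) * w x < 0.
  move: x; apply: (@barrier R (fun x => z x - (nu3 - D * (x - s)) * w x) s (s + C1)).
  - move=> y /andP[sy yT]; have yT' := le_trans yT C1T.
    by have ? := cw y yT'; have ? := cz y yT'; ctac.
  - rewrite subrr mulr0 subr0 subr_lt0 (le_lt_trans zs)// ltr_pM2r//.
  - move=> c /andP[sc cC] _ /eqP; rewrite subr_eq0 => /eqP zc.
    have cT := le_trans cC C1T; have c0 := le_lt_trans cT T0.
    have dw := ef_dw _ _ o c c0; have dz := ef_dz _ _ o c c0.
    eexists; first by repeat dstep.
    cbv beta; have := slope c _ (ltW sc) cT zc; rewrite zc.
    have : 0 <= D * (c - s) by rewrite (mulr_ge0 (ltW D_gt0))// subr_ge0 ltW.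
    have : D * (c - s) <= nu3 + nu1.
      by rewrite -C1D mulrC (ler_pM2r D_gt0); lra.
    move=> H1 H2 /(_ _)/wrap[|]; first by apply/andP; split; lra.
    by move: (n2 c) (pow q (w c)) (w c) => n p W; lra.
have zneg x : s + C1 <= x -> x <= T -> z x + nu1 * w x < 0.
  move=> Cx xT; have sC : s <= s + C1 by rewrite lerDl ltW.
  apply: (@barrier R (fun x => z x + nu1 * w x) (s + C1) T); last by rewrite Cx.
  - move=> y /andP[_ yT].
    by have ? := cw y yT; have ? := cz y yT; ctac.
  - have := moving (s + C1); rewrite sC lexx => /(_ isT).
    have -> : s + C1 - s = C1 by ring.
    by rewrite (mulrC D) C1D; lra.
  - move=> c /andP[sc cT] _ /eqP; rewrite addr_eq0 -mulNr => /eqP zc.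
    have c0 := le_lt_trans cT T0.
    have dw := ef_dw _ _ o c c0; have dz := ef_dz _ _ o c c0.
    eexists; first by repeat dstep.
    cbv beta; have sc' := le_trans sC (ltW sc).
    have := slope c _ sc' cT zc; rewrite zc lexx /=.
    have -> : - nu1 <= nu3 by lra.
    move=> /(_ isT); have := mulr_gt0 D_gt0 (wpos c sc' cT).
    by move: (n2 c) (pow q (w c)) (w c) => n p W; lra.
have zlt x : s + C1 <= x -> x <= T -> z x < 0.
  move=> Cx xT; have := zneg x Cx xT.
  have : 0 < nu1 * w x by rewrite mulr_gt0// wpos// (le_trans _ Cx)// lerDl ltW.
  by lra.
have [s3 /andP[s31 s32] ps3] : exists2 s3, s + C1 <= s3 <= s + C1 + nu1^-1 &
    pow q (w s3) <= 2 * nu ^+ 2.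
  apply: contrapT => /forall2NP H.
  have s1T : s + C1 + nu1^-1 <= T by rewrite TE; lra.
  have le1 : s + C1 <= s + C1 + nu1^-1 by rewrite lerDl ltW.
  have z1 := zlt _ (lexx _) C1T; have z2 := zlt _ le1 s1T.
  have H1 : - nu1^-1 < w (s + C1) / z (s + C1).
    rewrite ltr_ndivlMr// mulNr ltrNr mulrC ltr_pdivrMr//.
    by have := zneg _ (lexx _) C1T; lra.
  have H2 : w (s + C1 + nu1^-1) / z (s + C1 + nu1^-1) < 0.
    rewrite pmulr_rlt0 ?invr_lt0// wpos//; lra.
  have Hz x : s + C1 <= x <= s + C1 + nu1^-1 -> z x != 0.
    by move=> /andP[x1 x2]; rewrite lt_eqF// zlt// (le_trans x2).
  have Hp x : s + C1 <= x <= s + C1 + nu1^-1 -> 2 * nu ^+ 2 <= pow q (w x).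
    by move=> x12; have [/(_ x12)//|/negP] := H x; rewrite -ltNge => /ltW.
  by have := ratio_increases w z _ _ o le1 (le_lt_trans s1T T0) Hz Hp; lra.
have s3T : s3 + tau + 1 <= T by rewrite TE; lra.
have ss3 : s <= s3 by lra.
pose s4 := s3 + tau.
have s4T : s4 <= T by rewrite /s4; lra.
have w4 : w s4 <= b0 * expR s.
  have : - (w s3 * expR (nu1 * s3)) <= - (w s4 * expR (nu1 * s4)).
    have s34 : s3 <= s4 by rewrite lerDl.
    apply: (@mono_le R (fun x => - (w x * expR (nu1 * x))) s3 s4
      (fun x => - (z x + nu1 * w x) * expR (nu1 * x)) s34).
    - move=> x /andP[_ x4]; have H : der (fun x => expR (nu1 * x)) x (expR (nu1 * x) * nu1).
        by dtac; ring.
      by have ? := der_cont H; have ? := cw x (le_trans x4 s4T); ctac.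
    - move=> x /andP[_ x4]; have dw := ef_dw _ _ o x (lt_trans (lt_le_trans x4 s4T) T0).
      by dtac; ring.
    - move=> x /andP[x3 x4]; rewrite mulr_ge0 ?expR_ge0// oppr_ge0 ltW// zneg//.
        exact: le_trans (ltW x3).
      exact: le_trans (ltW x4) s4T.
  rewrite lerN2 /s4 mulrDr expRD mulrCA mulrA (mulrC (w s3)) -mulrA.
  rewrite ler_pM2l ?expR_gt0// => H.
  rewrite -(ler_pM2r (expR_gt0 (nu1 * tau))) exp_tau (le_trans H)//.
  by apply: le_M ps3; rewrite ltW// wpos//; lra.
have wdecr x : s4 <= x -> x <= s4 + 1 -> w x <= w s4.
  move=> x4 x5; rewrite -lerN2.
  apply: (@mono_le R (fun x => - w x) s4 x (fun x => - z x) x4).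
  - by move=> y /andP[_ yx]; apply: contN; apply: cw; move: yx x5 s3T; rewrite /s4; lra.
  - move=> y /andP[_ yx]; apply: derN; apply: (ef_dw _ _ o).
    by apply: le_lt_trans T0; move: yx x5 s3T; rewrite /s4; lra.
  - move=> y /andP[sy yx]; rewrite oppr_ge0 ltW// zlt//; last first.
      by move: yx x5 s3T; rewrite /s4; lra.
    by move: sy; rewrite /s4; lra.
have s41 : s4 < s4 + 1 by rewrite ltrDl.
have s4T' : s4 + 1 <= T by rewrite /s4.
have [||x /andP[x4 x5]] := @mean_value R w s4 (s4 + 1) z s41.
- by move=> x /andP[_ xs]; apply: cw; exact: le_trans s4T'.
- by move=> x /andP[_ xs]; apply: (ef_dw _ _ o); exact: lt_trans (lt_le_trans xs s4T') T0.
have -> : s4 + 1 - s4 = 1 by ring.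
rewrite mulr1 => wz.
have w5 : 0 < w (s4 + 1) by apply: wpos => //; rewrite ltW// (le_lt_trans _ s41)// /s4; lra.
have xT : x <= T by exact: le_trans (ltW x5) s4T'.
have sx : s + C1 <= x by apply: le_trans (ltW x4); rewrite /s4; lra.
have zx := zlt x sx xT.
have sx' : s <= x by lra.
have := speed_ge w z x (b0 * expR s) (le_trans xT TS) (ltW (wpos x sx' xT)) _ (ltW es0) (Gx x sx' xT).
move=> /(_ _)/wrap[|].
  by rewrite (le_trans (wdecr x (ltW x4) (ltW x5)))// (le_trans w4).
rewrite -[X in _ <= X]sqrrN ler_sqr ?nnegrE ?oppr_ge0 ?(ltW zx) ?(ltW es0)// => zb.
by move: w5 w4 wz zb; lra.
Qed.

(** One unit of time to reach the height [b0 * expR s], the time to grow from there to [M] at the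
    rate [nu1] (with [- s / nu1]), and [1 / nu1] above [M]. *)
Definition ascent_cst : R := 1 + ln (M / b0) / nu1 + nu1^-1.

(** On leaving the axis upwards the slope exceeds [nu1]. If this lasted up to [T], the speed bound,
    then the exponential growth, then [ratio_increases] would push [w / z] past [1 / nu1]. *)
Lemma ascent_time w z s t0 : ef_sol w z -> s < t0 -> w t0 = 0 -> 0 < z t0 ->
  (b0 * expR s) ^+ 2 / 2 <= ef_energy w z t0 -> b0 * expR s <= wstar ->
  t0 + (ascent_cst - s / nu1) <= S ->
  exists2 t, t0 < t <= t0 + (ascent_cst - s / nu1) & [/\ z t = nu1 * w t,
    forall x, t0 < x <= t -> 0 < w x & forall x, t0 <= x <= t -> nu1 * w x <= z x].
Proof.
move=> o st0 w0 z0 G0 es; set T := t0 + _ => TS.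
have h1 := nu1_gt0; have h13 := nu13; have h32 := nu32; have h2 := nu2_nu.
have T0 : T < 0 by exact: le_lt_trans S0.
have es0 : 0 < b0 * expR s by rewrite mulr_gt0// expR_gt0.
have wM : wstar <= M.
  apply: le_M; first exact: ltW.
  rewrite pow_wstar (@le_trans _ _ (nu ^+ 2))// ?lerXn2r ?nnegrE ?(ltW nu2_gt0) ?(ltW nu_gt0) ?(ltW nu2_nu)//.
  by rewrite ler_peMl ?sqr_ge0//; lra.
pose tau := (ln (M / b0) - s) / nu1.
have tau0 : 0 <= tau.
  rewrite divr_ge0 ?(ltW nu1_gt0)// subr_ge0 -(expRK s) ler_ln ?posrE ?expR_gt0 ?divr_gt0//.
  by rewrite ler_pdivlMr// mulrC (le_trans es).
have TE : T = t0 + 1 + tau + nu1^-1.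
  by rewrite /T /ascent_cst /tau; field; rewrite gt_eqF.
have nu1V : 0 < nu1^-1 by rewrite invr_gt0.
have t0T : t0 <= T by rewrite TE; lra.
have dw x : x <= T -> der w x (z x) by move=> xT; exact: (ef_dw _ _ o x (le_lt_trans xT T0)).
have cw x : x <= T -> cont w x by move=> xT; exact: der_cont (dw x xT).
have cz x : x <= T -> cont z x by move=> xT; exact: der_cont (ef_dz _ _ o x (le_lt_trans xT T0)).
have grow a b : a <= b -> b <= T -> (forall x, a <= x < b -> nu1 * w x < z x) ->
    w a * expR (- nu1 * a) <= w b * expR (- nu1 * b).
  move=> ab bT H; apply: (@mono_le R (fun x => w x * expR (- nu1 * x)) a b
    (fun x => (z x - nu1 * w x) * expR (- nu1 * x)) ab).
  - move=> x /andP[_ xb]; have He : der (fun x => expR (- nu1 * x)) x (expR (- nu1 * x) * - nu1).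
      by dtac; ring.
    by have ? := der_cont He; have ? := cw x (le_trans xb bT); ctac.
  - by move=> x /andP[_ xb]; have ? := dw x (le_trans (ltW xb) bT); dtac; ring.
  - move=> x /andP[ax xb]; rewrite mulr_ge0 ?expR_ge0// subr_ge0 ltW// H// xb ltW//.
have wpos b : t0 < b -> b <= T -> (forall x, t0 <= x < b -> nu1 * w x < z x) -> 0 < w b.
  move=> tb bT H.
  have : w t0 * expR (- nu1 * t0) < w b * expR (- nu1 * b).
    apply: (@mono_lt R (fun x => w x * expR (- nu1 * x)) t0 b
      (fun x => (z x - nu1 * w x) * expR (- nu1 * x)) tb).
    - move=> x /andP[_ xb]; have He : der (fun x => expR (- nu1 * x)) x (expR (- nu1 * x) * - nu1).
        by dtac; ring.
      by have ? := der_cont He; have ? := cw x (le_trans xb bT); ctac.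
    - by move=> x /andP[_ xb]; have ? := dw x (le_trans (ltW xb) bT); dtac; ring.
    - move=> x /andP[ax xb]; rewrite mulr_gt0 ?expR_gt0// subr_gt0 H// xb ltW//.
  by rewrite w0 mul0r pmulr_lgt0// expR_gt0.
have [[x /andP[tx xT] Hx]|none] := pselect (exists2 x, t0 <= x <= T & 0 <= nu1 * w x - z x).
  have [|||c [/andP[tc cx] fc below]] := @first_crossing R (fun x => nu1 * w x - z x) t0 x tx.
  - move=> y /andP[_ yx]; have yT := le_trans yx xT.
    by have ? := cw y yT; have ? := cz y yT; ctac.
  - by rewrite w0 mulr0 sub0r oppr_lt0.
  - exact: Hx.
  have below' y : t0 <= y < c -> nu1 * w y < z y by move=> /below; rewrite subr_lt0.
  exists c; first by rewrite tc (le_trans cx).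
  have zc : z c = nu1 * w c by apply/esym/eqP; rewrite -subr_eq0; apply/eqP.
  split=> // y /andP[ty yc].
  - apply: wpos => //; first by rewrite (le_trans yc)// (le_trans cx).
    by move=> u /andP[tu uy]; apply: below'; rewrite tu (lt_le_trans uy).
  - move: yc; rewrite le_eqVlt => /predU1P[->|yc]; first by rewrite zc.
    by rewrite ltW// below'// ty.
exfalso.
have zw x : t0 <= x -> x <= T -> nu1 * w x < z x.
  move=> tx xT; rewrite ltNge; apply/negP => H; apply: none; exists x; rewrite ?tx//.
  by rewrite subr_ge0.
have {}wpos x : t0 < x -> x <= T -> 0 < w x.
  move=> tx xT; apply: wpos => // y /andP[ty yx]; apply: zw => //.
  by rewrite (le_trans (ltW yx)).
have wge0 x : t0 <= x -> x <= T -> 0 <= w x.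
  by rewrite le_eqVlt => /predU1P[<-|tx xT]; [rewrite w0|rewrite ltW// wpos].
have zpos x : t0 <= x -> x <= T -> 0 < z x.
  by move=> tx xT; apply: le_lt_trans (zw x tx xT); rewrite mulr_ge0 ?(ltW nu1_gt0)// wge0.
pose x1 := t0 + 1.
have x1T : x1 <= T by rewrite /x1 TE; lra.
have tx1 : t0 < x1 by rewrite ltrDl.
have w1 : b0 * expR s <= w x1.
  rewrite leNgt; apply/negP => w1.
  have [||x /andP[x2 x3]] := @mean_value R w t0 x1 z tx1.
  - by move=> x /andP[_ xx]; apply: cw; exact: le_trans x1T.
  - by move=> x /andP[_ xx]; apply: dw; exact: le_trans (ltW xx) x1T.
  have -> : x1 - t0 = 1 by rewrite /x1; ring.
  rewrite w0 subr0 mulr1 => wz.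
  have xT := le_trans (ltW x3) x1T.
  have wx1 : w x <= w x1.
    apply: (@mono_le R w x x1 z (ltW x3)).
    - by move=> y /andP[_ yx]; apply: cw; exact: le_trans x1T.
    - by move=> y /andP[_ yx]; apply: dw; exact: le_trans (ltW yx) x1T.
    - by move=> y /andP[xy yx]; rewrite ltW// zpos; lra.
  have Gx : (b0 * expR s) ^+ 2 / 2 <= ef_energy w z x.
    by apply: le_trans G0 _; apply: ef_energy_le => //; [exact: ltW|exact: le_lt_trans T0].
  have wxs : w x <= wstar by apply: le_trans wx1 _; apply: le_trans (ltW w1) es.
  have := speed_ge w z x (b0 * expR s) (le_trans xT TS) (wge0 x (ltW x2) xT) wxs (ltW es0) Gx.
  have zx := zpos x (ltW x2) xT.
  rewrite ler_sqr ?nnegrE ?(ltW es0) ?(ltW zx)// => ez.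
  by move: w1; rewrite wz ltNge ez.
pose x2 := x1 + tau.
have x12 : x1 <= x2 by rewrite lerDl.
have x2T : x2 <= T by rewrite /x2 /x1 TE; lra.
have Mw x : x2 <= x -> x <= T -> M <= w x.
  move=> x2x xT; have x1x := le_trans x12 x2x.
  have H := grow x1 x x1x xT; have {}H : w x1 * expR (- nu1 * x1) <= w x * expR (- nu1 * x).
    by apply: H => y /andP[y1 y2]; apply: zw; [exact: le_trans (ltW tx1) y1|exact: le_trans (ltW y2) xT].
  have {}H : w x1 * expR (nu1 * (x - x1)) <= w x.
    rewrite -(ler_pM2r (expR_gt0 (- nu1 * x))) -mulrA -expRD.
    by have -> : nu1 * (x - x1) + - nu1 * x = - nu1 * x1 by ring.
  apply: le_trans H; rewrite -(exp_tau s) -/tau.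
  apply: ler_pM => //; first exact: ltW.
  by rewrite ler_expR ler_pM2l// lerBrDl.
have x23 : x2 <= x2 + nu1^-1 by rewrite lerDl ltW.
have x3T : x2 + nu1^-1 <= T by rewrite /x2 /x1 TE; lra.
have tx2 : t0 < x2 by exact: lt_le_trans x12.
have Hz x : x2 <= x <= x2 + nu1^-1 -> z x != 0.
  move=> /andP[y1 y2]; rewrite gt_eqF// zpos//; first exact: le_trans (ltW tx2) y1.
  exact: le_trans y2 x3T.
have Hp x : x2 <= x <= x2 + nu1^-1 -> 2 * nu ^+ 2 <= pow q (w x).
  by move=> /andP[y1 y2]; apply: M_le; apply: Mw => //; exact: le_trans x3T.
have := ratio_increases w z _ _ o x23 (le_lt_trans x3T T0) Hz Hp.
have -> : x2 + nu1^-1 - x2 = nu1^-1 by ring.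
have r1 : 0 < w x2 / z x2 by rewrite divr_gt0 ?wpos ?zpos// ltW.
have r2 : w (x2 + nu1^-1) / z (x2 + nu1^-1) < nu1^-1.
  have tx3 : t0 <= x2 + nu1^-1 by exact: le_trans (ltW tx2) x23.
  rewrite ltr_pdivrMr ?zpos// mulrC ltr_pdivlMr// mulrC; exact: zw.
by lra.
Qed.

(** With a nonnegative energy, slope [nu1] can only occur at a height [w >= W0]. [gap] is the time
    for which [w] is then known to have been at least [W0 / 2]: since [z <= 1 + nu * w], the
    function [(w + 1 / nu) * expR (- nu * x)] does not increase. *)
Let W0 : R := (nu2 ^+ 2 - nu1 ^+ 2) `^ q^-1.
Let gap : R := ln ((W0 + nu^-1) / (W0 / 2 + nu^-1)) / nu.

Let nu21 : 0 < nu2 ^+ 2 - nu1 ^+ 2.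
Proof.
rewrite subr_gt0 ltrXn2r ?nnegrE//; first exact: ltW.
exact: lt_trans nu32.
Qed.

Let W0_gt0 : 0 < W0. Proof. by rewrite powR_gt0. Qed.

Let gap_gt0 : 0 < gap.
Proof.
have nV : 0 < nu^-1 by rewrite invr_gt0.
have W := W0_gt0.
rewrite divr_gt0// ln_gt0// ltr_pdivlMr ?mul1r; lra.
Qed.

Let gapE : (W0 + nu^-1) * expR (- (nu * gap)) = W0 / 2 + nu^-1.
Proof.
have nV : 0 < nu^-1 by rewrite invr_gt0.
have W : 0 < W0 / 2 + nu^-1 by rewrite addr_gt0// divr_gt0.
have W' : 0 < W0 + nu^-1 by rewrite addr_gt0.
rewrite /gap mulrCA divff ?mulr1 ?gt_eqF// expRN lnK ?posrE ?divr_gt0//.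
by rewrite invf_div mulrCA divff ?mulr1// gt_eqF.
Qed.

(** Lower bound, in units of [expR t ^+ 2], for the energy gained over the last window of length
    [gap] before [t], where [rho] and [drho] are at least [expR (t - gap)]. *)
Definition ascent_gain : R := mu * expR (- gap) ^+ 2 * (W0 / 2) ^+ 2 * gap.

Lemma ascent_gain_gt0 : 0 < ascent_gain.
Proof.
apply: mulr_gt0 gap_gt0; apply: mulr_gt0.
  by apply: mulr_gt0 => //; exact: exprn_gt0 (expR_gt0 _).
by apply: exprn_gt0; exact: divr_gt0 W0_gt0 _.
Qed.

Hypothesis b0_le1 : b0 <= 1.
Hypothesis b0_gain : b0 ^+ 2 / 2 <= ascent_gain.

(** The energy inherited from the old scale [expR s] would not suffice at the new scale [expR t]; it
    is renewed by the gain made while [w] is of order one. *)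
Lemma ascent w z s t0 : ef_sol w z -> s < t0 -> w t0 = 0 -> 0 < z t0 ->
  (b0 * expR s) ^+ 2 / 2 <= ef_energy w z t0 -> b0 * expR s <= wstar ->
  t0 + (ascent_cst - s / nu1) <= S ->
  exists2 t, t0 < t <= t0 + (ascent_cst - s / nu1) & bubble_exit w z t.
Proof.
move=> o st0 w0 z0 G0 es TS.
have [t /andP[tt tT] [zt wpos zw]] := ascent_time _ _ _ _ o st0 w0 z0 G0 es TS.
exists t; first by rewrite tt.
have wt : 0 < w t by apply: wpos; rewrite tt lexx.
have tS := le_trans tT TS; have t00 := le_lt_trans tS S0.
have Gmono x : t0 <= x -> x <= t -> ef_energy w z x <= ef_energy w z t.
  by move=> _ xt; apply: ef_energy_le.
have Gpos x : t0 <= x -> x <= t -> 0 <= ef_energy w z x.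
  move=> tx xt; apply: (@le_trans _ _ (ef_energy w z t0)).
    by apply: le_trans G0; rewrite divr_ge0// sqr_ge0.
  by apply: ef_energy_le => //; exact: le_lt_trans t00.
split=> //; first by rewrite zt.
(* An energy of at least [1 / 2] is enough because [b0 * expR t <= 1]. A smaller one yields the
   bound [z <= 1 + nu * w]. *)
have [big|small] := leP 1 (2 * ef_energy w z t).
  have e1 : expR t <= 1 by rewrite expR_le1 ltW.
  have : (b0 * expR t) ^+ 2 <= 1.
    rewrite -[leRHS](expr1n _ 2) lerXn2r ?nnegrE//; last first.
      by rewrite -[leRHS]mul1r ler_pM// ?expR_ge0// ltW.
    by rewrite mulr_ge0 ?expR_ge0// ltW.
  by lra.
have WW : W0 <= w t.
  rewrite leNgt; apply/negP => H.
  have : pow q (w t) < pow q W0.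
    by apply: ltr_pow => //; rewrite !gtr0_norm.
  rewrite powK// (ltW nu21); apply/negP; rewrite -leNgt.
  have := slope_decreases w z t nu1 tS (Gpos t (ltW tt) (lexx t)) wt zt.
  rewrite -mulrDl pmulr_llt0// => /(_ _)/wrap[|]; last first.
    by have := n2_ge t tS; have := D_gt0; lra.
  by rewrite lerXn2r ?nnegrE ?(ltW nu1_gt0) ?(ltW nu3_gt0)// ltW.
have dw x : x <= t -> der w x (z x) by move=> xt; exact: (ef_dw _ _ o x (le_lt_trans xt t00)).
have zle x : t0 <= x -> x <= t -> z x <= 1 + nu * w x.
  move=> tx xt.
  have wx : 0 <= w x.
    by move: tx; rewrite le_eqVlt => /predU1P[<-|tx]; [rewrite w0|rewrite ltW// wpos// tx].
  have nw : 0 <= nu * w x by rewrite mulr_ge0// ltW.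
  have zx : 0 <= z x.
    by apply: le_trans (zw x _); rewrite ?tx// mulr_ge0// ltW.
  rewrite -ler_sqr ?nnegrE ?addr_ge0//.
  have := Gmono x tx xt; rewrite /ef_energy => Gx.
  have n2w : n2 x * w x ^+ 2 <= nu ^+ 2 * w x ^+ 2 by rewrite ler_wpM2r ?sqr_ge0.
  have pp : 0 <= ppow q (w x) / (q + 2) by rewrite divr_ge0 ?ppow_ge0// ltW.
  move: small Gx; rewrite /ef_energy; move: (z t ^+ 2 / 2 - n2 t * w t ^+ 2 / 2 + ppow q (w t) / (q + 2)) => Gt.
  move: n2w pp; rewrite -exprMn; move: (n2 x * _) (ppow _ _ / _) (nu * w x) nw => A B C C0 *.
  have -> : (1 + C) ^+ 2 = 1 + 2 * C + C ^+ 2 by ring.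
  by lra.
have nV : 0 < nu^-1 by rewrite invr_gt0.
have back x : t0 <= x -> x <= t -> t - gap <= x -> W0 / 2 <= w x.
  move=> tx xt gx.
  have : - ((w x + nu^-1) * expR (- nu * x)) <= - ((w t + nu^-1) * expR (- nu * t)).
    apply: (@mono_le R (fun x => - ((w x + nu^-1) * expR (- nu * x))) x t
      (fun x => (1 + nu * w x - z x) * expR (- nu * x)) xt).
    - move=> y /andP[_ yt]; have He : der (fun x => expR (- nu * x)) y (expR (- nu * y) * - nu).
        by dtac; ring.
      by have ? := der_cont He; have ? := der_cont (dw y yt); ctac.
    - move=> y /andP[_ yt]; have ? := dw y (ltW yt).
      by dtac; field; rewrite gt_eqF.
    - move=> y /andP[xy yt]; rewrite mulr_ge0 ?expR_ge0// subr_ge0 zle//.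
        exact: le_trans (ltW xy).
      exact: ltW.
  rewrite lerN2 => H.
  have {}H : (w t + nu^-1) * expR (- (nu * (t - x))) <= w x + nu^-1.
    rewrite -(ler_pM2r (expR_gt0 (- nu * x))) -mulrA -expRD.
    by have -> : - (nu * (t - x)) + - nu * x = - nu * t by ring.
  have : W0 / 2 + nu^-1 <= w x + nu^-1; last by rewrite lerD2r.
  apply: le_trans H; rewrite -gapE; apply: ler_pM; rewrite ?expR_ge0//.
  - exact: addr_ge0 (ltW W0_gt0) (ltW nV).
  - by rewrite lerD2r.
  - by rewrite ler_expR lerN2 ler_pM2l//; lra.
(* The window lies after the crossing, because [w t0 = 0] is below [W0 / 2]. *)
have gt : t0 <= t - gap.
  rewrite leNgt; apply/negP => H; have := back t0 (lexx _) (ltW tt) (ltW H).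
  by rewrite w0 leNgt divr_gt0.
have gt' : t - gap <= t by rewrite gerBl ltW.
set y := t - gap in gt gt'.
have : ef_energy w z y - mu * expR y ^+ 2 * (W0 / 2) ^+ 2 * y <=
    ef_energy w z t - mu * expR y ^+ 2 * (W0 / 2) ^+ 2 * t.
  apply: (@mono_le R (fun x => ef_energy w z x - mu * expR y ^+ 2 * (W0 / 2) ^+ 2 * x) y t
    (fun x => mu * rho x * drho x * w x ^+ 2 - mu * expR y ^+ 2 * (W0 / 2) ^+ 2) gt').
  - move=> x /andP[_ xt]; have ? := der_cont (der_ef_energy w z x o (le_lt_trans xt t00)).
    by ctac.
  - move=> x /andP[_ xt]; have ? := der_ef_energy w z x o (lt_trans xt t00).
    by dtac; ring.
  - move=> x /andP[yx xt]; have x0 := lt_trans xt t00.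
    have ex : expR y <= rho x.
      by apply: le_trans (rho_gt x x0); rewrite ler_expR ltW.
    have wx : W0 / 2 <= w x.
      by apply: back; [exact: le_trans gt (ltW yx)|exact: ltW|exact: ltW].
    have ee : expR y ^+ 2 <= rho x * drho x.
      by rewrite expr2 ler_pM ?expR_ge0// (le_trans ex)// drho_ge.
    have ww : (W0 / 2) ^+ 2 <= w x ^+ 2.
      have W00 : 0 <= W0 / 2 by rewrite divr_ge0// ltW.
      by rewrite lerXn2r ?nnegrE// (le_trans W00).
    have A : expR y ^+ 2 * (W0 / 2) ^+ 2 <= rho x * drho x * w x ^+ 2.
      by apply: ler_pM; rewrite ?sqr_ge0.
    by have := ler_wpM2l (ltW mu0) A; rewrite !mulrA subr_ge0.
have Gy := Gpos y gt gt'.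
have E : mu * expR y ^+ 2 * (W0 / 2) ^+ 2 * (t - y) = ascent_gain * expR t ^+ 2.
  by rewrite /ascent_gain /y expRD; ring.
have : b0 ^+ 2 / 2 * expR t ^+ 2 <= ascent_gain * expR t ^+ 2.
  by rewrite ler_wpM2r// sqr_ge0.
rewrite -E exprMn.
by move: (mu * expR y ^+ 2 * (W0 / 2) ^+ 2) Gy => B; lra.
Qed.

Hypothesis nu1_gt2 : 2 < nu1.

(* Each descent or ascent starting at [s] lasts about [- s / nu1], so that
   [nu1 > 2] leaves room for a descent, an ascent and a second descent before 0. *)
Lemma two_sign_changes : exists L, forall w z s, s <= L -> ef_sol w z ->
  bubble_exit w z s -> exists t1 t2, [/\ t1 < t2, t2 < 0, w t1 < 0 & 0 < w t2].
Proof.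
have h2 := nu1_gt2; have hS := S0.
pose r := nu1^-1.
have r0 : 0 < r by rewrite invr_gt0.
have r1 : r < 1 / 2 by rewrite div1r ltf_pV2 ?posrE.
(* Up to [S2] a bubble exit leaves room for a complete descent before [S], and [b0 * expR s] is at
   most [wstar]. The second exit must still be below [S2], which is the purpose of the division by
   [1 - 2 * r > 0] below. *)
pose S2 := Num.min S (Num.min (ln (wstar / b0)) ((S - descent_cst) / (1 - r))).
have S2P s : s <= S2 -> [/\ s <= S, b0 * expR s <= wstar & s + (descent_cst - s / nu1) <= S].
  rewrite !le_min => /andP[sS /andP[s1 s2]]; split => //.
    by rewrite mulrC -ler_pdivlMr// -[leRHS]lnK ?posrE ?divr_gt0// ler_expR.
  by move: s2; rewrite ler_pdivlMr -/r; lra.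
exists (Num.min S2 ((S2 - descent_cst - ascent_cst) / (1 - 2 * r))).
move=> w z s; rewrite le_min => /andP[s1 s2] o bub.
have [_ es sS] := S2P s s1.
have s2' : s + (descent_cst - s / nu1) + (ascent_cst - s / nu1) <= S2.
  by move: s2; rewrite ler_pdivlMr -/r; lra.
have S2S : S2 <= S by rewrite ge_min lexx.
have [z1 /andP[sz1 z1T] [wz1 wpos]] := descent _ _ _ o bub es sS.
have z10 : z1 < 0 := le_lt_trans (le_trans z1T sS) S0.
have leaves_axis u v x y : ef_sol u v -> x < y -> y < 0 -> (b0 * expR s) ^+ 2 / 2 <= ef_energy u v x ->
    u y = 0 -> (forall t, x <= t < y -> 0 < u t) -> v y < 0.
  move=> ouv xy y0 Gx uy upos; rewrite lt_neqAle; apply/andP; split.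
    apply/eqP => vy; have : 0 < ef_energy u v y.
      apply: (@lt_le_trans _ _ (ef_energy u v x)).
        by apply: lt_le_trans Gx; rewrite divr_gt0// exprn_gt0// mulr_gt0// expR_gt0.
      by apply: ef_energy_le => //; exact: ltW.
    by rewrite /ef_energy /ppow uy vy expr0n /= !(mulr0, mul0r, addr0, subr0) ltxx.
  rewrite -oppr_ge0; have du := derN _ _ _ (ef_dw _ _ ouv y y0).
  apply: (der_ge0_left du xy) => t /andP[xt ty].
  by rewrite uy oppr0 oppr_le0 ltW// upos// ty ltW.
have vz1 : z z1 < 0.
  by case: bub => _ _ Gs; exact: (leaves_axis _ _ _ _ o sz1 z10 Gs wz1 wpos).
have oN := ef_solN _ _ o.
have GN : (b0 * expR s) ^+ 2 / 2 <= ef_energy (fun s => - w s) (fun s => - z s) z1.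
  rewrite ef_energyN; case: bub => _ _ Gs; apply: le_trans Gs _.
  by apply: ef_energy_le => //; exact: ltW.
have asc : z1 + (ascent_cst - s / nu1) <= S2 by lra.
have wN0 : - w z1 = 0 by rewrite wz1 oppr0.
have vN0 : 0 < - z z1 by rewrite oppr_gt0.
have [t /andP[zt tT] bubt] := ascent _ _ _ _ oN sz1 wN0 vN0 GN es (le_trans asc S2S).
have [tS et tdS] := S2P t (le_trans tT asc).
have [z2 /andP[tz2 z2T] [wz2 wneg]] := descent _ _ _ oN bubt et tdS.
have z20 : z2 < 0 := le_lt_trans (le_trans z2T tdS) S0.
have vz2 : - z z2 < 0.
  apply: (leaves_axis _ _ _ _ oN tz2 z20 _ wz2 wneg).
  by apply: le_trans GN _; apply: ef_energy_le => //; [exact: ltW|exact: lt_trans z20].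
have [d d0 dP] := der_lt0_near (ef_dw _ _ oN z2 z20) vz2.
pose e := Num.min (d / 2) (- z2 / 2).
have e0 : 0 < e by rewrite lt_min !divr_gt0// oppr_gt0.
have ed : e <= d / 2 by rewrite ge_min lexx.
have ez : e <= - z2 / 2 by rewrite ge_min lexx orbT.
exists t, (z2 + e); split.
- by rewrite (lt_trans tz2)// ltrDl.
- by lra.
- by case: bubt; rewrite oppr_gt0.
- have [|+ _] := dP (z2 + e); first by rewrite addrC addKr gtr0_norm//; lra.
  by rewrite ltrDl => /(_ e0); rewrite wz2 oppr_lt0.
Qed.

End EmdenFowler.

(** * From the radial equation to Emden-Fowler coordinates; the first bubble *)

Section PolarToEmden.
Context {R : realType} (k : nat) (lam q : R).
Hypothesis k5 : (5 < k)%N.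
Let nu : R := (k%:R - 1) / 2.
Hypothesis qE : q = 2 / nu.
(** With [N = k + 1], [nu = (N - 2) / 2] and [nu * (nu + 1) = N * (N - 2) / 4], so [mu0] is the
    lower bound on [lam], and [qE] says that [q = 4 / (N - 2)]. *)
Let mu : R := lam - nu ^+ 2 - nu.
Hypothesis mu0 : 0 < mu.
Implicit Types (x y s t a b c : R) (U V : R -> R).
Local Notation ode := (radial_ode k lam q).

Let nu_ge : 5 / 2 <= nu.
Proof.
have : 6%:R <= k%:R :> R by rewrite ler_nat.
by rewrite /nu; lra.
Qed.
Let nu_gt0 : 0 < nu. Proof. by apply: lt_le_trans nu_ge; lra. Qed.
Let q0 : 0 < q. Proof. by rewrite qE divr_gt0. Qed.
Let q1 : q <= 1.
Proof. by rewrite qE ler_pdivrMr// mul1r (le_trans _ nu_ge)//; lra. Qed.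
Let kE : k%:R = 2 * nu + 1 :> R. Proof. by rewrite /nu; field. Qed.
Let lam0 : 0 < lam.
Proof.
have n2 : 0 <= nu ^+ 2 by exact: sqr_ge0.
by have h := mu0; have h' := nu_gt0; move: h; rewrite /mu; lra.
Qed.
Let qnu : nu * q = 2. Proof. by rewrite qE mulrCA divff ?mulr1// gt_eqF. Qed.

Lemma pow_pow x u : 0 < x -> pow q (pow nu x * u) = x ^+ 2 * pow q u.
Proof.
move=> x0; rewrite powM; congr (_ * _).
by rewrite /pow (gtr0_norm x0) ger0_norm ?powR_ge0// -powRrM qnu powR_mulrn// ltW.
Qed.

Lemma der_pow x : 0 < x -> der (pow nu) x (nu * pow nu x / x).
Proof.
move=> x0; have H1 := der_spow nu nu_gt0 x; have H2 := derV _ _ _ (derI x) (lt0r_neq0 x0).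
have H := derM _ _ _ _ _ H1 H2.
have {}H : der (fun y => spow nu y * y^-1) x (nu * pow nu x / x).
  by apply: (derE H); rewrite /spow; field; rewrite gt_eqF.
apply: near_eq_is_derive H; near=> y; rewrite /spow mulfK// gt_eqF//.
near: y; exact: lt_nbhsr.
Unshelve. all: by end_near. Qed.

(** [expR s = tanh (t / 2)] is the Euclidean radius of a point at hyperbolic distance [t = gT s], so
    [s] is its logarithm; this change of variable solves [dt / ds = sh t]. *)
Definition gT s : R := ln ((1 + expR s) / (1 - expR s)).

Let exp_lt1 s : s < 0 -> 0 < expR s < 1.
Proof. by move=> s0; rewrite expR_gt0 expR_lt1. Qed.

Lemma expR_gT s : s < 0 -> expR (gT s) = (1 + expR s) / (1 - expR s).
Proof.
move=> /exp_lt1; rewrite /gT; move: (expR s) => x /andP[x0 x1].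
by rewrite lnK// posrE divr_gt0 ?subr_gt0// addr_gt0.
Qed.

Lemma sh_gT s : s < 0 -> sh (gT s) = 2 * expR s / (1 - expR s ^+ 2).
Proof.
move=> s0; rewrite /sh expRN expR_gT//.
move: (exp_lt1 s s0); move: (expR s) => x /andP[x0 x1].
have x2 : x ^+ 2 < 1 by rewrite expr_lt1// ltW.
by field; apply/and3P; split; rewrite gt_eqF//; lra.
Qed.

Lemma der_gT s : s < 0 -> der gT s (sh (gT s)).
Proof.
move=> s0; rewrite sh_gT//; have e := exp_lt1 s s0.
have x2 : expR s ^+ 2 < 1 by case/andP: e => ? ?; rewrite expr_lt1// ltW.
have He : der (fun s => (1 + expR s) / (1 - expR s)) s (2 * expR s / (1 - expR s) ^+ 2).
  apply: derE; first by repeat dstep; rewrite gt_eqF//; case/andP: e => ? ?; rewrite subr_gt0.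
  by cbv beta; field; case/andP: e => ? ?; rewrite gt_eqF//; lra.
have Hl := der_ln _ _ _ He.
apply: derE; first by apply: Hl; case/andP: e => ? ?; rewrite divr_gt0 ?subr_gt0// addr_gt0.
move: e x2; move: (expR s) => x /andP[x0 x1] x2.
by field; apply/and3P; split; rewrite gt_eqF//; lra.
Qed.

Lemma sh_gT_ge s : s < 0 -> expR s <= sh (gT s).
Proof.
move=> s0; rewrite sh_gT//; move: (exp_lt1 s s0); move: (expR s) => x /andP[x0 x1].
have x2 : x ^+ 2 < 1 by rewrite expr_lt1// ltW.
rewrite ler_pdivlMr ?subr_gt0//.
have : 0 <= x * x ^+ 2 by rewrite mulr_ge0 ?sqr_ge0// ltW.
by lra.
Qed.

Lemma sh_gT_gt0 s : s < 0 -> 0 < sh (gT s).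
Proof. by move=> /sh_gT_ge; exact: lt_le_trans (expR_gt0 s). Qed.

Lemma gT_gt0 s : s < 0 -> 0 < gT s.
Proof.
move=> s0; rewrite ltNge; apply/negP => /sh_ler; rewrite sh0.
by rewrite leNgt sh_gT_gt0.
Qed.

Lemma gT_lt s t : s < t -> t < 0 -> gT s < gT t.
Proof.
move=> st t0; apply: (@mono_lt R gT s t (fun s => sh (gT s)) st).
- by move=> x /andP[_ xt]; exact: der_cont (der_gT x (le_lt_trans xt t0)).
- by move=> x /andP[_ xt]; exact: (der_gT x (lt_trans xt t0)).
- by move=> x /andP[_ xt]; exact: (sh_gT_gt0 x (lt_trans xt t0)).
Qed.

Let rho s : R := sh (gT s).
Let drho s : R := ch (gT s) * sh (gT s).

Let der_rho s : s < 0 -> der rho s (drho s).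
Proof. by move=> s0; exact: der_comp (der_sh _) (der_gT s s0). Qed.

Let drho_ge s : s < 0 -> rho s <= drho s.
Proof. by move=> s0; rewrite /drho ler_peMl ?ch_ge1// ltW// sh_gT_gt0. Qed.

Lemma rho_small c : 0 < c -> exists2 S, S < 0 & forall s, s <= S -> mu * rho s ^+ 2 <= c.
Proof.
(* For [x = expR s <= 1 / 2], [rho s = 2 * x / (1 - x ^+ 2) <= 4 * x], so
   [mu * rho s ^+ 2 <= 16 * mu * x]. *)
move=> c0; pose x0 := Num.min (1 / 2) (c / (16 * mu)).
have x00 : 0 < x0 by rewrite lt_min !divr_gt0// mulr_gt0.
have x01 : x0 <= 1 / 2 by rewrite ge_min lexx.
have x02 : x0 <= c / (16 * mu) by rewrite ge_min lexx orbT.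
exists (ln x0); first by rewrite ln_lt0// x00; lra.
move=> s sx; have : expR s <= x0 by rewrite -[leRHS]lnK ?posrE// ler_expR.
have s0 : s < 0 by apply: le_lt_trans sx _; rewrite ln_lt0// x00; lra.
rewrite /rho sh_gT//; move: (exp_lt1 s s0); move: (expR s) => x /andP[x1 x2] xx0.
have xx : x ^+ 2 <= x by rewrite expr2 ler_piMl// ltW.
have H : 2 * x / (1 - x ^+ 2) <= 4 * x.
  rewrite ler_pdivrMr; last by lra.
  have : 0 <= x * (2 - 4 * x ^+ 2) by rewrite mulr_ge0; lra.
  by lra.
have H0 : 0 <= 2 * x / (1 - x ^+ 2) by rewrite divr_ge0 ?mulr_ge0//; lra.
apply: (@le_trans _ _ (mu * (4 * x) ^+ 2)).
  by rewrite ler_pM2l// lerXn2r ?nnegrE// mulr_ge0// ltW.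
have : mu * x <= c / 16.
  apply: (@le_trans _ _ (mu * (c / (16 * mu)))); first by rewrite ler_pM2l// (le_trans xx0).
  by rewrite le_eqVlt; apply/orP; left; apply/eqP; field; rewrite gt_eqF.
have : mu * x ^+ 2 <= mu * x by rewrite ler_pM2l.
by rewrite exprMn; lra.
Qed.

(** The factor [sh ^ nu] removes the first-order term of the equation, and [nu * q = 2] turns
    [sh ^+ 2 * |U|^q] into [|w|^q] ([pow_pow]). [ef_z] is the derivative in [s]. *)
Definition ef_w U s : R := pow nu (rho s) * U (gT s).
Definition ef_z U V s : R :=
  pow nu (rho s) * (nu * ch (gT s) * U (gT s) + sh (gT s) * V (gT s)).

Lemma radial_ode_ef a U V : ode a U V -> ef_sol nu mu q rho (ef_w U) (ef_z U V).
Proof.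
move=> o; split=> s s0.
- have r0 := sh_gT_gt0 s s0; have dg := der_gT s s0.
  have dU := der_comp _ _ _ _ _ (ro_dU _ _ _ _ _ _ o (gT s) (gT_gt0 s s0)) dg.
  have dP := der_comp (pow nu) rho s _ _ (der_pow _ r0) (der_rho s s0).
  rewrite /ef_w; apply: (derE (derM _ _ _ _ _ dP dU)).
  by rewrite /ef_z /rho /drho; field; rewrite gt_eqF.
- have r0 := sh_gT_gt0 s s0; have dg := der_gT s s0.
  have dU := der_comp _ _ _ _ _ (ro_dU _ _ _ _ _ _ o (gT s) (gT_gt0 s s0)) dg.
  have dV := der_comp _ _ _ _ _ (ro_dV _ _ _ _ _ _ o (gT s) (gT_gt0 s s0)) dg.
  have dP := der_comp (pow nu) rho s _ _ (der_pow _ r0) (der_rho s s0).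
  have dc := der_comp _ _ _ _ _ (der_ch (gT s)) dg.
  have ds := der_comp _ _ _ _ _ (der_sh (gT s)) dg.
  rewrite /ef_z; eapply derE; first by repeat dstep.
  cbv beta; rewrite /ef_w pow_pow// /rho /drho /force /spow /coth kE.
  have c2 := ch2 (gT s).
  move: (pow q _) (pow nu _) => p P; move: (U (gT s)) (V (gT s)) => u v.
  (* The right-hand side is regrouped to exhibit [1 + sh ^+ 2], so that [ch2] can be used backwards
     before [field]. *)
  have -> : (nu ^+ 2 - mu * sh (gT s) ^+ 2 - sh (gT s) ^+ 2 * p) * (P * u) =
    P * u * (nu ^+ 2 * (1 + sh (gT s) ^+ 2) + nu * sh (gT s) ^+ 2 -
      lam * sh (gT s) ^+ 2 - sh (gT s) ^+ 2 * p) by rewrite /mu; ring.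
  by rewrite -c2; field; rewrite gt_eqF.
Qed.

Lemma der_weighted a U V t : ode a U V -> 0 < t ->
  der (fun t => sh t ^+ k * V t) t (sh t ^+ k * - force lam q (U t)).
Proof.
move=> o t0; have dV := ro_dV _ _ _ _ _ _ o t t0; have ds := der_sh t.
have st := sh_gt0 t t0.
dtac; rewrite /coth; case: k k5 => // n _; rewrite exprS /=.
by field; rewrite gt_eqF.
Qed.

Lemma sh_ge t : 0 <= t -> t <= sh t.
Proof.
move=> t0; suff : sh 0 - 0 <= sh t - t by rewrite sh0; lra.
apply: (@mono_le R (fun t => sh t - t) 0 t (fun t => ch t - 1) t0).
- by move=> x _; have ? := der_cont (der_sh x); ctac.
- by move=> x _; have ? := der_sh x; dtac.
- by move=> x _; rewrite subr_ge0 ch_ge1.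
Qed.

Section Bubble.
Variables (a t0 : R) (U V : R -> R).
Hypothesis a0 : 0 < a.
Hypothesis t00 : 0 < t0.
Hypothesis o : ode a U V.
Let Y := pow q a.
Hypothesis lamY : lam <= Y.
Hypothesis Yt0 : Y * t0 ^+ 2 = 1 / 4.
Hypothesis ch2t0 : ch t0 <= 2.

Let cU x : cont U x. Proof. exact: ro_contU o x. Qed.
Let cV x : cont V x. Proof. exact: ro_contV o x. Qed.
Let U0 : U 0 = a. Proof. exact: ro_U0 o. Qed.
Let V0 : V 0 = 0. Proof. exact: ro_V0 o. Qed.
Let cPV x : cont (fun t => sh t ^+ k * V t) x.
Proof. by have ? := der_cont (der_sh x); have ? := cV x; ctac. Qed.
Let Y0 : 0 < Y. Proof. by rewrite pow_gt0// gt_eqF. Qed.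

(** While [U >= a / 2], the force lies between 0 and [2 * Y * a], using [lam <= Y]; integrating
    twice gives the quadratic lower bound. *)
Lemma bubble_step c : 0 <= c -> (forall t, 0 < t < c -> a / 2 <= U t) ->
  [/\ V c <= 0, U c <= a & a - Y * a * c ^+ 2 <= U c].
Proof.
move=> c0 H.
have force_ge0 t : 0 < t < c -> 0 <= force lam q (U t).
  move=> /H Ut; have u0 : 0 <= U t by apply: le_trans Ut; rewrite divr_ge0// ltW.
  by rewrite addr_ge0 ?mulr_ge0 ?pow_ge0// ltW.
have Vneg t : 0 <= t -> t <= c -> V t <= 0.
  rewrite le_eqVlt => /predU1P[<- _|t1 tc]; first by rewrite V0.
  have : - (sh 0 ^+ k * V 0) <= - (sh t ^+ k * V t).
    apply: (@mono_le R (fun t => - (sh t ^+ k * V t)) 0 t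
      (fun t => sh t ^+ k * force lam q (U t)) (ltW t1)).
    - by move=> x _; apply: contN.
    - move=> x /andP[x0 _]; apply: (derE (derN _ _ _ (der_weighted _ _ _ _ o x0))).
      by rewrite mulrN opprK.
    - move=> x /andP[x0 xt]; rewrite mulr_ge0 ?exprn_ge0 ?sh_ge0 ?(ltW x0)//.
      by rewrite force_ge0// x0 (lt_le_trans xt).
  by rewrite V0 mulr0 oppr0 oppr_ge0 pmulr_rle0// exprn_gt0// sh_gt0.
have Ule t : 0 <= t -> t <= c -> U t <= a.
  move=> t1 tc; rewrite -U0 -lerN2.
  apply: (@mono_le R (fun t => - U t) 0 t (fun t => - V t) t1).
  - by move=> x _; apply: contN.
  - by move=> x /andP[x0 _]; apply: derN; exact: ro_dU o x x0.
  - by move=> x /andP[x0 xt]; rewrite oppr_ge0 Vneg ?(ltW x0)// (le_trans (ltW xt)).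
split; [exact: Vneg|exact: Ule|].
have Vge t : 0 < t -> t <= c -> - (2 * Y * a * t) <= V t.
  move=> t1 tc.
  have P0 x : 0 < x -> 0 < sh x ^+ k by move=> x0; rewrite exprn_gt0// sh_gt0.
  have Pm x y : 0 < x -> x <= y -> sh x ^+ k <= sh y ^+ k.
    move=> x0 xy; rewrite lerXn2r ?nnegrE ?sh_ge0 ?(ltW x0)//.
      by rewrite (le_trans (ltW x0)).
    exact: sh_ler.
  have PV0 : sh 0 ^+ k * V 0 = 0 by rewrite V0 mulr0.
  have cH x : cont (fun t => 2 * Y * a * t) x by ctac.
  have dH x : 0 < x -> der (fun t => 2 * Y * a * t) x (2 * Y * a).
    by move=> _; dtac; ring.
  have gh x : 0 < x < t -> `|- force lam q (U x)| <= 2 * Y * a.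
    move=> /andP[x0 xt]; have xc := lt_le_trans xt tc.
    have Hx : 0 < x < c by rewrite x0.
    rewrite normrN ger0_norm ?force_ge0//.
    have Ua := Ule x (ltW x0) (ltW xc); have Ux := H x Hx.
    have Ux0 : 0 <= U x by apply: le_trans Ux; rewrite divr_ge0// ltW.
    have p1 : pow q (U x) <= Y by apply: ler_pow => //; rewrite !ger0_norm// ltW.
    have A1 : lam * U x <= Y * a by rewrite ler_pM// ltW.
    have A2 : spow q (U x) <= Y * a by rewrite ler_pM// pow_ge0.
    by rewrite /force; lra.
  have B := @weighted_bound R (fun t => sh t ^+ k) P0 Pm (fun t => sh t ^+ k * V t)
    _ _ _ t (ltW t1) cPV PV0 (fun x (hx : 0 < x) => der_weighted _ _ _ _ o hx) cH dH gh.
  rewrite /= mulr0 subr0 in B.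
  have {}B : `|V t| <= 2 * Y * a * t.
    have Pt := P0 t t1.
    by move: B; rewrite normrM (gtr0_norm Pt) (ler_pM2l Pt).
  by move: B; rewrite ler_norml => /andP[].
have : U 0 + Y * a * 0 ^+ 2 <= U c + Y * a * c ^+ 2; last by rewrite U0 expr0n /= mulr0; lra.
apply: (@mono_le R (fun t => U t + Y * a * t ^+ 2) 0 c (fun t => V t + 2 * Y * a * t) c0).
- by move=> x _; have ? := cU x; ctac.
- by move=> x /andP[x0 _]; have ? := ro_dU _ _ _ _ _ _ o x x0; dtac; ring.
- by move=> x /andP[x0 xc]; have := Vge x x0 (ltW xc); lra.
Qed.

(** A continuity argument: [Y * a * t0 ^+ 2 = a / 4], so at a first time when [U = a / 2] before
    [t0], [bubble_step] would give [U >= 3 / 4 * a]. *)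
Lemma bubble_core t : 0 <= t -> t <= t0 -> a / 2 <= U t /\ U t <= a.
Proof.
move=> t1 tt0.
have Ya : Y * a * t0 ^+ 2 = a / 4 by rewrite mulrAC Yt0; field.
have half x : 0 <= x -> x <= t0 -> a / 2 <= U x.
  move=> x0 xt; rewrite leNgt; apply/negP => Ux.
  have [|||c [/andP[c0 cx] Uc below]] := @first_crossing R (fun t => a / 2 - U t) 0 x x0.
  - by move=> y _; have ? := cU y; ctac.
  - by rewrite U0; have := a0; lra.
  - by rewrite subr_ge0 ltW.
  have [||_ _] := bubble_step c; first exact: ltW.
    by move=> y /andP[y0 yc]; have := below y; rewrite (ltW y0) yc => /(_ isT); lra.
  have : Y * a * c ^+ 2 <= Y * a * t0 ^+ 2.
    rewrite ler_pM2l ?mulr_gt0// lerXn2r ?nnegrE ?(ltW c0) ?(ltW t00)//.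
    exact: le_trans cx xt.
  by rewrite Ya; have := a0; lra.
split; first exact: half.
have Hh y : 0 < y < t -> a / 2 <= U y.
  by move=> /andP[y0 yt]; apply: half; rewrite ltW// (lt_le_trans yt).
by have [] := bubble_step t t1 Hh.
Qed.

(** The force is at least [a * Y / 4], hence at least [c * ch] as [ch <= 2]. This last form has the
    explicit antiderivative [sh ^+ k.+1 / (k + 1)] against the weight. *)
Lemma bubble_slope : V t0 <= - (a * Y / 8 * sh t0 / (k%:R + 1)).
Proof.
have st := sh_gt0 t0 t00.
have k1 : 0 < k%:R + 1 :> R by rewrite ltr_wpDl// ler0n.
pose c := a * Y / 8.
have c0 : 0 < c by rewrite divr_gt0// mulr_gt0.
have : - (sh 0 ^+ k * V 0) - c * sh 0 ^+ k.+1 / (k%:R + 1) <=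
  - (sh t0 ^+ k * V t0) - c * sh t0 ^+ k.+1 / (k%:R + 1).
  apply: (@mono_le R (fun t => - (sh t ^+ k * V t) - c * sh t ^+ k.+1 / (k%:R + 1)) 0 t0
    (fun t => sh t ^+ k * (force lam q (U t) - c * ch t)) (ltW t00)).
  - move=> x _; have ? := cPV x; have ? := der_cont (der_sh x).
    by apply: contD; ctac.
  - move=> x /andP[x0 _]; have H1 := derN _ _ _ (der_weighted _ _ _ _ o x0).
    have ds := der_sh x.
    have H2 : der (fun t => - (c * sh t ^+ k.+1 / (k%:R + 1))) x (- (c * sh x ^+ k * ch x)).
      by dtac; rewrite /= -natr1; field; rewrite gt_eqF.
    by apply: (derE (derD _ _ _ _ _ H1 H2)); ring.
  - move=> x /andP[x0 xt]; rewrite mulr_ge0 ?exprn_ge0 ?sh_ge0 ?(ltW x0)// subr_ge0.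
    have [U1 U2] := bubble_core x (ltW x0) (ltW xt).
    have Ux : 0 <= U x by apply: le_trans U1; rewrite divr_ge0// ltW.
    have cx : ch x <= 2.
      apply: le_trans ch2t0; apply: (@mono_le R (@ch R) x t0 (@sh R) (ltW xt)).
      - by move=> y _; exact: der_cont (der_ch y).
      - by move=> y _; exact: der_ch.
      - by move=> y /andP[xy _]; rewrite sh_ge0// ltW// (lt_trans x0).
    (* Because [q <= 1], [(1 / 2)^q >= 1 / 2]. *)
    have p1 : Y / 2 <= pow q (a / 2).
      rewrite powM ler_pM2l// /pow gtr0_norm ?invr_gt0//.
      rewrite -[leLHS]powRr1 ?invr_ge0//; apply: ger_powR q1.
      by rewrite invr_gt0 invf_le1//; apply/andP; split; lra.
    have p2 : pow q (a / 2) <= pow q (U x).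
      by apply: ler_pow => //; rewrite !ger0_norm// divr_ge0// ltW.
    have A1 : Y / 2 * (a / 2) <= spow q (U x).
      by rewrite ler_pM ?divr_ge0 ?(ltW Y0) ?(ltW a0)// (le_trans p1).
    have A2 : 0 <= lam * U x by rewrite mulr_ge0// ltW.
    have A3 : c * ch x <= c * 2 by rewrite ler_pM2l.
    by rewrite /force; move: A3; rewrite /c; lra.
rewrite V0 mulr0 oppr0 sh0 expr0n /= mulr0 mul0r subr0 => H.
have {}H : sh t0 ^+ k * V t0 <= sh t0 ^+ k * - (c * sh t0 / (k%:R + 1)).
  by move: H; rewrite exprSr mulrN; lra.
by move: H; rewrite ler_pM2l// exprn_gt0.
Qed.

End Bubble.

Let pg := pow nu (1 / 2 : R).
(** At [t0] the term [sh * V] costs the slope [2 * c1] by [bubble_slope], while [nu * ch t0] exceeds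
    [nu] by at most [c1]; so the bubble is left with slope at most [nu - c1]. *)
Let c1 : R := 1 / (64 * (k%:R + 1)).
Let gain : R := mu * pg ^+ 2 / (8 * (nu + 1)).

Let k1 : 0 < k%:R + 1 :> R. Proof. by rewrite ltr_wpDl// ler0n. Qed.
Let c1_gt0 : 0 < c1. Proof. by rewrite divr_gt0// mulr_gt0. Qed.
Let nu1_gt0 : 0 < nu + 1. Proof. by rewrite addr_gt0. Qed.
Let pg_gt0 : 0 < pg. Proof. by rewrite pow_gt0// gt_eqF. Qed.
Let gain_gt0 : 0 < gain.
Proof. by apply: divr_gt0; rewrite mulr_gt0// exprn_gt0. Qed.

(** A bubble of width about [t0] and height [a = y ^ nu], with [y = 1 / (2 * t0)], so that
    [a ^ q * t0 ^+ 2 = 1 / 4]. On its core [U >= a / 2], and integrating the energy growth there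
    gives at least [gain * sh t0 ^+ 2]. *)
Lemma bubble_start b0 L : 0 < b0 -> b0 ^+ 2 / 2 <= gain -> exists2 a, 0 < a &
  forall U V, ode a U V -> exists2 s, s <= L &
    s < 0 /\ bubble_exit nu mu q rho (nu - c1) b0 (ef_w U) (ef_z U V) s.
Proof.
move=> b00 b0g.
have c1nu : 0 < c1 / nu by rewrite divr_gt0.
have /contP/(_ _ c1nu)[r1 r10 r1P] := der_cont (der_ch (0 : R)).
have /contP/(_ _ (expR_gt0 L))[r2 r20 r2P] := @continuous_expR R 0.
(* The three bounds make [nu * ch t0 <= nu + c1], the scale [s] at most [L], and [y] large enough
   for [lam <= a ^ q]. *)
pose t0 := Num.min (Num.min (r1 / 2) (r2 / 2)) (1 / (4 * (1 + lam))).
have l1 : 0 < 1 + lam by rewrite addr_gt0.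
have t00 : 0 < t0 by rewrite !lt_min !divr_gt0// mulr_gt0.
have t0r1 : t0 <= r1 / 2 by rewrite !ge_min lexx.
have t0r2 : t0 <= r2 / 2 by rewrite !ge_min lexx orbT.
have t0l : t0 <= 1 / (4 * (1 + lam)) by rewrite ge_min lexx orbT.
have cht : ch t0 - 1 < c1 / nu.
  have := r1P t0; rewrite subr0 gtr0_norm// ch0 => H.
  by apply: le_lt_trans (ler_norm _) (H _); lra.
have expt : expR t0 - 1 < expR L.
  have := r2P t0; rewrite subr0 gtr0_norm// expR0 => H.
  by apply: le_lt_trans (ler_norm _) (H _); lra.
have cht2 : nu * ch t0 <= nu + c1.
  move: cht; rewrite ltr_pdivlMr// => H.
  by have : (ch t0 - 1) * nu = nu * ch t0 - nu by [ring]; lra.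
have cht3 : ch t0 <= 2.
  have n1 : 1 <= nu by apply: le_trans nu_ge; lra.
  have c11 : c1 <= 1.
    rewrite /c1 ler_pdivrMr ?mulr_gt0// mul1r.
    by have : 0 <= k%:R :> R by [exact: ler0n]; lra.
  have : c1 / nu <= 1 by rewrite ler_pdivrMr// mul1r (le_trans c11).
  by lra.
pose y := 1 / (2 * t0).
have y0 : 0 < y by rewrite divr_gt0// mulr_gt0.
pose a := pow nu y.
have a0 : 0 < a by rewrite pow_gt0// gt_eqF.
have Yy : pow q a = y ^+ 2.
  have := pow_pow y 1 y0; rewrite mulr1 -/a => ->.
  by rewrite [pow q 1]/pow normr1 powR1 mulr1.
have lamY : lam <= pow q a.
  rewrite Yy; have yl : 2 * (1 + lam) <= y.
    move: t0l; rewrite /y !ler_pdivlMr ?mulr_gt0//; lra.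
  have : lam <= 2 * (1 + lam) by have := lam0; lra.
  have : 1 <= y by have := lam0; lra.
  by move=> H1 H2; apply: (le_trans H2); apply: (le_trans yl); rewrite expr2 ler_peMl// ltW.
have Yt0 : pow q a * t0 ^+ 2 = 1 / 4.
  by rewrite Yy /y; field; rewrite gt_eqF.
exists a => // U V o.
pose E := expR t0.
have E1 : 1 < E by rewrite /E expR_gt1.
(* [x = tanh (t0 / 2)], the Euclidean radius for which [gT (ln x) = t0]. *)
pose x := (E - 1) / (E + 1).
have x0 : 0 < x by rewrite divr_gt0 ?subr_gt0// addr_gt0// (lt_trans ltr01).
have x1 : x < 1 by rewrite ltr_pdivrMr; lra.
have xL : x <= expR L.
  apply: le_trans (ltW expt); rewrite -/E /x ler_pdivrMr; last by lra.
  by rewrite ler_peMr; lra.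
have s0 : ln x < 0 by rewrite ln_lt0// x0.
have gTx : gT (ln x) = t0.
  rewrite /gT lnK ?posrE// -[RHS]expRK; congr ln; rewrite -/E /x.
  by field; apply/andP; split; rewrite gt_eqF//; lra.
have rhox : rho (ln x) = sh t0 by rewrite /rho gTx.
exists (ln x); first by rewrite -ler_expR lnK.
split=> //.
have st := sh_gt0 t0 t00; have stt := sh_ge t0 (ltW t00).
have P0 : 0 < pow nu (sh t0) by rewrite pow_gt0// gt_eqF.
have core t := bubble_core a t0 U V a0 t00 o lamY Yt0 t.
have slope := bubble_slope a t0 U V a0 t00 o lamY Yt0 cht3.
have [Ut1 Ut2] := core t0 (ltW t00) (lexx t0).
have Ut0 : 0 < U t0 by apply: lt_le_trans Ut1; rewrite divr_gt0.
have Ysh : 1 / 4 <= pow q a * sh t0 ^+ 2.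
  rewrite -Yt0 ler_pM2l ?pow_gt0 ?gt_eqF//.
  by rewrite lerXn2r ?nnegrE ?(ltW t00) ?(ltW st).
split.
- by rewrite /ef_w rhox gTx mulr_gt0.
- rewrite /ef_w /ef_z rhox gTx [X in _ <= X]mulrCA (ler_pM2l P0).
  have A1 : nu * ch t0 * U t0 <= (nu + c1) * U t0 by rewrite ler_pM2r.
  have A2 : c1 * U t0 <= c1 * a by rewrite ler_pM2l.
  have A3 : sh t0 * V t0 <= sh t0 * - (a * pow q a / 8 * sh t0 / (k%:R + 1)) by rewrite ler_pM2l.
  have A4 : a / (8 * (k%:R + 1)) * (1 / 4) <= a / (8 * (k%:R + 1)) * (pow q a * sh t0 ^+ 2).
    by rewrite ler_pM2l// divr_gt0// mulr_gt0.
  have A5 : sh t0 * - (a * pow q a / 8 * sh t0 / (k%:R + 1)) =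
      - (a / (8 * (k%:R + 1)) * (pow q a * sh t0 ^+ 2)) by field; rewrite gt_eqF.
  have A6 : a / (8 * (k%:R + 1)) * (1 / 4) = 2 * (c1 * a).
    by rewrite /c1; field; rewrite gt_eqF.
  by move: A1 A2 A3 A4; rewrite A5 A6; lra.
have ew : forall t, 0 < t -> t <= t0 -> pow nu (sh t) ^+ 2 * (a / 2) ^+ 2 <= (pow nu (sh t) * U t) ^+ 2.
  move=> t t1 tt; have [U1 _] := core t (ltW t1) tt.
  rewrite [X in _ <= X]exprMn; apply: ler_wpM2l; first exact: sqr_ge0.
  rewrite lerXn2r ?nnegrE ?divr_ge0 ?(ltW a0)//.
  by apply: le_trans U1; rewrite divr_ge0// ltW.
(* The Emden-Fowler energy is rewritten in the variable [t], so that its limit at minus infinity in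
   [s] is the plain value [G 0 = 0]. [F] is an antiderivative of the lower bound for its growth. *)
pose W t := pow nu (sh t) * U t.
pose Z t := pow nu (sh t) * (nu * ch t * U t + sh t * V t).
pose G t := Z t ^+ 2 / 2 - (nu ^+ 2 - mu * sh t ^+ 2) * W t ^+ 2 / 2 + ppow q (W t) / (q + 2).
pose F t := mu * (a / 2) ^+ 2 / (2 * (nu + 1)) * (pow nu (sh t) * sh t) ^+ 2.
have Gx : ef_energy nu mu q rho (ef_w U) (ef_z U V) (ln x) = G t0.
  by rewrite /ef_energy /ef_w /ef_z rhox gTx.
rewrite Gx.
have F0 : F 0 = 0 by rewrite /F sh0 mulr0 expr0n /= mulr0.
have G0 : G 0 = 0.
  by rewrite /G /W /Z /ppow sh0 pow0// !mul0r expr0n /= !(mulr0, mul0r, subr0, addr0).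
have FG : F t0 <= G t0.
  suff : G 0 - F 0 <= G t0 - F t0 by rewrite F0 G0; lra.
  apply: (@mono_le R (fun t => G t - F t) 0 t0 (fun t => mu * sh t * ch t * W t ^+ 2 -
     mu * (a / 2) ^+ 2 * (pow nu (sh t) ^+ 2 * sh t * ch t)) (ltW t00)).
  - move=> t _; have cs := der_cont (der_sh t); have cc := der_cont (der_ch t).
    have cU := ro_contU _ _ _ _ _ _ o t; have cV := ro_contV _ _ _ _ _ _ o t.
    have cP : cont (fun t => pow nu (sh t)) t by apply: cont_comp cs; exact: cont_pow.
    have cW : cont W t by rewrite /W; ctac.
    have cZ : cont Z t by rewrite /Z; ctac.
    have cp : cont (fun t => ppow q (W t)) t.
      exact: (cont_comp (ppow q) W t (der_cont (der_ppow q q0 (W t))) cW).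
    by rewrite /G /F; ctac.
  - move=> t /andP[t1 _]; have sht := sh_gt0 t t1.
    have dU := ro_dU _ _ _ _ _ _ o t t1; have dV := ro_dV _ _ _ _ _ _ o t t1.
    have ds := der_sh t; have dc := der_ch t.
    have dP := der_comp (pow nu) (@sh R) t _ _ (der_pow _ sht) ds.
    have dW : der W t (Z t / sh t).
      apply: (derE (derM _ _ _ _ _ dP dU)); rewrite /Z; field; rewrite gt_eqF//.
    have dZ : der Z t ((nu ^+ 2 - mu * sh t ^+ 2 - pow q (W t)) * W t / sh t).
      rewrite /Z; eapply derE; first by repeat dstep.
      cbv beta; rewrite /W pow_pow// /force /spow /coth kE.
      have c2 := ch2 t.
      move: (pow q _) (pow nu _) => p P; move: (U t) (V t) => u v.
      have -> : (nu ^+ 2 - mu * sh t ^+ 2 - sh t ^+ 2 * p) * (P * u) / sh t =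
        P * u * (nu ^+ 2 * (1 + sh t ^+ 2) + nu * sh t ^+ 2 -
        lam * sh t ^+ 2 - sh t ^+ 2 * p) / sh t by rewrite /mu; field; rewrite gt_eqF.
      by rewrite -c2; field; rewrite gt_eqF.
    have dp := der_comp _ _ _ _ _ (der_ppow q q0 (W t)) dW.
    have dG : der G t (mu * sh t * ch t * W t ^+ 2).
      rewrite /G; eapply derE; first by repeat dstep.
      cbv beta; rewrite /spow; move: (pow q _) => p; move: (W t) (Z t) => w z.
      by field; rewrite !gt_eqF// addr_gt0.
    have dF : der F t (mu * (a / 2) ^+ 2 * (pow nu (sh t) ^+ 2 * sh t * ch t)).
      rewrite /F; eapply derE; first by repeat dstep.
      by cbv beta; move: (pow nu _) => P; field; rewrite !gt_eqF.
    exact: derD dG (derN _ _ _ dF).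
  - move=> t /andP[t1 tt]; have sht := sh_gt0 t t1.
    have H := ew t t1 (ltW tt).
    have msc : 0 <= mu * sh t * ch t.
      exact: mulr_ge0 (mulr_ge0 (ltW mu0) (ltW sht)) (ltW (ch_gt0 t)).
    have -> : mu * (a / 2) ^+ 2 * (pow nu (sh t) ^+ 2 * sh t * ch t) =
      mu * sh t * ch t * (pow nu (sh t) ^+ 2 * (a / 2) ^+ 2).
      by move: (pow nu (sh t)) (a / 2) => P b; ring.
    by rewrite subr_ge0; exact: ler_wpM2l msc _ _ H.
have ys : pg <= pow nu (y * sh t0).
  have ysh := mulr_gt0 y0 st.
  apply: ler_pow => //; rewrite (gtr0_norm ysh) gtr0_norm ?divr_gt0//.
  apply: (@le_trans _ _ (y * t0)); last by rewrite ler_pM2l.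
  by rewrite /y le_eqVlt; apply/orP; left; apply/eqP; field; rewrite gt_eqF.
have FE : F t0 = mu / (8 * (nu + 1)) * pow nu (y * sh t0) ^+ 2 * sh t0 ^+ 2.
  by rewrite /F (powM nu y (sh t0)) -/a; move: (pow nu (sh t0)) => P; field; rewrite gt_eqF.
rewrite FE in FG; apply: le_trans FG; rewrite exprMn mulrAC lnK ?posrE//.
have xs : x <= sh t0 by have := sh_gT_ge (ln x) s0; rewrite gTx lnK.
have bg : b0 ^+ 2 / 2 <= mu / (8 * (nu + 1)) * pow nu (y * sh t0) ^+ 2.
  apply: (le_trans b0g); rewrite /gain mulrAC ler_pM2l ?divr_gt0 ?mulr_gt0//.
  by rewrite lerXn2r ?nnegrE ?(ltW pg_gt0) ?pow_ge0.
apply: ler_pM => //; rewrite ?divr_ge0 ?sqr_ge0//.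
by rewrite lerXn2r ?nnegrE ?(ltW x0) ?(ltW st).
Qed.

(** Since [c1 <= 1 / 64] and [nu >= 5 / 2], which is [N >= 7], the loss from [nu] to [nu1 = nu - c1]
    keeps [nu1 > 2]. *)
Lemma large_amplitude : exists2 a, 0 < a & forall U V, ode a U V -> goes_neg_pos U.
Proof.
pose nu1 := nu - c1; pose nu3 := nu - 3 / 4 * c1; pose nu2 := nu - c1 / 2.
have c := c1_gt0; have nn := nu_ge.
have c11 : c1 <= 1 / 64.
  rewrite /c1 ler_pdivrMr ?mulr_gt0//.
  by have : 0 <= k%:R :> R by [exact: ler0n]; lra.
have nu10 : 0 < nu1 by rewrite /nu1; lra.
have nu13 : nu1 < nu3 by rewrite /nu1 /nu3; lra.
have nu32 : nu3 < nu2 by rewrite /nu2 /nu3; lra.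
have nu2nu : nu2 < nu by rewrite /nu2; lra.
have nu12 : 2 < nu1 by rewrite /nu1; lra.
have g : 0 < nu ^+ 2 - nu2 ^+ 2.
  by rewrite subr_gt0 ltrXn2r// ?nnegrE /nu2; lra.
have [S S0 SP] := rho_small _ g.
have n2 s : s <= S -> nu2 ^+ 2 <= nu ^+ 2 - mu * rho s ^+ 2 by move=> /SP; lra.
have ag := ascent_gain_gt0 nu mu q mu0 nu1 nu2 nu3 nu10 nu13 nu32 nu2nu.
(* As [b0 <= 1], also [b0 ^+ 2 / 2 <= b0], which is below both gains. *)
pose b0 := Num.min 1 (Num.min gain (ascent_gain nu mu q nu1 nu2)).
have b00 : 0 < b0 by rewrite !lt_min ltr01 gain_gt0.
have b01 : b0 <= 1 by rewrite ge_min lexx.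
have b0g : b0 <= gain by rewrite !ge_min lexx orbT.
have b0a : b0 <= ascent_gain nu mu q nu1 nu2 by rewrite !ge_min lexx !orbT.
have b02 : b0 ^+ 2 / 2 <= b0.
  have : b0 ^+ 2 <= b0 by rewrite expr2 ler_piMl// ltW.
  by have : 0 <= b0 ^+ 2 by [exact: sqr_ge0]; lra.
have [L HL] := two_sign_changes nu mu q rho drho mu0 q0 sh_gT_ge der_rho drho_ge
  nu1 nu2 nu3 S nu10 nu13 nu32 nu2nu S0 n2 b0 b00 b01 (le_trans b02 b0a) nu12.
have [a a0 Ha] := bubble_start b0 L b00 (le_trans b02 b0g).
exists a => // U V o; have [s sL [s0 bub]] := Ha U V o.
have [t1 [t2 [t12 t20 w1 w2]]] := HL _ _ s sL (radial_ode_ef _ _ _ o) bub.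
have t10 := lt_trans t12 t20.
have pos t : t < 0 -> 0 < pow nu (rho t) by move=> t0; rewrite pow_gt0// gt_eqF// sh_gT_gt0.
exists (gT t1), (gT t2); split.
- exact: gT_gt0.
- exact: gT_lt.
- by move: w1; rewrite /ef_w pmulr_rlt0// pos.
- by move: w2; rewrite /ef_w pmulr_rgt0// pos.
Qed.

End PolarToEmden.

(** * Lebesgue measure on row vectors *)

Section RowMeasure.
Context {R : realType}.
Local Open Scope classical_set_scope.

Lemma measurable_rV_ball n (c : 'rV[R]_n) e : measurable (ball c e).
Proof.
have [e0|e0] := ltP 0 e; last first.
  have -> : ball c e = set0; last exact: measurable0.
  by apply/seteqP; split => // x [] /(le_lt_trans e0); rewrite ltxx.
have -> : ball c e = \bigcap_(i in [set: 'I_n])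
    ((fun x : 'rV[R]_n => x ord0 i) @^-1` (ball (c ord0 i) e)).
  apply/seteqP; split => x /=.
    by move=> [_ h] i _; exact: h.
  by move=> h; split=> // i j; rewrite ord1; exact: h.
apply: fin_bigcap_measurable; first exact: finite_finset.
move=> i _; rewrite -[X in measurable X]setTI.
apply: measurable_rV_coord => //; exact: measurable_ball.
Qed.

(** The sup-norm balls with rational centres and radii [1 / m.+1] form a countable base. *)
Lemma measurable_rV_open n (U : set 'rV[R]_n) : open U -> measurable U.
Proof.
move=> oU.
pose B (p : 'rV[rat]_n * nat) : set 'rV[R]_n :=
  ball (map_mx (@ratr R) p.1) (p.2.+1%:R^-1).
have -> : U = \bigcup_p (if `[<B p `<=` U>] then B p else set0).
  apply/seteqP; split => x; last by move=> [p _]; case: asboolP => // h /h.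
  move=> Ux; have /nbhs_ballP[e /= e0 eU] := open_nbhs_nbhs (conj oU Ux).
  have [m me] : exists m : nat, m.+1%:R^-1 < e / 2.
    exists (Num.truncn (e / 2)^-1); rewrite invf_plt ?posrE ?divr_gt0//.
    exact: truncnS_gt.
  have m0 : (0 : R) < m.+1%:R^-1 by rewrite invr_gt0.
  have hq i : exists q : rat, x ord0 i - m.+1%:R^-1 < ratr q < x ord0 i + m.+1%:R^-1.
    have [|q] := @rat_in_itvoo R (x ord0 i - m.+1%:R^-1) (x ord0 i + m.+1%:R^-1).
      by rewrite ltrBlDr -addrA ltrDl addr_gt0.
    by rewrite in_itv /= => hq; exists q.
  have [q qP] := choice hq.
  have xB : B (\row_i q i, m) x.
    split=> // i j; rewrite ord1 !mxE /=; have := qP j.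
    by rewrite /ball/= ltr_distl.
  exists (\row_i q i, m) => //; case: asboolP => // -[] y yB; apply: eU.
  apply: (@le_ball _ _ x (m.+1%:R^-1 + m.+1%:R^-1)).
    by move/ltW: me; move: (m.+1%:R^-1) => z; lra.
  by apply: ball_triangle yB; exact: ball_sym.
apply: countable_bigcupT_measurable => [|p]; first exact: countableP.
by case: asboolP => _; [exact: measurable_rV_ball|exact: measurable0].
Qed.

Lemma continuous_measurable_rV n (f : 'rV[R]_n -> R) :
  continuous f -> measurable_fun setT f.
Proof.
move=> cf; apply: (measurability _ (RGenOpens.measurableE R)).
move=> _ [_ [a [b ->]] <-]; rewrite setTI; apply: measurable_rV_open.
by move/continuousP : cf; apply; exact: interval_open.
Qed.

Lemma compact_measurable_rV n (K : set 'rV[R]_n) : compact K -> measurable K.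
Proof.
move=> cK; rewrite -(setCK K); apply: measurableC; apply: measurable_rV_open.
by rewrite openC; apply: compact_closed => //; exact: norm_hausdorff.
Qed.

Lemma rV_cons0 n (p : R * 'rV[R]_n) : rV_cons p ord0 ord0 = p.1.
Proof. by have /(congr1 fst) := rV_consK p. Qed.

Lemma rV_consS n (p : R * 'rV[R]_n) j : rV_cons p ord0 (lift ord0 j) = p.2 ord0 j.
Proof. by have /(congr1 snd)/rowP/(_ j) := rV_consK p; rewrite mxE. Qed.

(** Balls are those of the sup norm, hence cubes of side [2 * e], which split as products along
    [rV_cons]. *)
Lemma lebesgue_rV_ball n (c : 'rV[R]_n) (e : R) : 0 < e ->
  lebesgue_rV R n (ball c e) = ((e *+ 2) ^+ n)%:E.
Proof.
move=> e0; elim: n c => [|n IHn] c.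
  rewrite /= /lebesgue_rV0 diracE expr0.
  by rewrite mem_set//; split=> // i [].
rewrite /= /lebesgue_rV_succ /pushforward.
rewrite (_ : _ @^-1` _ = ball (c ord0 ord0) e `*` ball (rV_uncons c).2 e); last first.
  apply/seteqP; split => -[t x] /=.
    move=> [_ h]; split; first by have := h ord0 ord0; rewrite rV_cons0.
    by split=> // i j; rewrite (ord1 i) mxE; have := h ord0 (lift ord0 j); rewrite rV_consS.
  move=> [h1 [_ h2]]; split=> // i j; rewrite (ord1 i) {i}.
  case: (unliftP ord0 j) => [k|] ->; rewrite ?rV_cons0// rV_consS.
  by have := h2 ord0 k; rewrite mxE.
rewrite product_measure1E ?IHn.
- rewrite exprS EFinM; congr (_ * _)%E; exact: (lebesgue_measure_ball _ (ltW e0)).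
- exact: measurable_ball.
- exact: measurable_rV_ball.
Qed.

End RowMeasure.

(** * Tonelli slicing along an arbitrary coordinate *)

Section Slicing.
Context {R : realType}.
Local Open Scope classical_set_scope.

Definition rV_ins {n} (i : 'I_n.+1) (t : R) (x : 'rV[R]_n) : 'rV[R]_n.+1 :=
  \row_j oapp (fun k => x ord0 k) t (unlift i j).

Lemma rV_ins_id n (i : 'I_n.+1) t x : rV_ins i t x ord0 i = t.
Proof. by rewrite mxE unlift_none. Qed.

Lemma rV_ins_lift n (i : 'I_n.+1) t x j : rV_ins i t x ord0 (lift i j) = x ord0 j.
Proof. by rewrite mxE liftK. Qed.

Lemma rV_ins0 n t (x : 'rV[R]_n) : rV_ins ord0 t x = rV_cons (t, x).
Proof.
apply/rowP => j; case: (unliftP ord0 j) => [k|] ->.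
  by rewrite rV_ins_lift rV_consS.
by rewrite rV_ins_id rV_cons0.
Qed.

Lemma rV_insS n (i : 'I_n.+1) t s (x : 'rV[R]_n) :
  rV_ins (lift ord0 i) t (rV_cons (s, x)) = rV_cons (s, rV_ins i t x).
Proof.
apply/rowP => j; case: (unliftP ord0 j) => [k|] ->; last first.
  have -> : ord0 = lift (lift ord0 i) ord0 :> 'I_n.+2 by apply/val_inj.
  rewrite rV_ins_lift rV_cons0.
  have -> : lift (lift ord0 i) ord0 = ord0 :> 'I_n.+2 by apply/val_inj.
  by rewrite rV_cons0.
rewrite rV_consS /=; case: (unliftP i k) => [l|] ->; last by rewrite !rV_ins_id.
have -> : lift ord0 (lift i l) = lift (lift ord0 i) (lift ord0 l).
  by apply/val_inj; rewrite /= /bump /= !add1n ltnS; case: (i <= l)%N.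
by rewrite !rV_ins_lift rV_consS.
Qed.

Lemma measurable_rV_ins n (i : 'I_n.+1) :
  measurable_fun [set: R * 'rV[R]_n] (fun p => rV_ins i p.1 p.2).
Proof.
apply: measurable_fun_rV => j; case: (unliftP i j) => [k|] ->.
  under eq_fun do rewrite rV_ins_lift.
  exact: (measurableT_comp (measurable_rV_coord k) measurable_snd).
under eq_fun do rewrite rV_ins_id.
exact: measurable_fst.
Qed.

Lemma measurable_slice n (i : 'I_n.+1) (f : 'rV[R]_n.+1 -> \bar R) :
  measurable_fun setT f -> (forall x, (0 <= f x)%E) ->
  measurable_fun setT (fun x => \int[lebesgue_measure]_t f (rV_ins i t x))%E.
Proof.
move=> mf f0.
exact: (@measurable_fun_fubini_tonelli_G _ _ (measurableTypeR R) 'rV[R]_n R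
  (@lebesgue_measure R) (fun p => f (rV_ins i p.1 p.2))
  (measurableT_comp mf (measurable_rV_ins _ i)) (fun p => f0 _)).
Qed.

Lemma integral_rV_cons n (f : 'rV[R]_n.+1 -> \bar R) : measurable_fun setT f ->
  (forall x, (0 <= f x)%E) ->
  (\int[lebesgue_rV R n.+1]_x f x =
   \int[lebesgue_measure \x lebesgue_rV R n]_p f (rV_cons p))%E.
Proof.
move=> mf f0; have := @ge0_integral_pushforward _ _ (measurableTypeR R * 'rV[R]_n)%type
  'rV[R]_n.+1 R (@rV_cons R n) (@measurable_rV_cons R n)
  (@lebesgue_measure R \x lebesgue_rV R n)%E _ _ measurableT mf (fun x _ => f0 x).
by rewrite preimage_setT; exact.
Qed.

Lemma integral_rV_cons1 n (f : 'rV[R]_n.+1 -> \bar R) : measurable_fun setT f ->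
  (forall x, (0 <= f x)%E) ->
  (\int[lebesgue_rV R n.+1]_x f x =
   \int[lebesgue_measure]_s \int[lebesgue_rV R n]_x f (rV_cons (s, x)))%E.
Proof.
move=> mf f0; rewrite integral_rV_cons//.
exact: (@fubini_tonelli1 _ _ (measurableTypeR R) 'rV[R]_n R (@lebesgue_measure R)
  (lebesgue_rV R n) (fun p => f (rV_cons p))
  (measurableT_comp mf (@measurable_rV_cons _ _)) (fun p => f0 _)).
Qed.

Lemma integral_rV_cons2 n (f : 'rV[R]_n.+1 -> \bar R) : measurable_fun setT f ->
  (forall x, (0 <= f x)%E) ->
  (\int[lebesgue_rV R n.+1]_x f x =
   \int[lebesgue_rV R n]_x \int[lebesgue_measure]_s f (rV_ins ord0 s x))%E.
Proof.
move=> mf f0; rewrite integral_rV_cons//.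
under [RHS]eq_integral do under eq_integral do rewrite rV_ins0.
exact: (@fubini_tonelli2 _ _ (measurableTypeR R) 'rV[R]_n R (@lebesgue_measure R)
  (lebesgue_rV R n) (fun p => f (rV_cons p))
  (measurableT_comp mf (@measurable_rV_cons _ _)) (fun p => f0 _)).
Qed.

(** The measure is built by adding first coordinates, so another direction [i] is reached by
    induction: peel off the first coordinate on both sides and slice the rest. Being Tonelli, it is
    stated for nonnegative functions, and signed ones are later split into their two parts. *)
Lemma slicing n (i : 'I_n.+1) (f : 'rV[R]_n.+1 -> \bar R) : measurable_fun setT f ->
  (forall x, (0 <= f x)%E) ->
  (\int[lebesgue_rV R n.+1]_x f x =
   \int[lebesgue_rV R n]_x \int[lebesgue_measure]_t f (rV_ins i t x))%E.
Proof.
elim: n i f => [|n IHn] i f mf f0; first by rewrite ord1; exact: integral_rV_cons2.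
case: (unliftP ord0 i) => [j|] ->; last exact: integral_rV_cons2.
rewrite integral_rV_cons1// integral_rV_cons1; first last.
- by move=> x; apply: integral_ge0.
- exact: measurable_slice.
apply: eq_integral => s _; rewrite (IHn j).
- by apply: eq_integral => x _; apply: eq_integral => t _; rewrite rV_insS.
- apply: (measurableT_comp mf).
  apply: (measurableT_comp (@measurable_rV_cons _ _)).
  exact: (@pair1_measurable _ _ (measurableTypeR R)).
- by [].
Qed.

End Slicing.

Section EuclideanNorm.
Context {R : realType}.
Local Open Scope classical_set_scope.

Lemma edot_ge0 n (x : 'rV[R]_n) : 0 <= edot x x.
Proof. by apply: sumr_ge0 => i _; rewrite -expr2 sqr_ge0. Qed.

Lemma enorm_ge0 n (x : 'rV[R]_n) : 0 <= enorm x.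
Proof. exact: sqrtr_ge0. Qed.

Lemma enorm2 n (x : 'rV[R]_n) : enorm x ^+ 2 = edot x x.
Proof. by rewrite sqr_sqrtr// edot_ge0. Qed.

Lemma coord_le_enorm n (x : 'rV[R]_n) i : `|x ord0 i| <= enorm x.
Proof.
rewrite -(@ler_pXn2r _ 2)// ?nnegrE ?enorm_ge0// enorm2 real_normK ?num_real//.
by rewrite /edot (bigD1 i)//= -expr2 lerDl sumr_ge0// => j _; rewrite -expr2 sqr_ge0.
Qed.

Lemma enorm0_eq0 n (x : 'rV[R]_n) : enorm x = 0 -> x = 0.
Proof.
move=> x0; apply/rowP => i; apply/eqP; rewrite mxE -normr_le0.
by rewrite (le_trans (coord_le_enorm _ x i))// x0.
Qed.

Lemma enorm_gt0 n (x : 'rV[R]_n) : x != 0 -> 0 < enorm x.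
Proof.
by rewrite lt0r enorm_ge0 andbT; apply: contra_neq; exact: enorm0_eq0.
Qed.

Lemma enorm0 n : enorm (0 : 'rV[R]_n) = 0.
Proof. by rewrite /enorm /edot big1 ?sqrtr0// => i _; rewrite mxE mul0r. Qed.

Lemma enorm_ins n (i : 'I_n.+1) t (x : 'rV[R]_n) :
  enorm (rV_ins i t x) ^+ 2 = t ^+ 2 + enorm x ^+ 2.
Proof.
rewrite !enorm2 /edot (bigD1_ord i)//= rV_ins_id -expr2; congr +%R.
by apply: eq_bigr => j _; rewrite rV_ins_lift.
Qed.

Lemma enorm_insE n (i : 'I_n.+1) t (x : 'rV[R]_n) :
  enorm (rV_ins i t x) = Num.sqrt (t ^+ 2 + enorm x ^+ 2).
Proof. by rewrite -(@enorm_ins n i) sqrtr_sqr ger0_norm// enorm_ge0. Qed.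

Lemma continuous_enorm n : continuous (@enorm R n).
Proof.
move=> x; have h : {for x, continuous (fun y : 'rV[R]_n => edot y y)}.
  rewrite /edot; have FF : Filter (nbhs x) by exact: nbhs_filter.
  apply: (@cvg_big (R : numFieldType) 'I_n +%R 0 xpredT _ _ _ _ _ _ FF) => [|i _].
    exact: add_continuous.
  have c := @coord_continuous R 1 n ord0 i x.
  exact: (cvgM c c).
exact: (continuous_comp h (@sqrt_continuous _ _)).
Qed.

Lemma measurable_enorm n : measurable_fun setT (@enorm R n).
Proof. by apply: continuous_measurable_rV; exact: continuous_enorm. Qed.

Lemma measurable_hball n : measurable (@hball R n).
Proof.
rewrite (_ : @hball R n = @enorm R n @^-1` `]-oo, 1[); last first.
  by apply/seteqP; split => x; rewrite /hball /= in_itv.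
rewrite -[X in measurable X]setTI; exact: measurable_enorm.
Qed.

Lemma hball_fin n : (lebesgue_rV R n (@hball R n) < +oo)%E.
Proof.
apply: (@le_lt_trans _ _ (lebesgue_rV R n (ball 0 1))); last first.
  by rewrite lebesgue_rV_ball// ltry.
apply: le_measure; rewrite ?inE.
- exact: measurable_hball.
- exact: measurable_rV_ball.
- move=> x x1; split=> // i j; rewrite (ord1 i) /ball /= mxE sub0r normrN.
  exact: le_lt_trans (coord_le_enorm _ x j) x1.
Qed.

(** Applied in the hyperplane transverse to a direction: the line through the origin can be
    ignored. *)
Lemma lebesgue_rV_set0 n : lebesgue_rV R n.+1 [set 0] = 0%E.
Proof.
rewrite /= /lebesgue_rV_succ /pushforward.
rewrite (_ : _ @^-1` _ = [set 0] `*` [set 0]); last first.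
  apply/seteqP; split => -[t x] /=.
    move=> /rowP h; split; first by have := h ord0; rewrite rV_cons0 mxE.
    by apply/rowP => j; have := h (lift ord0 j); rewrite rV_consS !mxE.
  move=> [-> ->]; apply/rowP => j; case: (unliftP ord0 j) => [k|] ->.
    by rewrite rV_consS !mxE.
  by rewrite rV_cons0 mxE.
rewrite product_measure1E.
- by rewrite [X in (X * _)%E](lebesgue_measure_set1 (0 : R)) mul0e.
- exact: (measurable_set1 (0 : R)).
- apply: compact_measurable_rV; exact: compact_set1.
Qed.

Lemma rV_ins_shift n (i : 'I_n.+1) s t (x : 'rV[R]_n) :
  rV_ins i (s + t) x = s *: delta_mx ord0 i + rV_ins i t x.
Proof.
apply/rowP => j; transitivity (s * (j == i)%:R + rV_ins i t x ord0 j); last first.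
  by rewrite [RHS]mxE; congr +%R; rewrite !mxE eqxx.
case: (unliftP i j) => [k|] ->.
  by rewrite !rV_ins_lift eq_sym (negbTE (neq_lift _ _)) mulr0 add0r.
by rewrite !rV_ins_id eqxx mulr1.
Qed.

Lemma continuous_rV_ins n (i : 'I_n.+1) (x : 'rV[R]_n) : continuous (fun t => rV_ins i t x).
Proof.
move=> t; rewrite (_ : (fun t => _) = (fun t => t *: delta_mx ord0 i + rV_ins i 0 x)).
  by apply: cvgD; [apply: cvgZr_tmp; exact: cvg_id|exact: cvg_cst].
by apply/funext => s; rewrite -rV_ins_shift addr0.
Qed.

Lemma rV_insP n (i : 'I_n.+1) (x : 'rV[R]_n.+1) :
  x = rV_ins i (x ord0 i) (\row_j x ord0 (lift i j)).
Proof.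
apply/rowP => j; case: (unliftP i j) => [k|] ->; last by rewrite rV_ins_id.
by rewrite rV_ins_lift mxE.
Qed.

End EuclideanNorm.

(** * Integrals of derivatives along lines *)

Section LineDerivative.
Context {R : realType}.
Local Notation leb1 := (@lebesgue_measure R).

Lemma integral_compact_support (f : R -> \bar R) :
  (forall t, 1 <= `|t| -> f t = 0%E) ->
  (\int[leb1]_t f t = \int[leb1]_(t in `[(-1)%R, 1%R]%classic) f t)%E.
Proof.
move=> f0; rewrite [RHS]integral_mkcond; apply: eq_integral => t _.
rewrite patchE; case: ifPn => //; rewrite notin_setE /= in_itv /= -ler_norml => /negP.
by rewrite -ltNge => /ltW/f0.
Qed.

(** The fundamental theorem of calculus on [[-1, 1]], stated as the equality of the positive and
    negative parts to fit [slicing]. *)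
Lemma integral_der_compact (p p' : R -> R) : (forall t : R, der p t (p' t)) ->
  (forall t : R, cont p' t) -> (forall t, 1 <= `|t| -> p t = 0 /\ p' t = 0) ->
  (\int[leb1]_t (EFin \o p')^\+ t = \int[leb1]_t (EFin \o p')^\- t)%E.
Proof.
move=> dp cp p0.
rewrite (integral_compact_support (_^\+)%E); last first.
  by move=> t /p0[_ p't]; rewrite funeposE /= p't maxxx.
rewrite (integral_compact_support (_^\-)%E); last first.
  by move=> t /p0[_ p't]; rewrite funenegE /= p't oppr0 maxxx.
have int_p' : leb1.-integrable `[(-1), 1]%classic (EFin \o p').
  apply: continuous_compact_integrable; first exact: segment_compact.
  by apply: cont_within => x _; exact: cp.
have : (\int[leb1]_(t in `[(-1)%R, 1%R]%classic) (p' t)%:E = (p 1%R)%:E - (p (-1)%R)%:E)%E.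
  apply: continuous_FTC2; first by lra.
  - by apply: cont_within => x _; exact: cp.
  - split.
    + by move=> x _; have [] := dp x.
    + by apply: cvg_at_right_filter; exact: der_cont (dp (-1)).
    + by apply: cvg_at_left_filter; exact: der_cont (dp 1).
  - by move=> x _; rewrite derive1E; apply: derive_val.
have [-> _] : p 1 = 0 /\ p' 1 = 0 by apply: p0; rewrite normr1.
have [-> _] : p (-1) = 0 /\ p' (-1) = 0 by apply: p0; rewrite normrN1.
rewrite subee// integralE => /eqP.
by rewrite sube_eq ?add0e ?fin_num_adde_defl ?integrable_pos_fin_num ?integrable_neg_fin_num// => /eqP.
Qed.

Lemma der0_near (f : R -> R) (x : R) : (\forall y \near x, f y = 0) -> der f x 0.
Proof.
move=> f0; apply: near_eq_is_derive (derC 0 x).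
by apply: filterS f0 => y ->.
Qed.

Lemma cont0_near (f : R -> R) (x : R) : (\forall y \near x, f y = 0) -> cont f x.
Proof. by move=> /der0_near/der_cont. Qed.

Lemma near_enorm_gt n (i : 'I_n.+1) (x' : 'rV[R]_n) r0 t : r0 < enorm (rV_ins i t x') ->
  \forall s \near t, r0 < enorm (rV_ins i s x').
Proof.
move=> r0t; have ct : cont (fun s => enorm (rV_ins i s x')) t.
  apply: (@continuous_comp _ _ _ (fun s => rV_ins i s x') (@enorm R _)).
    exact: continuous_rV_ins.
  exact: continuous_enorm.
exact: (cvgr_gt _ ct r0 r0t).
Qed.

(** On almost every line in direction [i], [G] is the derivative of a compactly supported function,
    so its two parts have equal integrals there. The single exceptional line [x' = 0] is null, so
    nothing is asked of [F] at the origin beyond the boundedness of [G]. *)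
Lemma integral_line_der n (i : 'I_n.+2) (F G : 'rV[R]_n.+2 -> R) r0 : r0 < 1 ->
  measurable_fun setT G -> (exists B, forall x, `|G x| <= B) ->
  (forall x, r0 < enorm x -> F x = 0 /\ G x = 0) ->
  (forall x', x' != 0 -> forall t : R, enorm (rV_ins i t x') < 1 ->
     der (fun s => F (rV_ins i s x')) t (G (rV_ins i t x')) /\
     cont (fun s => G (rV_ins i s x')) t) ->
  \int[lebesgue_rV R n.+2]_(x in @hball R n.+2) G x = 0.
Proof.
move=> r01 mG [B GB] FG0 dF.
have mEG : measurable_fun setT (EFin \o G) by exact/measurable_EFinP.
have intG : (lebesgue_rV R n.+2).-integrable (@hball R n.+2) (EFin \o G).
  apply: measurable_bounded_integrable.
  - exact: measurable_hball.
  - exact: hball_fin.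
  - exact: measurable_funTS.
  - exists B; split; first exact: num_real.
    by move=> M BM x _; apply: le_trans (ltW BM); exact: GB.
have toT (f : 'rV[R]_n.+2 -> \bar R) : (forall x, r0 < enorm x -> f x = 0%E) ->
  (\int[lebesgue_rV R n.+2]_(x in @hball R n.+2) f x = \int[lebesgue_rV R n.+2]_x f x)%E.
  move=> f0; rewrite integral_mkcond; apply: eq_integral => x _.
  rewrite patchE; case: ifPn => //; rewrite notin_setE /hball /= => /negP.
  by rewrite -leNgt => x1; rewrite f0// (lt_le_trans r01).
rewrite /Rintegral integralE.
have -> : (\int[lebesgue_rV R n.+2]_(x in @hball R n.+2) (EFin \o G)^\- x =
           \int[lebesgue_rV R n.+2]_(x in @hball R n.+2) (EFin \o G)^\+ x)%E; last first.
  by rewrite subee//; apply: integrable_pos_fin_num => //; exact: measurable_hball.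
rewrite !toT; first last.
- by move=> x /FG0[_ Gx]; rewrite funenegE /= Gx oppr0 maxxx.
- by move=> x /FG0[_ Gx]; rewrite funeposE /= Gx maxxx.
have mGp := measurable_funepos mEG; have mGn := measurable_funeneg mEG.
rewrite (slicing _ i _ mGp (funepos_ge0 _)) (slicing _ i _ mGn (funeneg_ge0 _)).
apply: ge0_ae_eq_integral => //.
- exact: measurable_slice.
- exact: measurable_slice.
- by move=> x _; apply: integral_ge0.
- by move=> x _; apply: integral_ge0.
exists [set 0]%classic; split.
- by apply: compact_measurable_rV; exact: compact_set1.
- exact: lebesgue_rV_set0.
move=> x' /= nx'; apply: contra_notP nx' => /eqP x'0 _.
have h (t : R) : der (fun s => F (rV_ins i s x')) t (G (rV_ins i t x')) /\
     cont (fun s => G (rV_ins i s x')) t.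
  have [t1|t1] := ltP (enorm (rV_ins i t x')) 1; first exact: dF.
  have r0t := lt_le_trans r01 t1; have near0 := near_enorm_gt _ i x' r0 t r0t.
  have [_ ->] := FG0 _ r0t; split.
    by apply: der0_near; apply: filterS near0 => s /FG0[].
  by apply: cont0_near; apply: filterS near0 => s /FG0[].
transitivity (\int[leb1]_s (EFin \o (fun s => G (rV_ins i s x')))^\- s)%E.
  by apply: eq_integral => s _; rewrite !funenegE.
transitivity (\int[leb1]_s (EFin \o (fun s => G (rV_ins i s x')))^\+ s)%E; last first.
  by apply: eq_integral => s _; rewrite !funeposE.
apply/esym/(integral_der_compact (fun s => F (rV_ins i s x'))).
- by move=> t; have [] := h t.
- by move=> t; have [] := h t.
move=> t t1; apply: FG0; apply: (lt_le_trans r01); apply: (le_trans t1).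
by have := coord_le_enorm _ (rV_ins i t x') i; rewrite rV_ins_id.
Qed.

End LineDerivative.

Section TestFunctions.
Context {R : realType} {n : nat}.
Local Notation rV := 'rV[R]_n.+1.
Implicit Types (K : set rV) (phi : rV -> R).

Lemma compact_max K (f : rV -> R) : compact K -> continuous f ->
  exists M, forall x, K x -> f x <= M.
Proof.
move=> cK cf; have [->|/set0P K0] := eqVneq K set0; first by exists 0.
have [c _ fc] := EVT_max_rV K0 cK (continuous_subspaceT cf).
by exists (f c) => x Kx; apply: fc; rewrite inE.
Qed.

Lemma compact_hball_radius K : compact K -> (K `<=` @hball R n.+1)%classic ->
  exists r0, [/\ 0 <= r0, r0 < 1 & forall x, K x -> enorm x <= r0].
Proof.
move=> cK K1; have [->|/set0P K0] := eqVneq K set0; first by exists 0.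
have [c /[!inE] Kc fc] := EVT_max_rV K0 cK (continuous_subspaceT (@continuous_enorm R n.+1)).
exists (enorm c); split; [exact: enorm_ge0|exact: K1|].
by move=> x Kx; apply: fc; rewrite inE.
Qed.

Lemma test_continuous phi : test_function phi -> continuous phi.
Proof. by move=> [/(_ 0%N)]. Qed.

Lemma test_partial_continuous i phi : test_function phi -> continuous (partial i phi).
Proof. by move=> [/(_ 1%N)/(_ i)[]]. Qed.

Lemma test_der_line i phi (t : R) (x : 'rV[R]_n) : test_function phi ->
  der (fun s => phi (rV_ins i s x)) t (partial i phi (rV_ins i t x)).
Proof.
move=> [/(_ 1%N)/(_ i)[dphi _] _]; have := dphi (rV_ins i t x).
have e : (fun h : R => h^-1 *: (phi (rV_ins i (h *: 1 + t) x) - phi (rV_ins i t x))) =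
    (fun h : R => h^-1 *: (phi (h *: delta_mx ord0 i + rV_ins i t x) - phi (rV_ins i t x))).
  by apply/funext => h; rewrite rV_ins_shift [h *: 1]mulr1.
move=> d; apply: DeriveDef; last by rewrite /partial /derive /= e.
by rewrite /derivable /= e.
Qed.

Lemma test_partial_cont_line i phi (t : R) (x : 'rV[R]_n) : test_function phi ->
  cont (fun s => partial i phi (rV_ins i s x)) t.
Proof.
move=> tphi; apply: (@continuous_comp _ _ _ (fun s => rV_ins i s x) (partial i phi)).
  exact: continuous_rV_ins.
exact: test_partial_continuous.
Qed.

Lemma test_support phi : test_function phi -> exists K, [/\ compact K,
  (K `<=` @hball R n.+1)%classic &
  forall x, ~ K x -> phi x = 0 /\ forall i, partial i phi x = 0].
Proof.
move=> tphi; have [_ [K [cK K1 K0]]] := tphi; exists K; split=> // x Kx; split=> [|i].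
  exact: K0.
rewrite [in LHS](rV_insP _ i x).
move: (\row_j _) (rV_insP _ i x) => x' xE.
apply: (der_unique (test_der_line i phi (x ord0 i) x' tphi)).
apply: der0_near.
have oK : open (~` K)%classic.
  by rewrite openC; apply: compact_closed => //; exact: norm_hausdorff.
have nK : nbhs (rV_ins i (x ord0 i) x') (~` K)%classic.
  by rewrite -xE; apply: open_nbhs_nbhs.
have : \forall s \near x ord0 i, (~` K)%classic (rV_ins i s x').
  exact: (continuous_rV_ins _ i x' (x ord0 i) _ nK).
by apply: filterS => s; exact: K0.
Qed.

Lemma test_facts phi : test_function phi -> exists r0, [/\ 0 <= r0, r0 < 1,
  forall x, r0 < enorm x -> phi x = 0 /\ forall i, partial i phi x = 0 &
  forall i, exists B, forall x, `|phi x| <= B /\ `|partial i phi x| <= B].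
Proof.
move=> tphi; have [K [cK K1 K0]] := test_support _ tphi.
have [r0 [r00 r01 Kr0]] := compact_hball_radius _ cK K1.
exists r0; split=> // [x rx|i].
  have nKx : ~ K x by move=> /Kr0; rewrite leNgt rx.
  exact: K0.
have cn (f : rV -> R) : continuous f -> continuous (fun x => `|f x|).
  move=> cf x; apply: continuous_comp; first exact: cf.
  exact: norm_continuous.
have [B1 hB1] := compact_max _ _ cK (cn _ (test_continuous _ tphi)).
have [B2 hB2] := compact_max _ _ cK (cn _ (test_partial_continuous i _ tphi)).
exists (`|B1| + `|B2|) => x.
have [Kx|/K0[-> ->]] := pselect (K x).
  split.
    by rewrite (le_trans (hB1 _ Kx))// (le_trans (ler_norm _))// lerDl.
  by rewrite (le_trans (hB2 _ Kx))// (le_trans (ler_norm _))// lerDr.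
by rewrite normr0 addr_ge0.
Qed.

End TestFunctions.

(** * From radial profiles to weak solutions *)

Section RadialVariable.
Context {R : realType}.
Implicit Types (r t : R).

(* The hyperbolic distance to the origin of a point of Euclidean norm [r]. *)
Definition hdist r : R := ln (1 + r) - ln (1 - r).
Definition conf r : R := 2 / (1 - r ^+ 2).

Lemma conf_den r : 0 <= r < 1 -> 0 < 1 - r ^+ 2.
Proof. by move=> /andP[r0 r1]; rewrite subr_gt0 expr_lt1. Qed.

Lemma conf_gt0 r : 0 <= r < 1 -> 0 < conf r.
Proof. by move=> /conf_den h; rewrite divr_gt0. Qed.

Lemma conf_ler r r0 : 0 <= r -> r <= r0 -> r0 < 1 -> conf r <= conf r0.
Proof.
move=> h0 h1 h2; have h3 := le_trans h0 h1.
have d0 : 0 < 1 - r ^+ 2 by apply: conf_den; rewrite h0 (le_lt_trans h1).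
have d1 : 0 < 1 - r0 ^+ 2 by apply: conf_den; rewrite h3.
by rewrite ler_pM2l// lef_pV2 ?posrE// lerD2l lerN2 lerXn2r ?nnegrE.
Qed.

Lemma der_hdist r : 0 <= r < 1 -> der hdist r (conf r).
Proof.
move=> h; have := conf_den r h; move: h => /andP[r0 r1] d0.
have h1 : 0 < 1 + r by lra.
have h2 : 0 < 1 - r by lra.
have d1 : der (fun s : R => 1 + s) r 1 by dtac; ring.
have d2 : der (fun s : R => 1 - s) r (- 1) by dtac; ring.
apply: (derE (derD _ _ _ _ _ (der_ln _ _ _ d1 h1) (derN _ _ _ (der_ln _ _ _ d2 h2)))).
rewrite /conf; field; rewrite !gt_eqF//=.
Qed.

Lemma hdist0 : hdist 0 = 0.
Proof. by rewrite /hdist addr0 subr0 subrr. Qed.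

Lemma expR_hdist r : 0 <= r < 1 -> expR (hdist r) = (1 + r) / (1 - r).
Proof.
move=> /andP[r0 r1]; rewrite /hdist expRD expRN.
by rewrite !lnK// posrE; lra.
Qed.

Lemma expRN_hdist r : 0 <= r < 1 -> expR (- hdist r) = (1 - r) / (1 + r).
Proof. by move=> h; rewrite expRN expR_hdist// invf_div. Qed.

Lemma sh_hdist r : 0 <= r < 1 -> sh (hdist r) = r * conf r.
Proof.
move=> h; rewrite /sh expR_hdist// expRN_hdist// /conf.
have := conf_den r h; move: h => /andP[r0 r1] d0.
have h1 : 0 < 1 + r by lra.
have h2 : 0 < 1 - r by lra.
by field; rewrite !gt_eqF.
Qed.

Lemma ch_hdist r : 0 <= r < 1 -> ch (hdist r) = (1 + r ^+ 2) * conf r / 2.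
Proof.
move=> h; rewrite /ch expR_hdist// expRN_hdist// /conf.
have := conf_den r h; move: h => /andP[r0 r1] d0.
have h1 : 0 < 1 + r by lra.
have h2 : 0 < 1 - r by lra.
by field; rewrite !gt_eqF.
Qed.

Lemma hdist_gt0 r : 0 < r < 1 -> 0 < hdist r.
Proof.
by move=> /andP[r0 r1]; rewrite /hdist subr_gt0 ltr_ln ?posrE; lra.
Qed.

Lemma hdist_ge0 r : 0 <= r < 1 -> 0 <= hdist r.
Proof.
move=> /andP[]; rewrite le_eqVlt => /predU1P[<- _|r0 r1]; first by rewrite hdist0.
by apply/ltW/hdist_gt0; rewrite r0.
Qed.

Lemma der_conf r : 0 <= r < 1 -> der conf r (r * conf r ^+ 2).
Proof.
move=> /conf_den d0; have d0' : 1 - r ^+ 2 != 0 by rewrite gt_eqF.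
by rewrite /conf; dtac; field.
Qed.

Lemma measurable_conf : measurable_fun setT conf.
Proof.
(* An inverse [d^-1] equals [d] times the power of exponent -1 of [d ^+ 2], also for [d = 0]; real
   powers are measurable. *)
have -> : conf = fun r => 2 * ((1 - r ^+ 2) * ((1 - r ^+ 2) ^+ 2) `^ (-1)).
  apply/funext => r; rewrite /conf powR_inv1 ?sqr_ge0// expr2.
  have [->|d0] := eqVneq (1 - r ^+ 2) 0; first by rewrite invr0 mul0r.
  by move: (1 - r ^+ 2) d0 => d d0; field.
have m1 : measurable_fun setT (fun r => 1 - r ^+ 2).
  by apply: measurable_funB => //; exact: exprn_measurable.
apply: measurable_funM => //; apply: measurable_funM => //.
by apply: measurableT_comp (measurable_powR _) _; exact: measurable_funX.
Qed.

Lemma measurable_hdist : measurable_fun setT hdist.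
Proof.
apply: measurable_funB; apply: measurableT_comp => //.
- exact: measurable_funD.
- exact: measurable_funB.
Qed.

Lemma measurable_inv : measurable_fun setT (@GRing.inv R).
Proof.
rewrite (_ : GRing.inv = fun r : R => r * (r ^+ 2) `^ (-1)).
  apply: measurable_funM => //.
  by apply: measurableT_comp (measurable_powR _) _; exact: exprn_measurable.
apply/funext => r; rewrite powR_inv1 ?sqr_ge0// expr2.
have [->|d0] := eqVneq r 0; first by rewrite invr0 mul0r.
by rewrite invfM mulrA divff// mul1r.
Qed.

End RadialVariable.

Section Flux.
Context {R : realType} (n : nat) (lam q a : R) (U V : R -> R).
Local Notation k := n.+1.
Hypothesis (n5 : (5 < k)%N) (lam0 : 0 < lam) (q0 : 0 < q).
Hypothesis o : radial_ode k lam q a U V.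
Local Notation force := (force lam q).

(** With [N = n.+2], [flux (enorm x)] times [x] is the vector field [conf ^+ (N - 2) * grad u],
    whose divergence is [conf ^+ N] times the Laplace-Beltrami operator of [u]. *)
Definition flux (r : R) : R := conf r ^+ k * V (hdist r) * r^-1.

Lemma force_bound : exists M, forall t, 0 <= t -> [/\ `|U t| <= M, `|V t| <= M & `|force (U t)| <= M].
Proof.
have [B hB] := radial_bound _ _ _ lam0 q0 _ _ _ o.
have B0 : 0 <= B by have [h _] := hB 0 (lexx _); rewrite (le_trans _ h).
have p0 : 0 <= pow q B * B by apply: mulr_ge0 => //; exact: pow_ge0.
have l0 : 0 <= lam * B by apply: mulr_ge0 => //; exact: ltW.
exists (B + (lam * B + pow q B * B)) => t /hB[h1 h2]; split; [lra|lra|].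
have : `|force (U t)| <= lam * B + pow q B * B; last by lra.
rewrite /force (le_trans (ler_normD _ _))// lerD//.
  by rewrite normrM (gtr0_norm lam0) ler_pM2l.
rewrite /spow normrM ler_pM// ger0_norm ?pow_ge0//.
by apply: ler_pow => //; rewrite (ger0_norm B0).
Qed.

(** [weighted_bound] applied to [(sh ^+ k * V)' = - sh ^+ k * force]. The linear bound compensates
    the factor [r^-1] of [flux] at the origin. *)
Lemma V_le_linear M t : (forall t, 0 <= t -> `|force (U t)| <= M) -> 0 <= t ->
  `|V t| <= M * t.
Proof.
move=> hM; rewrite le_eqVlt => /predU1P[<-|t0].
  by rewrite (ro_V0 _ _ _ _ _ _ o) normr0 mulr0.
have P0 (x : R) : 0 < x -> 0 < sh x ^+ k by move=> /sh_gt0 h; rewrite exprn_gt0.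
have Pm (x y : R) : 0 < x -> x <= y -> sh x ^+ k <= sh y ^+ k.
  by move=> x0 xy; rewrite lerXn2r ?nnegrE ?sh_ge0 ?sh_ler// ltW// (lt_le_trans x0).
have cQ (x : R) : cont (fun t => sh t ^+ k * V t) x.
  have ? := ro_contV _ _ _ _ _ _ o x; have ? := der_cont (der_sh x); ctac.
have cH (x : R) : cont (fun t : R => M * t) x by ctac.
have dH (x : R) : 0 < x -> der (fun t : R => M * t) x M by move=> _; dtac; ring.
have := weighted_bound (fun t => sh t ^+ k) P0 Pm (fun t => sh t ^+ k * V t)
  (fun t => - force (U t)) (fun=> M) _ t (ltW t0) cQ _
  (fun (x : R) (hx : 0 < x) => der_weighted _ _ _ n5 _ _ _ _ o hx) cH dH.
rewrite (ro_V0 _ _ _ _ _ _ o) !mulr0 subr0 => /(_ erefl).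
rewrite normrM (gtr0_norm (P0 t t0)) ler_pM2l ?P0//; apply.
by move=> x /andP[x0 _]; rewrite normrN hM// ltW.
Qed.

Lemma flux_bound M r : (forall t, 0 <= t -> `|force (U t)| <= M) -> 0 <= r < 1 ->
  `|flux r| <= M * conf r ^+ k.+1.
Proof.
move=> hM hr; have /ltW c0 := conf_gt0 r hr.
have M0 : 0 <= M by rewrite (le_trans _ (hM 0 _)).
rewrite /flux; have [re|r0] := eqVneq r 0.
  by rewrite {1 2 3}re invr0 mulr0 normr0; apply: mulr_ge0 => //; exact: exprn_ge0.
have rp : 0 < r by rewrite lt0r r0; case/andP: hr.
rewrite normrM normfV (gtr0_norm rp) ler_pdivrMr// normrM ger0_norm ?exprn_ge0//.
have -> : M * conf r ^+ k.+1 * r = conf r ^+ k * (M * sh (hdist r)).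
  by rewrite sh_hdist// exprSr; move: (conf r ^+ k) (conf r) => x y; ring.
rewrite ler_wpM2l ?exprn_ge0//.
rewrite (le_trans (V_le_linear M _ hM (hdist_ge0 r hr)))//.
by rewrite ler_wpM2l// sh_ge// hdist_ge0.
Qed.

Lemma der_flux (r : R) : 0 < r < 1 ->
  der flux r (- (k.+1%:R * flux r + conf r ^+ k.+1 * force (U (hdist r))) * r^-1).
Proof.
move=> hr; have hr' : 0 <= r < 1 by case/andP: hr => /ltW -> ->.
have r0 : r != 0 by case/andP: hr => ? _; rewrite gt_eqF.
have t0 := hdist_gt0 r hr.
have dV := der_comp V hdist r _ _ (ro_dV _ _ _ _ _ _ o _ t0) (der_hdist r hr').
have dc := der_conf r hr'.
rewrite /flux; have dI := derV _ r _ (derI r) r0.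
apply: (derE (derM _ _ _ _ _ (derM _ _ _ _ _ (derX _ k _ _ dc) dV) dI)).
rewrite /coth sh_hdist// ch_hdist//= -/force.
have d0 := conf_den r hr'; have d0' : 1 - r ^+ 2 != 0 by rewrite gt_eqF.
rewrite (exprS (conf r) k) (exprS (conf r) n) -!natr1.
move: (conf r ^+ n) (V (hdist r)) (force (U (hdist r))) (n%:R : R) => X v f m.
by rewrite /conf; field; rewrite r0.
Qed.

End Flux.

Section WeakDerivative.
Context {R : realType} {n : nat}.
Local Notation rV := 'rV[R]_n.+2.
Local Notation leb := (lebesgue_rV R n.+2).
Local Notation B := (@hball R n.+2).

Definition loc_bounded (a : rV -> R) : Prop :=
  forall r0, 0 <= r0 -> r0 < 1 -> exists C, forall x, enorm x <= r0 -> `|a x| <= C.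

(* [b] is the derivative of [a] along the lines in direction [i] that avoid the origin. *)
Definition line_derivative (i : 'I_n.+2) (a b : rV -> R) : Prop :=
  forall x' : 'rV[R]_n.+1, x' != 0 -> forall t : R, enorm (rV_ins i t x') < 1 ->
    der (fun s => a (rV_ins i s x')) t (b (rV_ins i t x')) /\
    cont (fun s => b (rV_ins i s x')) t.

Lemma mul_support_bounded a psi r0 : loc_bounded a -> 0 <= r0 -> r0 < 1 ->
  (exists C, forall x, `|psi x| <= C) -> (forall x, r0 < enorm x -> psi x = 0) ->
  exists C, forall x, `|a x * psi x| <= C.
Proof.
move=> la r00 r01 [C2 hC2] psi0; have [C1 hC1] := la r0 r00 r01.
have C20 : 0 <= C2 by rewrite (le_trans _ (hC2 0)).
have C10 : 0 <= C1 by rewrite (le_trans _ (hC1 0 _))// enorm0.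
exists (C1 * C2) => x; have [xr|xr] := leP (enorm x) r0.
  by rewrite normrM ler_pM// hC1.
by rewrite psi0// mulr0 normr0; exact: mulr_ge0.
Qed.

Lemma bounded_integrable (f : rV -> R) (D : set rV) : measurable D -> (D `<=` B)%classic ->
  measurable_fun setT f -> (exists C, forall x, D x -> `|f x| <= C) ->
  leb.-integrable D (EFin \o f).
Proof.
move=> mD DB mf [C hC]; apply: measurable_bounded_integrable => //.
- apply: le_lt_trans (hball_fin n.+2); apply: le_measure; rewrite ?inE//.
  exact: measurable_hball.
- exact: measurable_funTS.
- exists C; split; first exact: num_real.
  by move=> M CM x Dx; apply: le_trans (ltW CM); exact: hC.
Qed.

Lemma L1loc_bounded a : measurable_fun setT a -> loc_bounded a -> L1loc a.
Proof.
move=> ma la K cK KB; have [r0 [r00 r01 Kr0]] := compact_hball_radius K cK KB.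
have [C hC] := la r0 r00 r01.
apply: bounded_integrable => //; first exact: compact_measurable_rV.
by exists C => x Kx; apply: hC; exact: Kr0.
Qed.

Lemma test_integrable a phi i : measurable_fun setT a -> loc_bounded a ->
  test_function phi ->
  leb.-integrable B (EFin \o (fun x => a x * phi x)) /\
  leb.-integrable B (EFin \o (fun x => a x * partial i phi x)).
Proof.
move=> ma la tphi; have [r0 [r00 r01 phi0 phiB]] := test_facts _ tphi.
have [C hC] := phiB i.
have mphi := continuous_measurable_rV _ _ (test_continuous _ tphi).
have mdphi := continuous_measurable_rV _ _ (test_partial_continuous i _ tphi).
split; (apply: bounded_integrable => //;
  [exact: measurable_hball|exact: measurable_funM|]).
- have [|x /phi0[]//|C' hC'] := mul_support_bounded a phi r0 la r00 r01.
    by exists C => x; have [] := hC x.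
  by exists C' => x _.
- have [|x /phi0[_ ->]//|C' hC'] := mul_support_bounded a (partial i phi) r0 la r00 r01.
    by exists C => x; have [] := hC x.
  by exists C' => x _.
Qed.

(** Integration by parts, by [integral_line_der] for the product [a * phi]; local boundedness stands
    in for regularity at the origin. *)
Lemma weak_derivative i a b phi : measurable_fun setT a -> measurable_fun setT b ->
  loc_bounded a -> loc_bounded b -> line_derivative i a b -> test_function phi ->
  \int[leb]_(x in B) (a x * partial i phi x) = - \int[leb]_(x in B) (b x * phi x).
Proof.
move=> ma mb la lb dab tphi; have [r0 [r00 r01 phi0 phiB]] := test_facts _ tphi.
have [C hC] := phiB i.
have mphi := continuous_measurable_rV _ _ (test_continuous _ tphi).
have mdphi := continuous_measurable_rV _ _ (test_partial_continuous i _ tphi).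
have [int_b _] := test_integrable b phi i mb lb tphi.
have [_ int_a] := test_integrable a phi i ma la tphi.
apply/eqP; rewrite -subr_eq0 opprK -RintegralD//; last exact: measurable_hball.
apply/eqP; apply: (integral_line_der _ i (fun x => a x * phi x) _ r0 r01).
- by apply: measurable_funD; exact: measurable_funM.
- have [|x /phi0[]//|C1 hC1] := mul_support_bounded b phi r0 lb r00 r01.
    by exists C => x; have [] := hC x.
  have [|x /phi0[_ ->]//|C2 hC2] := mul_support_bounded a (partial i phi) r0 la r00 r01.
    by exists C => x; have [] := hC x.
  by exists (C2 + C1) => x; rewrite (le_trans (ler_normD _ _))// lerD.
- by move=> x /phi0[-> /(_ i) ->]; rewrite !mulr0 addr0.
move=> x' x'0 t t1; have [da cb] := dab x' x'0 t t1.
have dphi := test_der_line i phi t x' tphi; split.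
  by apply: (derE (derM _ _ _ _ _ da dphi)); rewrite addrC.
apply: contD; apply: contM => //.
- exact: der_cont da.
- exact: test_partial_cont_line.
- exact: der_cont dphi.
Qed.

Lemma der_enorm_line (i : 'I_n.+2) (t : R) (x' : 'rV[R]_n.+1) : x' != 0 ->
  der (fun s => enorm (rV_ins i s x')) t (t * (enorm (rV_ins i t x'))^-1).
Proof.
move=> x'0; have r0 : 0 < t ^+ 2 + enorm x' ^+ 2.
  by rewrite ltr_wpDl ?sqr_ge0// exprn_gt0// enorm_gt0.
have d1 : der (fun s : R => s ^+ 2 + enorm x' ^+ 2) t (2 * t) by dtac; ring.
have -> : (fun s => enorm (rV_ins i s x')) =
    (fun s : R => Num.sqrt (s ^+ 2 + enorm x' ^+ 2)).
  by apply/funext => s; rewrite enorm_insE.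
rewrite enorm_insE.
apply: (derE (der_comp Num.sqrt _ t _ _ (is_derive1_sqrt r0) d1)).
have s0 : Num.sqrt (t ^+ 2 + enorm x' ^+ 2) != 0 by rewrite gt_eqF// sqrtr_gt0.
by move: (Num.sqrt _) s0 => s s0; field.
Qed.

Lemma enorm_line_gt0 (i : 'I_n.+2) (t : R) (x' : 'rV[R]_n.+1) : x' != 0 ->
  0 < enorm (rV_ins i t x').
Proof.
move=> x'0; rewrite enorm_insE sqrtr_gt0 ltr_wpDl ?sqr_ge0//.
by rewrite exprn_gt0// enorm_gt0.
Qed.

Lemma measurable_radial (w : R -> R) : measurable_fun setT w ->
  measurable_fun setT (fun x : rV => w (enorm x)).
Proof. by move=> mw; apply: measurableT_comp => //; exact: measurable_enorm. Qed.

Lemma coord_ratio (x : rV) i : `|x ord0 i * (enorm x)^-1| <= 1.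
Proof.
rewrite normrM normfV (ger0_norm (enorm_ge0 _ x)).
have [r0|r0] := eqVneq (enorm x) 0; first by rewrite r0 invr0 mulr0.
by rewrite ler_pdivrMr ?mul1r ?coord_le_enorm// lt0r r0 enorm_ge0.
Qed.

End WeakDerivative.

Section RadialSolution.
Context {R : realType} (n : nat) (lam q a : R) (U V : R -> R).
Hypothesis (n5 : (5 < n.+1)%N) (lam0 : 0 < lam) (q0 : 0 < q).
Hypothesis o : radial_ode n.+1 lam q a U V.
Local Notation rV := 'rV[R]_n.+2.
Local Notation leb := (lebesgue_rV R n.+2).
Local Notation B := (@hball R n.+2).
Local Notation force := (force lam q).
Local Notation flux := (flux n V).
Implicit Types (x : rV) (i : 'I_n.+2).

Definition radial_fun x : R := U (hdist (enorm x)).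
Definition radial_grad x : rV :=
  \row_i (V (hdist (enorm x)) * conf (enorm x) * (x ord0 i * (enorm x)^-1)).
Definition radial_force (r : R) : R := conf r ^+ n.+2 * force (U (hdist r)).
Definition radial_flux i x : R := flux (enorm x) * x ord0 i.

(* With [0^-1 = 0], the last term is only present at the origin, where it makes
   the divergence of the flux equal to [- radial_force]. *)
Definition radial_dflux i x : R :=
  flux (enorm x)
  - (x ord0 i * (enorm x)^-1) ^+ 2 * (n.+2%:R * flux (enorm x) + radial_force (enorm x))
  - (1 - enorm x * (enorm x)^-1) * (radial_force (enorm x) / n.+2%:R).

Lemma sum_radial_dflux x : \sum_i radial_dflux i x = - radial_force (enorm x).
Proof.
rewrite /radial_dflux !big_split /= !sumr_const card_ord sumrN -mulr_suml.
rewrite -[flux _ *+ _]mulr_natl -[(- _) *+ _]mulr_natl.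
have N0 : (n.+2%:R : R) != 0 by rewrite pnatr_eq0.
have -> : \sum_i (x ord0 i * (enorm x)^-1) ^+ 2 = (enorm x * (enorm x)^-1) ^+ 2.
  rewrite (exprMn _ (enorm x)) enorm2 /edot mulr_suml; apply: eq_bigr => i _.
  by rewrite exprMn expr2.
have [r0|r0] := eqVneq (enorm x) 0.
  rewrite r0 /flux invr0 !mulr0; move: (radial_force 0) (n.+2%:R : R) N0 => f N N0.
  by field.
rewrite divff//; move: (radial_force _) (flux _) (n.+2%:R : R) => f A N; ring.
Qed.

Lemma loc_bounded_radial (w : R -> R) :
  (forall r0, 0 <= r0 -> r0 < 1 -> exists C, forall r, 0 <= r -> r <= r0 -> `|w r| <= C) ->
  loc_bounded (fun x => w (enorm x)).
Proof.
move=> h r0 r00 r01; have [C hC] := h r0 r00 r01; exists C => x xr.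
by apply: hC => //; exact: enorm_ge0.
Qed.

Lemma loc_boundedD (f g : rV -> R) : loc_bounded f -> loc_bounded g ->
  loc_bounded (fun x => f x + g x).
Proof.
move=> lf lg r0 r00 r01; have [C hC] := lf r0 r00 r01; have [D hD] := lg r0 r00 r01.
by exists (C + D) => x xr; rewrite (le_trans (ler_normD _ _))// lerD ?hC ?hD.
Qed.

Lemma loc_boundedM (f g : rV -> R) : loc_bounded f -> loc_bounded g ->
  loc_bounded (fun x => f x * g x).
Proof.
move=> lf lg r0 r00 r01; have [C hC] := lf r0 r00 r01; have [D hD] := lg r0 r00 r01.
by exists (C * D) => x xr; rewrite normrM ler_pM// ?hC ?hD.
Qed.

Lemma loc_boundedN (f : rV -> R) : loc_bounded f -> loc_bounded (fun x => - f x).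
Proof.
move=> lf r0 r00 r01; have [C hC] := lf r0 r00 r01.
by exists C => x xr; rewrite normrN hC.
Qed.

Lemma loc_bounded_cst (c : R) : loc_bounded (fun _ : rV => c).
Proof. by move=> r0 _ _; exists `|c| => x _. Qed.

Lemma loc_bounded_coord i : loc_bounded (fun x => x ord0 i).
Proof. by move=> r0 _ _; exists r0 => x; exact: le_trans (coord_le_enorm _ x i). Qed.

Lemma loc_bounded_ratio i : loc_bounded (fun x => x ord0 i * (enorm x)^-1).
Proof. by move=> r0 _ _; exists 1 => x _; exact: coord_ratio. Qed.

Lemma loc_bounded_conf : loc_bounded (fun x => conf (enorm x)).
Proof.
apply: loc_bounded_radial => r0 r00 r01; exists (conf r0) => r h0 h1.
by rewrite gtr0_norm ?conf_ler// conf_gt0// h0 (le_lt_trans h1).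
Qed.

Lemma loc_boundedX (f : rV -> R) m : loc_bounded f -> loc_bounded (fun x => f x ^+ m).
Proof.
move=> lf r0 r00 r01; have [C hC] := lf r0 r00 r01.
by exists (C ^+ m) => x xr; rewrite normrX lerXn2r ?nnegrE ?hC// (le_trans _ (hC x xr)).
Qed.

Lemma loc_bounded_profile (w : R -> R) : (exists M, forall t, 0 <= t -> `|w t| <= M) ->
  loc_bounded (fun x => w (hdist (enorm x))).
Proof.
move=> [M hM]; apply: (loc_bounded_radial (fun r => w (hdist r))) => r0 _ r01.
by exists M => r h0 h1; apply: hM; apply: hdist_ge0; rewrite h0 (le_lt_trans h1).
Qed.

Lemma loc_bounded_U : loc_bounded radial_fun.
Proof.
apply: loc_bounded_profile; have [M hM] := force_bound _ _ _ _ _ _ lam0 q0 o.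
by exists M => t /hM[].
Qed.

Lemma loc_bounded_force : loc_bounded (fun x => radial_force (enorm x)).
Proof.
apply: loc_boundedM; first by apply: loc_boundedX; exact: loc_bounded_conf.
apply: (loc_bounded_profile (fun t => force (U t))).
have [M hM] := force_bound _ _ _ _ _ _ lam0 q0 o.
by exists M => t /hM[].
Qed.

Lemma loc_bounded_flux : loc_bounded (fun x => flux (enorm x)).
Proof.
have [M hM] := force_bound _ _ _ _ _ _ lam0 q0 o.
have M0 : 0 <= M by have [h _ _] := hM 0 (lexx _); rewrite (le_trans _ h).
apply: loc_bounded_radial => r0 r00 r01; exists (M * conf r0 ^+ n.+2) => r h0 h1.
have hr : 0 <= r < 1 by rewrite h0 (le_lt_trans h1).
have hr0 : 0 <= r0 < 1 by rewrite r00.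
have hf t (t0 : 0 <= t) : `|force (U t)| <= M by have [] := hM t t0.
rewrite (le_trans (flux_bound _ _ _ _ _ _ n5 o _ _ hf hr))//.
have /ltW c0 := conf_gt0 _ hr; have /ltW c1 := conf_gt0 _ hr0.
by rewrite ler_wpM2l// lerXn2r ?nnegrE ?conf_ler.
Qed.

Lemma loc_bounded_grad i : loc_bounded (fun x => radial_grad x ord0 i).
Proof.
rewrite (_ : (fun x => _) = (fun x => V (hdist (enorm x)) * conf (enorm x) *
  (x ord0 i * (enorm x)^-1))); last by apply/funext => x; rewrite mxE.
apply: loc_boundedM; last exact: loc_bounded_ratio.
apply: loc_boundedM; last exact: loc_bounded_conf.
apply: loc_bounded_profile; have [M hM] := force_bound _ _ _ _ _ _ lam0 q0 o.
by exists M => t /hM[].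
Qed.

Lemma loc_bounded_dflux i : loc_bounded (radial_dflux i).
Proof.
apply: loc_boundedD; last first.
  apply/loc_boundedN/loc_boundedM; last first.
    by apply: loc_boundedM; [exact: loc_bounded_force|exact: loc_bounded_cst].
  move=> r0 _ _; exists 1 => x _; have [->|h] := eqVneq (enorm x) 0.
    by rewrite mul0r subr0 normr1.
  by rewrite divff// subrr normr0.
apply: loc_boundedD; first exact: loc_bounded_flux.
apply/loc_boundedN/loc_boundedM; first by apply: loc_boundedX; exact: loc_bounded_ratio.
apply: loc_boundedD; last exact: loc_bounded_force.
by apply: loc_boundedM; [exact: loc_bounded_cst|exact: loc_bounded_flux].
Qed.

Lemma measurable_profile (w : R -> R) : (forall t, cont w t) ->
  measurable_fun setT (fun x => w (hdist (enorm x))).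
Proof.
move=> cw; apply: (measurable_radial (fun r => w (hdist r))).
apply: measurableT_comp; last exact: measurable_hdist.
exact: continuous_measurable_fun.
Qed.

Lemma measurable_ratio i : measurable_fun setT (fun x => x ord0 i * (enorm x)^-1).
Proof.
apply: measurable_funM; first exact: measurable_rV_coord.
by apply: measurable_radial; exact: measurable_inv.
Qed.

Lemma measurable_conf_radial m : measurable_fun setT (fun x => conf (enorm x) ^+ m).
Proof. by apply: measurable_funX; apply: measurable_radial; exact: measurable_conf. Qed.

Lemma cont_force t : cont force t.
Proof.
rewrite /force /spow.
have ? := cont_pow q q0 t; ctac.
Qed.

Lemma measurable_force : measurable_fun setT (fun x => radial_force (enorm x)).
Proof.
apply: measurable_funM; first exact: measurable_conf_radial.
apply: (measurable_profile (fun t => force (U t))) => t.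
by apply: cont_comp; [exact: cont_force|exact: ro_contU o t].
Qed.

Lemma measurable_flux : measurable_fun setT (fun x => flux (enorm x)).
Proof.
apply: measurable_funM; last by apply: measurable_radial; exact: measurable_inv.
apply: measurable_funM; first exact: measurable_conf_radial.
by apply: measurable_profile; exact: ro_contV o.
Qed.

Lemma measurable_radial_fun : measurable_fun setT radial_fun.
Proof. by apply: measurable_profile; exact: ro_contU o. Qed.

Lemma measurable_grad i : measurable_fun setT (fun x => radial_grad x ord0 i).
Proof.
rewrite (_ : (fun x => _) = (fun x => V (hdist (enorm x)) * conf (enorm x) *
  (x ord0 i * (enorm x)^-1))); last by apply/funext => x; rewrite mxE.
apply: measurable_funM; last exact: measurable_ratio.
apply: measurable_funM; last by apply: measurable_radial; exact: measurable_conf.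
by apply: measurable_profile; exact: ro_contV o.
Qed.

Lemma measurable_dflux i : measurable_fun setT (radial_dflux i).
Proof.
apply: measurable_funB; last first.
  apply: measurable_funM; last by apply: measurable_funM => //; exact: measurable_force.
  apply: measurable_funB => //; apply: measurable_funM; first exact: measurable_enorm.
  by apply: measurable_radial; exact: measurable_inv.
apply: measurable_funB; first exact: measurable_flux.
apply: measurable_funM; first by apply: measurable_funX; exact: measurable_ratio.
apply: measurable_funD; last exact: measurable_force.
by apply: measurable_funM => //; exact: measurable_flux.
Qed.

Lemma line_grad i : line_derivative i radial_fun (fun x => radial_grad x ord0 i).
Proof.
move=> x' x'0 t t1; have rt := enorm_line_gt0 i t x' x'0.
have r01 : 0 < enorm (rV_ins i t x') < 1 by rewrite rt.
have dr := der_enorm_line i t x' x'0; have cr := der_cont dr.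
have dT := der_hdist _ (introT andP (conj (ltW rt) t1)).
have dc := der_conf _ (introT andP (conj (ltW rt) t1)).
have t0 := hdist_gt0 _ r01.
split.
  apply: (derE (der_comp U _ t _ _ (ro_dU _ _ _ _ _ _ o _ t0) (der_comp hdist _ t _ _ dT dr))).
  by rewrite mxE rV_ins_id mulrA.
rewrite (_ : (fun s => _) = (fun s => V (hdist (enorm (rV_ins i s x'))) *
   conf (enorm (rV_ins i s x')) * (s * (enorm (rV_ins i s x'))^-1))); last first.
  by apply/funext => s; rewrite mxE rV_ins_id.
apply: contM; last by apply: contM; [exact: contI|apply: contV => //; rewrite gt_eqF].
apply: contM; last exact: (cont_comp conf (fun s => enorm (rV_ins i s x')) t (der_cont dc) cr).
exact: (cont_comp V (fun s => hdist (enorm (rV_ins i s x'))) t (ro_contV _ _ _ _ _ _ o _) (cont_comp hdist (fun s => enorm (rV_ins i s x')) t (der_cont dT) cr)).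
Qed.

Lemma line_flux i : line_derivative i (radial_flux i) (radial_dflux i).
Proof.
move=> x' x'0 t t1; have rt := enorm_line_gt0 i t x' x'0.
have r01 : 0 < enorm (rV_ins i t x') < 1 by rewrite rt.
have dr := der_enorm_line i t x' x'0; have cr := der_cont dr.
have dT := der_hdist _ (introT andP (conj (ltW rt) t1)).
have dc := der_conf _ (introT andP (conj (ltW rt) t1)).
have dF := der_comp flux (fun s => enorm (rV_ins i s x')) t _ _
  (der_flux _ _ _ _ _ _ o _ r01) dr.
have rn0 : enorm (rV_ins i t x') != 0 by rewrite gt_eqF.
have fE : (fun s => radial_flux i (rV_ins i s x')) =
    (fun s => flux (enorm (rV_ins i s x')) * s).
  by apply/funext => s; rewrite /radial_flux rV_ins_id.
have dE : (fun s => radial_dflux i (rV_ins i s x')) = (fun s =>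
    flux (enorm (rV_ins i s x'))
    - (s * (enorm (rV_ins i s x'))^-1) ^+ 2 *
      (n.+2%:R * flux (enorm (rV_ins i s x')) + radial_force (enorm (rV_ins i s x')))
    - (1 - enorm (rV_ins i s x') * (enorm (rV_ins i s x'))^-1) *
      (radial_force (enorm (rV_ins i s x')) / n.+2%:R)).
  by apply/funext => s; rewrite /radial_dflux rV_ins_id.
split.
  rewrite fE; apply: (derE (derM _ _ _ _ _ dF (derI t))).
  rewrite /radial_dflux rV_ins_id divff// subrr mul0r subr0 /radial_force.
  move: (flux _) => A; move: (_ ^+ n.+2 * _) => f; move: (enorm _) rn0 => r rn0.
  by field.
rewrite dE.
have cF := der_cont dF.
have cV : cont (fun s => (enorm (rV_ins i s x'))^-1) t by apply: contV.
have cf : cont (fun s => radial_force (enorm (rV_ins i s x'))) t.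
  apply: contM.
    by apply: contX; exact: (cont_comp conf (fun s => enorm (rV_ins i s x')) t (der_cont dc) cr).
  apply: (cont_comp force); first exact: cont_force.
  exact: (cont_comp U (fun s => hdist (enorm (rV_ins i s x'))) t (ro_contU _ _ _ _ _ _ o _) (cont_comp hdist (fun s => enorm (rV_ins i s x')) t (der_cont dT) cr)).
by ctac.
Qed.

End RadialSolution.

Section WeakSolution.
Context {R : realType} (n : nat) (lam q a : R) (U V : R -> R).
Hypothesis (n5 : (5 < n.+1)%N) (lam0 : 0 < lam) (q0 : 0 < q).
Hypothesis o : radial_ode n.+1 lam q a U V.
Local Notation rV := 'rV[R]_n.+2.
Local Notation leb := (lebesgue_rV R n.+2).
Local Notation B := (@hball R n.+2).
Local Notation force := (force lam q).
Local Notation flux := (flux n V).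
Implicit Types (x : rV) (i : 'I_n.+2).

Local Notation u := (radial_fun n U).
Local Notation g := (radial_grad n V).
Local Notation hforce := (radial_force n lam q U).

Lemma Rintegral_sum I (s : seq I) (f : I -> rV -> R) :
  (forall j, leb.-integrable B (EFin \o f j)) ->
  leb.-integrable B (EFin \o (fun x => \sum_(j <- s) f j x)) /\
  \int[leb]_(x in B) (\sum_(j <- s) f j x) = \sum_(j <- s) \int[leb]_(x in B) f j x.
Proof.
move=> hf; have mB := measurable_hball (R := R) n.+2.
elim: s => [|k s [IH1 IH2]].
  have -> : (fun x => \sum_(j <- [::]) f j x) = cst 0.
    by apply/funext => x; rewrite big_nil.
  by rewrite big_nil Rintegral_cst// mul0r; split => //; exact: integrable0.
have -> : (fun x => \sum_(j <- k :: s) f j x) = fun x => f k x + \sum_(j <- s) f j x.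
  by apply/funext => x; rewrite big_cons.
rewrite RintegralD// IH2 big_cons; split => //.
exact: (integrableD mB (hf k) IH1).
Qed.

Lemma radial_weak_gradient : weak_gradient u g.
Proof.
have mu := measurable_radial_fun n lam q a U V o.
have mg := measurable_grad n lam q a U V o.
have lu := loc_bounded_U n lam q a U V lam0 q0 o.
have lg := loc_bounded_grad n lam q a U V lam0 q0 o.
split => [|i|phi tphi i].
- exact: L1loc_bounded.
- exact: L1loc_bounded.
apply: weak_derivative => //.
exact: (line_grad _ _ _ _ _ _ o i).
Qed.

(** The factor [conf ^- 2] in [hgrad_dot] lowers the volume weight to the power [N - 2] contained in
    [flux]. *)
Lemma hgrad_dot_flux x w : B x -> hgrad_dot x (g x) w * conformal_factor x ^+ n.+2 =
  \sum_i radial_flux n V i x * w ord0 i.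
Proof.
rewrite /hball /= => x1.
have d0 := conf_den _ (introT andP (conj (enorm_ge0 _ x) x1)).
rewrite /hgrad_dot /edot mulr_sumr mulr_suml; apply: eq_bigr => i _.
rewrite mxE /radial_flux /flux /conformal_factor -/(conf _).
rewrite (exprS (conf _) n.+1) (exprS (conf _) n).
move: (V _) (w _ _) (x ord0 i) => v d xi.
move: (conf _ ^+ n) => c; rewrite /conf.
move: (enorm x)^-1 => ri; move: (1 - _) d0 => y y0.
by field; rewrite gt_eqF.
Qed.

(** The gradient term is the sum over [i] of the pairings of [radial_flux i] with [partial i phi].
    Each one is integrated by parts separately, and [sum_radial_dflux] turns the resulting
    divergence into the force. *)
Lemma radial_weak_solution p : p - 1 = q -> weak_solution lam p u.
Proof.
move=> pq; exists g; have mB := measurable_hball (R := R) n.+2.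
have mu := measurable_radial_fun n lam q a U V o.
have lu := loc_bounded_U n lam q a U V lam0 q0 o.
have [M hM] := force_bound _ _ _ _ _ _ lam0 q0 o.
have ms : measurable_fun setT (fun x => spow q (u x)).
  apply: (measurable_profile n (fun t => spow q (U t))) => t.
  apply: (cont_comp (spow q)); last exact: ro_contU o t.
  by rewrite /spow; have ? := cont_pow q q0 (U t); ctac.
have ls : loc_bounded (fun x => spow q (u x)).
  have -> : (fun x => spow q (u x)) = (fun x => force (u x) + - (lam * u x)).
    by apply/funext => x; rewrite /force; ring.
  apply: loc_boundedD.
    apply: (loc_bounded_profile n (fun t => force (U t))).
    by exists M => t /hM[].
  by apply: loc_boundedN; apply: loc_boundedM => //; exact: loc_bounded_cst.
have lc : loc_bounded (fun x => conf (enorm x) ^+ n.+2).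
  by apply: loc_boundedX; exact: loc_bounded_conf.
have mc := measurable_conf_radial (R := R) n n.+2.
split; [exact: radial_weak_gradient|by rewrite pq; exact: L1loc_bounded|].
move=> phi tphi; rewrite pq.
have int_u : leb.-integrable B (EFin \o (fun x => u x * phi x * conformal_factor x ^+ n.+2)).
  have [||h _] := test_integrable (fun x => u x * conf (enorm x) ^+ n.+2) phi ord0 _ _ tphi.
  - exact: (measurable_funM mu mc).
  - exact: (loc_boundedM _ _ _ lu lc).
  - by move: h; congr (_.-integrable _ _); apply/funext => x /=; rewrite mulrAC.
have int_s : leb.-integrable B (EFin \o (fun x => spow q (u x) * phi x * conformal_factor x ^+ n.+2)).
  have [||h _] := test_integrable (fun x => spow q (u x) * conf (enorm x) ^+ n.+2) phi ord0 _ _ tphi.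
  - exact: (measurable_funM ms mc).
  - exact: (loc_boundedM _ _ _ ls lc).
  - by move: h; congr (_.-integrable _ _); apply/funext => x /=; rewrite mulrAC.
have int_F i : leb.-integrable B (EFin \o (fun x => radial_flux n V i x * partial i phi x)).
  have [||_ h] := test_integrable (radial_flux n V i) phi i _ _ tphi.
  - apply: measurable_funM; last exact: measurable_rV_coord.
    exact: (measurable_flux _ _ _ _ _ _ o).
  - apply: loc_boundedM; last exact: loc_bounded_coord.
    exact: (loc_bounded_flux _ _ _ _ _ _ n5 lam0 q0 o).
  - exact: h.
have mD := measurable_dflux _ _ _ _ _ _ q0 o.
have lD := loc_bounded_dflux _ _ _ _ _ _ n5 lam0 q0 o.
have int_D i : leb.-integrable B (EFin \o (fun x => radial_dflux n lam q U V i x * phi x)).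
  by have [] := test_integrable _ phi i (mD i) (lD i) tphi.
have e1 : hintegral (fun x => hgrad_dot x (g x) (grad phi x)) =
    \sum_i \int[leb]_(x in B) (radial_flux n V i x * partial i phi x).
  have [_ <-] := Rintegral_sum _ (index_enum 'I_n.+2) _ int_F.
  apply: eq_Rintegral => x /[!inE] Bx; rewrite hgrad_dot_flux//.
  by apply: eq_bigr => i _; rewrite mxE.
have e2 : \sum_i \int[leb]_(x in B) (radial_flux n V i x * partial i phi x) =
    - \int[leb]_(x in B) (- hforce (enorm x) * phi x).
  rewrite (eq_bigr (fun i => - \int[leb]_(x in B) (radial_dflux n lam q U V i x * phi x))).
    have [_ h] := Rintegral_sum _ (index_enum 'I_n.+2) _ int_D.
    rewrite sumrN -h; congr (- _); apply: eq_Rintegral => x _.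
    by rewrite -mulr_suml sum_radial_dflux.
  move=> i _; apply: weak_derivative => //.
  - apply: measurable_funM; last exact: measurable_rV_coord.
    exact: (measurable_flux _ _ _ _ _ _ o).
  - apply: loc_boundedM; last exact: loc_bounded_coord.
    exact: (loc_bounded_flux _ _ _ _ _ _ n5 lam0 q0 o).
  - exact: (line_flux _ _ _ _ _ _ q0 o).
have int_lu : leb.-integrable B
    (EFin \o (fun x => lam * (u x * phi x * conformal_factor x ^+ n.+2))).
  exact: (integrableZl mB lam int_u).
have int_w := integrableD mB int_lu int_s.
rewrite e1 e2 /hintegral.
have -> : \int[leb]_(x in B) (- hforce (enorm x) * phi x) =
    -1 * (lam * \int[leb]_(x in B) (u x * phi x * conformal_factor x ^+ n.+2) +
          \int[leb]_(x in B) (spow q (u x) * phi x * conformal_factor x ^+ n.+2)).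
  rewrite -(RintegralZl lam mB int_u) -(RintegralD mB int_lu int_s) -(RintegralZl _ mB int_w).
  apply: eq_Rintegral => x _; rewrite /radial_force /force -/(u x) /conformal_factor -/(conf _).
  by move: (conf _ ^+ _) (phi x) => c f; move: (spow q _) => s; move: (u x) => v; ring.
move: (\int[leb]_(x in B) _) (\int[leb]_(x in B) _) => y z; ring.
Qed.

Lemma radial_radial_fun : radial u.
Proof. by move=> x y _ _ xy; rewrite /radial_fun xy. Qed.

End WeakSolution.

(** * Finite energy *)

Section Shells.
Context {R : realType} {n : nat}.
Local Notation rV := 'rV[R]_n.+2.
Local Notation leb := (lebesgue_rV R n.+2).
Local Notation leb1 := (@lebesgue_measure R).
Local Notation B := (@hball R n.+2).
Implicit Types (x : rV) (d : R).
Local Open Scope classical_set_scope.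

Lemma measurable_enorm_set (c1 c2 : R) : measurable [set x : rV | c1 <= enorm x ^+ 2 < c2].
Proof.
have m2 : measurable_fun setT (fun x : rV => enorm x ^+ 2).
  by apply: measurable_funX; exact: measurable_enorm.
have -> : [set x : rV | c1 <= enorm x ^+ 2 < c2] =
    ((fun x : rV => (enorm x ^+ 2 : R)) @^-1` `[c1, c2[%classic)%classic.
  by apply/seteqP; split => x /=; rewrite in_itv.
rewrite -[X in measurable X]setTI; apply: m2 => //.
Qed.

(** If [s] is half the chord cut out of the ball by the line, then [(s - |t|) * (s + |t|) <= d];
    with [|t| >= tau] this confines [t] to two intervals of length [d / tau]. *)
Lemma slice_measure (E : set rV) (tau d : R) (i : 'I_n.+2) (x' : 'rV[R]_n.+1) :
  0 < tau -> 0 < d -> measurable E ->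
  (forall x, E x -> tau <= `|x ord0 i| /\ 1 - d <= enorm x ^+ 2 < 1) ->
  (leb1 ((fun t => rV_ins i t x') @^-1` E)%classic <=
   ((2 * d / tau) * \1_(@hball R n.+1) x')%:E)%E.
Proof.
move=> tau0 d0 mE hE.
have mpre : measurable ((fun t : R => rV_ins i t x') @^-1` E)%classic.
  rewrite -[X in measurable X]setTI.
  exact: (measurableT_comp (measurable_rV_ins _ i) (@pair2_measurable _ _ (measurableTypeR R) _ x')).
have [x'1|x'1] := ltP (enorm x') 1; last first.
  rewrite (_ : (_ @^-1` E)%classic = set0).
    by rewrite measure0 lee_fin mulr_ge0// divr_ge0// ltW// mulr_gt0.
  apply/seteqP; split => // t /= /hE[_ /andP[_]].
  by rewrite enorm_ins; have := exprn_ege1 2 x'1; have := sqr_ge0 t; lra.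
rewrite indicE mem_set// mulr1.
set s := Num.sqrt (1 - enorm x' ^+ 2).
have s2 : s ^+ 2 = 1 - enorm x' ^+ 2.
  by rewrite sqr_sqrtr// subr_ge0 expr_le1// ?enorm_ge0// ltW.
have s0 : 0 <= s by exact: sqrtr_ge0.
have dt0 : 0 < d / tau by rewrite divr_gt0.
apply: (@le_trans _ _ (leb1 (`[(s - d / tau)%R, s] `|` `[(- s)%R, (- s + d / tau)%R])%classic)).
  apply: le_measure; rewrite ?inE//; first exact: measurableU.
  move=> t /= /hE[]; rewrite rV_ins_id enorm_ins => t1 /andP[t2 t3].
  have ts : `|t| < s.
    by rewrite -(@ltr_pXn2r _ 2)// ?nnegrE// real_normK ?num_real// s2; lra.
  have h : s - `|t| <= d / tau.
    rewrite ler_pdivlMr//.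
    have h1 : (s - `|t|) * (s + `|t|) <= d.
      by rewrite -subr_sqr real_normK ?num_real// s2; lra.
    apply: le_trans h1; rewrite ler_wpM2l//; first by rewrite subr_ge0 ltW.
    by lra.
  rewrite !in_itv /=; case: (ger0P t) ts h => h0.
    by move=> ts h; left; apply/andP; split; lra.
  by move=> ts h; right; apply/andP; split; lra.
have hI (c1 c2 : R) : c2 - c1 = d / tau -> leb1 `[c1, c2] = (d / tau)%:E.
  move=> e; rewrite lebesgue_measure_itv /= lte_fin ifT; last by lra.
  by rewrite -EFinD e.
apply: (@le_trans _ _ (leb1 `[(s - d / tau)%R, s] + leb1 `[(- s)%R, (- s + d / tau)%R])%E).
  exact: measureU2.
rewrite !hI; [|ring|ring].
by rewrite -EFinD lee_fin; lra.
Qed.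

Definition shell d : set rV := [set x : rV | 1 - d <= enorm x ^+ 2 < 1].
Definition shell_part (i : 'I_n.+2) (tau d : R) : set rV :=
  [set x : rV | tau <= `|x ord0 i| /\ 1 - d <= enorm x ^+ 2 < 1].

Lemma measurable_shell_part i tau d : measurable (shell_part i tau d).
Proof.
rewrite (_ : shell_part i tau d = ((fun x : rV => `|x ord0 i|) @^-1` `[tau, +oo[) `&`
  [set x : rV | 1 - d <= enorm x ^+ 2 < 1]); last first.
  by apply/seteqP; split => x /=; rewrite in_itv /= andbT.
apply: measurableI; last exact: measurable_enorm_set.
rewrite -[X in measurable X]setTI.
by apply: measurableT_comp => //; exact: measurable_rV_coord.
Qed.

Lemma shell_part_measure (i : 'I_n.+2) (tau d : R) : 0 < tau -> 0 < d ->
  (leb (shell_part i tau d) <=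
   (2 * d / tau)%:E * lebesgue_rV R n.+1 (@hball R n.+1))%E.
Proof.
move=> tau0 d0; set E := shell_part i tau d.
have mE : measurable E by exact: measurable_shell_part.
have mi : measurable_fun setT (fun x : rV => (\1_E x : R)%:E) by exact/measurable_EFinP.
rewrite -[E in leb E]setIT -(integral_indic leb measurableT mE).
have mi0 x : (0 <= (\1_E x : R)%:E)%E by rewrite lee_fin.
rewrite (slicing _ i _ mi mi0).
have mB := measurable_hball (R := R) n.+1.
rewrite -[@hball R n.+1]setIT -(integral_indic _ measurableT mB).
rewrite -ge0_integralZl_EFin//; first last.
- by rewrite divr_ge0 ?mulr_ge0// ltW.
- exact/measurable_EFinP.
apply: ge0_le_integral => //.
- by move=> x _; apply: integral_ge0 => t _; rewrite lee_fin.
- exact: (measurable_slice _ i _ mi mi0).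
- by apply: measurable_funeM; exact/measurable_EFinP.
move=> x' _.
have := slice_measure E tau d i x' tau0 d0 mE (fun x h => h).
rewrite EFinM; apply: le_trans; rewrite le_eqVlt; apply/orP; left; apply/eqP.
have mpre : measurable ((fun t : R => rV_ins i t x') @^-1` E)%classic.
  rewrite -[X in measurable X]setTI.
  exact: (measurableT_comp (measurable_rV_ins _ i) (@pair2_measurable _ _ (measurableTypeR R) _ x')).
by have := integral_indic leb1 measurableT mpre; rewrite setIT => <-.
Qed.

(** For [d <= 1 / 2] a point of the shell has [|x| ^+ 2 >= 1 / 2], so one of its [N] coordinates
    satisfies [x_i ^+ 2 >= tau = 1 / (4 * N)], and [|x_i| >= tau] because [tau <= 1]: the shell is
    covered by [N] parts. For larger [d] the measure of the ball suffices. *)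
Lemma shell_measure : exists C : R, 0 <= C /\ forall d, 0 < d -> d <= 1 ->
  (leb (shell d) <= (C * d)%:E)%E.
Proof.
pose b := fine (leb B); pose b' := fine (lebesgue_rV R n.+1 (@hball R n.+1)).
have bE : leb B = b%:E by rewrite fineK// ge0_fin_numE// hball_fin.
have b'E : lebesgue_rV R n.+1 (@hball R n.+1) = b'%:E.
  by rewrite fineK// ge0_fin_numE// hball_fin.
have b0 : 0 <= b by exact: fine_ge0.
have b'0 : 0 <= b' by exact: fine_ge0.
have [N [NE N1]] : exists N : R, N = n.+2%:R /\ 1 <= N by exists n.+2%:R; rewrite ler1n.
have N0 : 0 <= N by lra.
have [tau [tauE tau0]] : exists tau : R, tau = (4 * N)^-1 /\ 0 < tau.
  by exists (4 * N)^-1; rewrite invr_gt0; split => //; lra.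
have [C [CE C0]] : exists C : R, C = N * (2 / tau * b') /\ 0 <= C.
  exists (N * (2 / tau * b')); split => //.
  by apply: (mulr_ge0 N0); apply: mulr_ge0 => //; apply: divr_ge0 => //; exact: ltW.
have {}bE : exists2 b : R, leb B = b%:E & 0 <= b by exists b.
move: b' b'E b'0 CE bE => {b b0} b' b'E b'0 CE [b bE b0].
exists (2 * b + C); split=> [|d d0 d1]; first by lra.
have [dh|dh] := ltP (1 / 2) d.
  apply: (@le_trans _ _ (leb B)).
    apply: le_measure; rewrite ?inE; [exact: measurable_enorm_set|exact: measurable_hball|].
    move=> x /= /andP[_]; rewrite /hball /= => h.
    by rewrite -(@ltr_pXn2r _ 2)// ?nnegrE ?enorm_ge0// expr1n.
  rewrite bE lee_fin.
  have h1 : 0 <= C * d by rewrite mulr_ge0// ltW.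
  have h2 : b * (1 / 2) <= b * d by rewrite ler_wpM2l// ltW.
  by lra.
pose A (k : nat) : set rV := shell_part (inord k) tau d.
have mA k : measurable (A k) by exact: measurable_shell_part.
apply: (@le_trans _ _ (leb (\big[setU/set0]_(k < n.+2) A k))).
  apply: le_measure; rewrite ?inE.
  - exact: measurable_enorm_set.
  - by apply: bigsetU_measurable.
  move=> x /= hx; rewrite -bigcup_mkord.
  have [i hi] : exists i, tau <= x ord0 i ^+ 2.
    apply: contrapT => /forallNP hn; have /andP[h1 _] := hx.
    have : enorm x ^+ 2 <= \sum_(i < n.+2) tau.
      rewrite enorm2 /edot; apply: ler_sum => i _; rewrite -expr2 ltW//.
      by rewrite ltNge; apply/negP; exact: hn.
    rewrite sumr_const card_ord -mulr_natl -NE tauE.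
    suff -> : N * (4 * N)^-1 = 1 / 4 by lra.
    by field; rewrite gt_eqF//; lra.
  exists (i : nat) => //=; rewrite /A /shell_part /= inord_val; split=> //.
  rewrite -(@ler_pXn2r _ 2)// ?nnegrE ?(ltW tau0)//.
  rewrite real_normK ?num_real// (le_trans _ hi)// expr2 ger_pMl//.
  by rewrite tauE invf_le1; lra.
apply: (@le_trans _ _ (\sum_(k < n.+2) leb (A k))%E).
  exact: (Boole_inequality leb (fun k _ => mA k)).
apply: (@le_trans _ _ (\sum_(k < n.+2) (2 * d / tau * b')%:E)%E).
  apply: lee_sum => k _; rewrite EFinM -b'E.
  by have := shell_part_measure (inord k) tau d tau0 d0.
rewrite sumEFin lee_fin sumr_const card_ord -[_ *+ n.+2]mulr_natl -NE.
have -> : N * (2 * d / tau * b') = C * d by rewrite CE; ring.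
by rewrite [leRHS]mulrDl lerDr; apply: mulr_ge0; [lra|exact: ltW].
Qed.

End Shells.

Section Integrability.
Context {R : realType} {n : nat}.
Local Notation rV := 'rV[R]_n.+2.
Local Notation leb := (lebesgue_rV R n.+2).
Local Notation B := (@hball R n.+2).
Local Open Scope classical_set_scope.
Implicit Types (x : rV) (j : nat).

(** The shell of index [j] has measure of order [2 ^- j], which cancels the factor [2 ^+ j] of the
    bound on [f]; the geometric series of ratio [th] remains, and monotone convergence along [G j]
    concludes. *)
Lemma integrable_shells (f : rV -> R) (K th : R) : measurable_fun setT f ->
  (forall x, B x -> 0 <= f x) -> 0 <= K -> 0 < th -> th < 1 ->
  (forall j x, 1 - (1 / 2) ^+ j <= enorm x ^+ 2 < 1 - (1 / 2) ^+ j.+1 ->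
     f x <= K * 2 ^+ j * th ^+ j) ->
  leb.-integrable B (EFin \o f).
Proof.
move=> mf f0 K0 th0 th1 hf; have [C [C0 hC]] := @shell_measure R n.
have mB := measurable_hball (R := R) n.+2.
have h0 j : 0 < (1 / 2 : R) ^+ j by apply: exprn_gt0.
pose G j : set rV := [set x : rV | 0 <= enorm x ^+ 2 < 1 - (1 / 2) ^+ j].
pose L j : set rV := [set x : rV | 1 - (1 / 2) ^+ j <= enorm x ^+ 2 < 1 - (1 / 2) ^+ j.+1].
have mG j : measurable (G j) by exact: measurable_enorm_set.
have mL j : measurable (L j) by exact: measurable_enorm_set.
have inB x : enorm x ^+ 2 < 1 -> B x.
  by move=> h; rewrite /hball /= -(@ltr_pXn2r _ 2)// ?nnegrE ?enorm_ge0// expr1n.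
have GB j : G j `<=` B by move=> x /= /andP[_ h]; apply: inB; have := h0 j; lra.
have LB j : L j `<=` B by move=> x /= /andP[_ h]; apply: inB; have := h0 j.+1; lra.
have hS j : (1 / 2 : R) ^+ j.+1 = (1 / 2) ^+ j / 2 by rewrite exprS; field.
have GS j : G j.+1 = G j `|` L j.
  apply/seteqP; split => x /=.
    move=> /andP[h1 h2]; have [h3|h3] := ltP (enorm x ^+ 2) (1 - (1 / 2) ^+ j).
      by left; apply/andP.
    by right; apply/andP.
  move=> [/andP[h1 h2]|/andP[h1 h2]]; apply/andP; split=> //.
    by have := h0 j; rewrite hS; lra.
  exact: sqr_ge0.
have mEf : measurable_fun setT (EFin \o f) by exact/measurable_EFinP.
have intL j : (\int[leb]_(x in L j) (f x)%:E <= (K * C * th ^+ j)%:E)%E.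
  have c0 : 0 <= K * 2 ^+ j * th ^+ j.
    by apply: mulr_ge0; [apply: mulr_ge0 => //; exact: exprn_ge0|apply: exprn_ge0; exact: ltW].
  apply: (@le_trans _ _ (\int[leb]_(x in L j) (K * 2 ^+ j * th ^+ j)%:E)%E).
    apply: ge0_le_integral => //.
    - by move=> x Lx; rewrite lee_fin f0//; exact: (LB j).
    - exact: measurable_funTS.
    - by move=> x Lx; rewrite lee_fin; exact: hf.
  rewrite integral_cst//.
  have le1 : (leb (L j) <= (C * (1 / 2) ^+ j)%:E)%E.
    apply: le_trans (hC _ (h0 j) _); last first.
      by rewrite exprn_ile1//; lra.
    apply: le_measure; rewrite ?inE//; first exact: measurable_enorm_set.
    by move=> x /= /andP[h1 h2]; apply/andP; split=> //; have := h0 j.+1; lra.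
  apply: le_trans (lee_wpmul2l _ le1) _; first by rewrite lee_fin.
  rewrite -EFinM lee_fin le_eqVlt; apply/orP; left; apply/eqP.
  have : 2 ^+ j * (1 / 2) ^+ j = 1 :> R by rewrite -exprMn mulrC divfK ?expr1n.
  move: (2 ^+ j) ((1 / 2) ^+ j) (th ^+ j) => p r s pr.
  by rewrite [LHS](_ : _ = K * C * s * (p * r)); [rewrite pr mulr1|ring].
have intG j : (\int[leb]_(x in G j) (f x)%:E <= (K * C * (1 - th ^+ j) / (1 - th))%:E)%E.
  elim: j => [|j IHj].
    rewrite (_ : G 0%N = set0) ?integral_set0 ?expr0 ?subrr ?mulr0 ?mul0r//.
    by apply/seteqP; split => // x; rewrite /G /= expr0 subrr => /andP[h1 h2]; lra.
  rewrite GS ge0_integral_setU//.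
  - apply: le_trans (leeD IHj (intL j)) _.
    rewrite -EFinD lee_fin le_eqVlt; apply/orP; left; apply/eqP.
    by rewrite exprS; move: (th ^+ j) => s; field; rewrite subr_eq0 gt_eqF.
  - exact: measurable_funTS.
  - by move=> x [/(GB j)|/(LB j)] Bx; rewrite lee_fin f0.
  - apply/disj_setPS => x [/= /andP[_ h1] /andP[h2 _]]; lra.
apply/integrableP; split; first exact: measurable_funTS.
have -> : (\int[leb]_(x in B) `|(EFin \o f) x| = \int[leb]_(x in B) (f x)%:E)%E.
  by apply: eq_integral => x /[!inE] Bx; rewrite /= ger0_norm ?f0.
have UG : \bigcup_j G j = B.
  apply/seteqP; split => [x [j _]|x Bx]; first exact: GB.
  have y0 : 0 < 1 - enorm x ^+ 2 by rewrite subr_gt0 expr_lt1// enorm_ge0.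
  have [j hj] : exists j, (1 / 2) ^+ j < 1 - enorm x ^+ 2.
    apply: contrapT => /forallNP hn; move: y0; apply/negP; rewrite -leNgt.
    apply: (half_pow_small 1) => j; have /negP := hn j.
    by rewrite -leNgt expr_div_n expr1n.
  by exists j => //=; apply/andP; split; [exact: sqr_ge0|lra].
have cvG := @ge0_nondecreasing_set_cvg_integral _ _ R G (EFin \o f) leb _ mG.
apply: (@le_lt_trans _ _ (K * C / (1 - th))%:E); last exact: ltry.
rewrite -UG; apply: (cvge_to_le (cvG _ _ _)).
- move=> i j ij; apply/subsetPset => x /= /andP[h1 h2]; apply/andP; split=> //.
  apply: (lt_le_trans h2); rewrite lerD2l lerN2.
  by apply: ler_wiXn2l => //; lra.
- by move=> j; exact: measurable_funTS.
- by move=> j x /(GB j) Bx; rewrite lee_fin f0.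
- near=> j; apply: le_trans (intG j) _.
  rewrite lee_fin ler_pM2r ?invr_gt0 ?subr_gt0//.
  rewrite -[leRHS]mulr1; apply: ler_wpM2l; first exact: mulr_ge0.
  by rewrite lerBlDr lerDl exprn_ge0// ltW.
Unshelve. all: by end_near. Qed.

End Integrability.

Section FiniteEnergy.
Context {R : realType} (n : nat) (lam q a : R) (U V : R -> R).
Hypothesis (n5 : (5 < n.+1)%N) (lam0 : 0 < lam) (q0 : 0 < q).
Hypothesis o : radial_ode n.+1 lam q a U V.
Local Notation rV := 'rV[R]_n.+2.
Local Notation leb := (lebesgue_rV R n.+2).
Local Notation B := (@hball R n.+2).
Local Notation force := (force lam q).
Local Notation flux := (flux n V).
Implicit Types (x : rV) (i : 'I_n.+2).

Hypothesis dec : decaying n.+1 U V.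
Local Notation u := (radial_fun n U).
Local Notation g := (radial_grad n V).
Local Notation density := (fun x => (hgrad_dot x (g x) (g x) + u x ^+ 2) * conformal_factor x ^+ n.+2).

(** Equality away from the origin; at the origin [enorm x * (enorm x)^-1] is 0 instead of 1. *)
Lemma hgrad_dot_le x : B x -> hgrad_dot x (g x) (g x) <= V (hdist (enorm x)) ^+ 2.
Proof.
rewrite /hball /= => x1.
have d0 := conf_den _ (introT andP (conj (enorm_ge0 _ x) x1)).
have -> : hgrad_dot x (g x) (g x) =
    V (hdist (enorm x)) ^+ 2 * (enorm x * (enorm x)^-1) ^+ 2.
  rewrite [in RHS]exprMn enorm2 /hgrad_dot /edot mulr_sumr mulr_suml mulr_sumr.
  apply: eq_bigr => i _; rewrite mxE; move: (x ord0 i) (V _) ((enorm x)^-1) => xi v ri.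
  by rewrite /conf; move: (1 - _) d0 => y y0; field; rewrite gt_eqF.
rewrite -[leRHS]mulr1 ler_wpM2l ?sqr_ge0// exprn_ile1//.
  by rewrite mulr_ge0 ?invr_ge0 ?enorm_ge0.
by have [->|h] := eqVneq (enorm x) 0; rewrite ?mul0r// divff.
Qed.

Lemma density_ge0 x : B x -> 0 <= density x.
Proof.
rewrite /hball /= => x1.
have hr : 0 <= enorm x < 1 by rewrite enorm_ge0.
apply: mulr_ge0; last by rewrite exprn_ge0// ltW// conf_gt0.
apply: addr_ge0; last exact: sqr_ge0.
by apply: mulr_ge0; [exact: sqr_ge0|exact: edot_ge0].
Qed.

Lemma measurable_density : measurable_fun setT density.
Proof.
have mg := measurable_grad n lam q a U V o.
apply: measurable_funM; last exact: measurable_conf_radial.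
apply: measurable_funD; last first.
  by apply: measurable_funX; exact: (measurable_radial_fun n lam q a U V o).
apply: measurable_funM.
  apply: measurable_funX; apply: measurable_funM => //.
  apply: measurable_funB => //; apply: measurable_funX; exact: measurable_enorm.
by apply: measurable_sum => i; exact: measurable_funM.
Qed.

Lemma expRN_hdist_le (r : R) : 0 <= r < 1 -> expR (- hdist r) <= 1 - r ^+ 2.
Proof.
move=> h; rewrite expRN_hdist//; case/andP: h => r0 r1.
have h1 : 0 < 1 + r by lra.
by rewrite ler_pdivrMr//; nra.
Qed.

(** Put [y = 1 - |x| ^+ 2], so that [expR (- t) <= y]. The squares of [U] and [V] are at most [C ^+
    2 * y ^+ n.+1 * expR (- (2 * r' * t))], and the weight [(2 / y) ^+ n.+2] leaves a single factor
    [y^-1], of order [2 ^+ j] on the shell of index [j]. *)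
Lemma hintegrable_density : leb.-integrable B (EFin \o density).
Proof.
have [C [r' [r'0 hC]]] := dec.
(* On the shell of index [j], [t >= j * ln 2], so the surplus decay [expR (- (2 * r' * t))] is at
   most [th ^+ j]. *)
pose th := expR (- (2 * r' * ln 2)).
have ln2 : 0 < ln 2 :> R by rewrite ln_gt0// ltr1n.
have th0 : 0 < th by exact: expR_gt0.
have th1 : th < 1.
  by rewrite /th -[X in _ < X]expR0 ltr_expR oppr_lt0 !mulr_gt0.
have K0 : 0 <= C ^+ 2 * 2 ^+ n.+4 by rewrite mulr_ge0 ?sqr_ge0 ?exprn_ge0.
apply: (integrable_shells _ (C ^+ 2 * 2 ^+ n.+4) th) => //.
- exact: measurable_density.
- exact: density_ge0.
move=> j x /andP[x1 x2].
have hj : 0 < (1 / 2 : R) ^+ j.+1 by apply: exprn_gt0.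
have Bx : B x.
  rewrite /hball /= -(@ltr_pXn2r _ 2)// ?nnegrE ?enorm_ge0// expr1n; lra.
have hr : 0 <= enorm x < 1 by rewrite enorm_ge0.
have [hU hV] := hC _ (hdist_ge0 _ hr).
have hV2 := hgrad_dot_le x Bx.
have eT := expRN_hdist_le _ hr.
have t0 := hdist_ge0 _ hr; have y0 := conf_den _ hr.
rewrite /radial_fun /conformal_factor.
set t := hdist (enorm x) in hU hV hV2 eT t0 *.
have yj : 1 - enorm x ^+ 2 <= (1 / 2) ^+ j by lra.
have jy : (1 / 2) ^+ j.+1 < 1 - enorm x ^+ 2 by lra.
move: (1 - enorm x ^+ 2) y0 yj jy eT => y y0 yj jy eT {x1 x2}.
pose E := expR (- (n.+1%:R / 2 + r') * t).
have EE : E ^+ 2 = expR (- t) ^+ n.+1 * expR (- (2 * r' * t)).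
  rewrite /E -expRM_natl -expRM_natl -expRD; congr expR.
  by rewrite -mulr_natl; field.
have Fth : expR (- (2 * r' * t)) <= th ^+ j.
  rewrite /th -expRM_natl ler_expR.
  have tj : j%:R * ln 2 <= t.
    have : expR (- t) <= expR (- (j%:R * ln 2)).
      by rewrite (le_trans eT)// (le_trans yj)// -mulrN expRM_natl expRN lnK ?posrE// div1r.
    by rewrite ler_expR lerN2.
  have : 2 * r' * (j%:R * ln 2) <= 2 * r' * t by rewrite ler_wpM2l// mulr_ge0// ltW.
  by lra.
have sq (w : R) : `|w| <= C * E -> w ^+ 2 <= C ^+ 2 * E ^+ 2.
  move=> h; rewrite -exprMn -(real_normK (num_real w)) lerXn2r ?nnegrE//.
  exact: le_trans h.
have C2 := sqr_ge0 C.
have d1 : hgrad_dot x (g x) (g x) + U t ^+ 2 <= 2 * (C ^+ 2 * E ^+ 2).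
  by have := sq _ hU; have := sq _ hV; lra.
have iy0 : 0 < y^-1 by rewrite invr_gt0.
have iyj : y^-1 <= 2 ^+ j.+1.
  move: jy; rewrite expr_div_n expr1n div1r => /ltW jy.
  by rewrite -[leRHS]invrK lef_pV2// posrE invr_gt0 exprn_gt0.
have ek : expR (- t) ^+ n.+1 <= y ^+ n.+1 by rewrite lerXn2r ?nnegrE ?expR_ge0// ltW.
have F0 : 0 <= expR (- (2 * r' * t)) by exact: expR_ge0.
apply: (@le_trans _ _ (2 * (C ^+ 2 * (y ^+ n.+1 * expR (- (2 * r' * t)))) * (2 / y) ^+ n.+2)).
  rewrite ler_wpM2r ?exprn_ge0 ?divr_ge0 ?(ltW y0)// (le_trans d1)//.
  by rewrite ler_wpM2l// ler_wpM2l// EE ler_wpM2r.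
have -> : 2 * (C ^+ 2 * (y ^+ n.+1 * expR (- (2 * r' * t)))) * (2 / y) ^+ n.+2 =
    C ^+ 2 * 2 ^+ n.+3 * (expR (- (2 * r' * t)) * y^-1).
  rewrite expr_div_n (exprS y n.+1) (exprS 2 n.+2).
  have yn0 : y ^+ n.+1 != 0 by rewrite expf_neq0// gt_eqF.
  move: (y ^+ n.+1) (2 ^+ n.+2) (expR _) yn0 => z w F z0.
  by field; rewrite z0 gt_eqF.
have -> : C ^+ 2 * 2 ^+ n.+4 * 2 ^+ j * th ^+ j = C ^+ 2 * 2 ^+ n.+3 * (th ^+ j * 2 ^+ j.+1).
  rewrite (exprS 2 n.+3) (exprS 2 j).
  by move: (2 ^+ n.+3) (2 ^+ j) (th ^+ j) => z w F; ring.
have c0 : 0 <= C ^+ 2 * 2 ^+ n.+3 by apply: mulr_ge0 => //; exact: exprn_ge0.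
by apply: ler_wpM2l => //; apply: ler_pM => //; exact: ltW.
Qed.

Lemma radial_H1 : H1 u.
Proof.
exists g; first exact: (radial_weak_gradient n lam q a U V lam0 q0 o).
exact: hintegrable_density.
Qed.

End FiniteEnergy.

(** * Distinct profiles give distinct solutions; conclusion *)

Section NonTrivial.
Context {R : realType} (n : nat).
Local Notation rV := 'rV[R]_n.+2.
Local Notation leb := (lebesgue_rV R n.+2).
Local Notation B := (@hball R n.+2).

Lemma ae_near (P : rV -> Prop) (x0 : rV) : {ae leb, forall x, P x} ->
  (\forall x \near x0, ~ P x) -> False.
Proof.
move=> [Z [mZ Z0 PZ]] /nbhs_ballP[e /= e0 he].
have : (leb (ball x0 e) <= leb Z)%E.
  apply: le_measure; rewrite ?inE//; first exact: measurable_rV_ball.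
  by move=> x /he nP; exact: PZ.
by rewrite Z0 lebesgue_rV_ball// lee_fin leNgt exprn_gt0// mulrn_wgt0.
Qed.

Lemma hdist_surj (t : R) : 0 <= t -> exists2 r, 0 <= r < 1 & hdist r = t.
Proof.
move=> t0; have e1 : 1 <= expR t by rewrite -[leLHS]expR0 ler_expR.
pose r := (expR t - 1) / (expR t + 1).
have d0 : 0 < expR t + 1 by lra.
have hr : 0 <= r < 1.
  by rewrite divr_ge0 ?ltr_pdivrMr//; lra.
exists r => //; apply: expR_inj; rewrite expR_hdist// /r.
move: (expR t) e1 d0 => e e1 d0; field.
by apply/andP; split; rewrite gt_eqF//; lra.
Qed.

(** Continuous profiles that differ at [t] differ on a neighbourhood of a point at distance [t] from
    the origin, which has positive measure. *)
Lemma not_hae_eq (U1 U2 : R -> R) (t : R) : 0 <= t -> (forall t, cont U1 t) ->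
  (forall t, cont U2 t) -> U1 t != U2 t ->
  ~ hae_eq (radial_fun n U1) (radial_fun n U2).
Proof.
move=> t0 c1 c2 U12 ae; have [r hr rt] := hdist_surj t t0.
pose x0 : rV := rV_ins ord0 r 0.
have x0r : enorm x0 = r.
  by rewrite enorm_insE enorm0 expr0n addr0 sqrtr_sqr ger0_norm//; case/andP: hr.
apply: (ae_near _ x0 ae).
have chd : {for x0, continuous (fun x : rV => hdist (enorm x))}.
  apply: (@continuous_comp _ _ _ (@enorm R n.+2) hdist); first exact: continuous_enorm.
  by rewrite x0r; exact: der_cont (der_hdist r hr).
have cd : {for x0, continuous (fun x : rV => U1 (hdist (enorm x)) - U2 (hdist (enorm x)))}.
  apply: (@continuous_comp _ _ _ (fun x : rV => hdist (enorm x)) (fun t => U1 t - U2 t)) => //.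
  by apply: contD; [exact: c1|apply: contN; exact: c2].
have d0 : U1 (hdist (enorm x0)) - U2 (hdist (enorm x0)) != 0.
  by rewrite x0r rt subr_eq0.
have near1 : \forall x \near x0, U1 (hdist (enorm x)) - U2 (hdist (enorm x)) != 0.
  exact: (cvgr_neq0 _ cd d0).
have near2 : \forall x \near x0, enorm x < 1.
  apply: (cvgr_lt _ (@continuous_enorm R n.+2 x0)).
  by rewrite x0r; case/andP: hr.
near=> x; move=> /(_ _)/= h.
have : U1 (hdist (enorm x)) - U2 (hdist (enorm x)) != 0 by near: x.
have x1 : enorm x < 1 by near: x.
by rewrite subr_eq0 => /eqP; apply; exact: h.
Unshelve. all: by end_near. Qed.

End NonTrivial.

Lemma radial_solution (R : realType) (n : nat) (lam p a : R) (U V : R -> R) :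
  (5 < n.+1)%N -> 0 < lam -> 0 < p - 1 -> radial_ode n.+1 lam (p - 1) a U V ->
  decaying n.+1 U V -> a != 0 -> nontrivial_radial_solution lam p (radial_fun n U).
Proof.
move=> n5 lam0 q0 o dec a0; split.
- exact: (radial_H1 _ _ _ _ _ _ lam0 q0 o dec).
- exact: (radial_weak_solution _ _ _ _ _ _ n5 lam0 q0 o p erefl).
- exact: radial_radial_fun.
- apply: (not_hae_eq _ U (fun=> 0) 0 (lexx _)).
  + exact: ro_contU o.
  + by move=> t; exact: contC.
  + by rewrite (ro_U0 _ _ _ _ _ _ o).
Qed.

Lemma decayingN (R : realType) k (U V : R -> R) : decaying k U V ->
  decaying k (fun t => - U t) (fun t => - V t).
Proof.
by move=> [C [r [r0 h]]]; exists C, r; split=> // t t0; rewrite !normrN; exact: h.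
Qed.

Lemma radial_funN (R : realType) n (U : R -> R) :
  - radial_fun n U = radial_fun n (fun t => - U t).
Proof. exact/funext. Qed.

Theorem theorem5p5 (R : realType) (N : nat) (lambda p : R) :
  (7 <= N)%N ->
  p = (N%:R + 2) / (N%:R - 2) ->
  N%:R * (N%:R - 2) / 4 < lambda ->
  lambda < ((N%:R - 1) / 2) ^+ 2 ->
  exists u v : 'rV[R]_N -> R,
    [/\ nontrivial_radial_solution lambda p u,
        nontrivial_radial_solution lambda p (- u),
        nontrivial_radial_solution lambda p v &
        nontrivial_radial_solution lambda p (- v)]
    /\ ~ hae_eq u v /\ ~ hae_eq u (- v).
Proof.
case: N => [|[|n]]// N7 pE lam_lo lam_hi.
have n5 : (5 < n.+1)%N by [].
(* An opaque real [N] lets [lra] and [field] treat the dimension as a single atom. *)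
have [N NE] : exists N : R, n.+2%:R = N by exists n.+2%:R.
have kE : n.+1%:R = N - 1 :> R by rewrite -NE -[n.+2%:R]natr1 addrK.
have N7' : 7 <= N by rewrite -NE ler_nat.
rewrite NE in pE lam_lo lam_hi.
have lam0 : 0 < lambda.
  by apply: le_lt_trans lam_lo; rewrite divr_ge0// mulr_ge0//; lra.
have qE : p - 1 = 2 / ((n.+1%:R - 1) / 2).
  by rewrite pE kE; field; rewrite gt_eqF; lra.
have q0 : 0 < p - 1 by rewrite qE kE !divr_gt0//; lra.
have mu0 : 0 < lambda - ((n.+1%:R - 1) / 2) ^+ 2 - (n.+1%:R - 1) / 2.
  by rewrite kE; move: lam_lo; lra.
rewrite -kE in lam_hi.
have [A A0 hA] := large_amplitude n.+1 lambda (p - 1) n5 qE mu0.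
pose u := sol n.+1 lambda (p - 1) A lam0 q0 (ltW A0).
pose v := sol' n.+1 lambda (p - 1) A lam0 q0 (ltW A0).
have ode b : 0 <= b <= A -> radial_ode n.+1 lambda (p - 1) b (u b) (v b).
  move=> /andP[b0 bA]; apply: radial_ode_sol => //.
  by rewrite ger0_norm.
have [C [K dist]] := sol_dist n.+1 lambda (p - 1) A lam0 q0 (ltW A0).
have uA : goes_neg_pos (u A) by apply: hA; apply: ode; rewrite (ltW A0) lexx.
have uA1 : goes_neg (u A) by have [s1 [_ [s10 _ s1n _]]] := uA; exists s1.
have [b1 [/andP[b10 b1A] pos1 dec1]] := positive_profile n.+1 lambda (p - 1) isT lam0 q0 lam_hi
  u v A C K ode dist A0 uA1.
have [b2 [/andP[b20 b2A] [t2 t20 neg2] dec2]] := sign_changing_profile n.+1 lambda (p - 1) isT lam0 q0 lam_hi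
  u v A C K ode dist A0 uA.
have o1 : radial_ode n.+1 lambda (p - 1) b1 (u b1) (v b1) by apply: ode; rewrite b1A ltW.
have o2 : radial_ode n.+1 lambda (p - 1) b2 (u b2) (v b2) by apply: ode; rewrite b2A ltW.
exists (radial_fun n (u b1)), (radial_fun n (u b2)); rewrite !radial_funN; split; first split.
- exact: (radial_solution _ _ _ _ _ _ _ n5 lam0 q0 o1 dec1 (lt0r_neq0 b10)).
- apply: (radial_solution _ _ _ _ _ _ _ n5 lam0 q0 (radial_odeN _ _ _ _ _ _ o1) (decayingN _ _ _ _ dec1)).
  by rewrite oppr_eq0 lt0r_neq0.
- exact: (radial_solution _ _ _ _ _ _ _ n5 lam0 q0 o2 dec2 (lt0r_neq0 b20)).
- apply: (radial_solution _ _ _ _ _ _ _ n5 lam0 q0 (radial_odeN _ _ _ _ _ _ o2) (decayingN _ _ _ _ dec2)).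
  by rewrite oppr_eq0 lt0r_neq0.
have cU1 := ro_contU _ _ _ _ _ _ o1; have cU2 := ro_contU _ _ _ _ _ _ o2.
split.
  (* The first profile is positive everywhere and the second negative at [t2], so they differ there;
     the first differs from the opposite of the second at 0, where the values are [b1 > 0] and
     [- b2 < 0]. *)
  apply: (not_hae_eq _ _ _ t2 (ltW t20)) => //.
  by rewrite gt_eqF// (lt_trans neg2)// pos1// ltW.
apply: (not_hae_eq _ _ (fun t => - u b2 t) 0 (lexx _)) => //.
  by move=> t; apply: contN.
rewrite (ro_U0 _ _ _ _ _ _ o1) (ro_U0 _ _ _ _ _ _ o2) gt_eqF//.
by rewrite (lt_trans _ b10)// oppr_lt0.
Qed.
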